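(* Let $\Omega\subset\mathbb{R}^n$, $n\ge2$, be open, let $v,f:\Omega\to\mathbb{R}$ with $f\in L^\infty_{loc}(\Omega)$, and assume that $v\in C^{1,1}(\Omega)$ satisfies $\Delta v=f$ a.e. in $\Omega$. Then, for every $x\in\Omega$ and every $0<\varepsilon<\mathrm{dist}(x,\partial\Omega)$, $$(\mathcal A_\varepsilon-I)[v](x)=\int_0^\varepsilon A_r[f](x)\,\frac{r}{n}\,dr=\int_0^\varepsilon\mathcal A_r[f](x)\,\mathcal K_\varepsilon(r)\,dr,$$ where $$\mathcal K_\varepsilon(r)=\begin{cases}\dfrac{r}{n-2}\Big(1-\big(\tfrac{r}{\varepsilon}\big)^{n-2}\Big)&\text{if }n\ge3,\\[6pt] r\log\big(\tfrac{\varepsilon}{r}\big)&\text{if }n=2.\end{cases}$$ Moreover, for a.e. $x\in\Omega$ and every $0<\varepsilon<\mathrm{dist}(x,\partial\Omega)$, $$(\mathcal A_\varepsilon-I)[v](x)=\frac{f(x)}{2n}\,\varepsilon^2+\mathcal R_\varepsilon(x),\qquad(\ast)$$ where $$\mathcal R_\varepsilon(x)=\int_0^\varepsilon A_r\big[f(\cdot)-f(x)\big](x)\,\frac{r}{n}\,dr=\int_0^\varepsilon\mathcal A_r\big[f(\cdot)-f(x)\big](x)\,\mathcal K_\varepsilon(r)\,dr .$$ In addition: (1) If $f$ is continuous at $x$, then $\mathcal R_\varepsilon(x)=o(\varepsilon^2)$ as $\varepsilon\to0$. If $f\in C(\Omega)$, then $(\ast)$ holds for every $x\in\Omega$ (and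 every $0<\varepsilon<\mathrm{dist}(x,\partial\Omega)$), and $\mathcal R_\varepsilon=o(\varepsilon^2)$ as $\varepsilon\to0$ locally uniformly in $\Omega$. (2) If $|f(x)-f(y)|\le\omega(|x-y|)$ for all $x,y\in\Omega$, where $\omega:[0,\infty)\to[0,\infty)$ is non-decreasing with $\lim_{t\to0^+}\omega(t)=0$, then $|\mathcal R_\varepsilon(x)|\le\frac{1}{2n}\,\omega(\varepsilon)\,\varepsilon^2$ for every $0<\varepsilon<\mathrm{dist}(x,\partial\Omega)$. (3) If $f$ is Hölder or Lipschitz continuous in $\Omega$ with exponent $\alpha\in(0,1]$, then $\mathcal R_\varepsilon=O(\varepsilon^{2+\alpha})$, i.e. there is a constant $C$ with $|\mathcal R_\varepsilon(x)|\le C\varepsilon^{2+\alpha}$ for all $x\in\Omega$ and $0<\varepsilon<\mathrm{dist}(x,\partial\Omega)$.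
   Context: $A_r[g](x)=\frac{1}{|B_r(x)|}\int_{B_r(x)}g(y)\,dy$ is the ball average, $\mathcal A_r[g](x)=\frac{1}{\mathcal H^{n-1}(\partial B_r(x))}\int_{\partial B_r(x)}g\,d\mathcal H^{n-1}$ is the spherical average, and $I$ is the identity. For $f\in L^\infty_{loc}(\Omega)$ and fixed $x$, $\mathcal A_r[f](x)$ is defined for a.e. $r\in(0,\mathrm{dist}(x,\partial\Omega))$. In $A_r[f(\cdot)-f(x)](x)$ the number $f(x)$ is a constant with respect to the averaging variable. $C^{1,1}(\Omega)$ denotes the $C^1(\Omega)$ functions whose first-order partial derivatives are locally Lipschitz in $\Omega$. If $\Omega=\mathbb{R}^n$, $\mathrm{dist}(x,\partial\Omega)=+\infty$. ''$\mathcal R_\varepsilon=o(\varepsilon^k)$ as $\varepsilon\to0$ locally uniformly in $\Omega$'' means: for every compact $K\subset\Omega$ and every $\eta>0$ there is $\varepsilon_0>0$ such that $\operatorname{ess\,sup}_{x\in K}|\mathcal R_\varepsilon(x)|\le\eta\,\varepsilon^k$ for all $0<\varepsilon<\varepsilon_0$. *)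

(* Defs.v *)
From HB Require Import structures.
From mathcomp Require Import all_boot all_order all_algebra.
From mathcomp Require Import all_classical all_reals all_analysis.
From mathcomp Require Import ess_sup_inf.

Set Implicit Arguments.
Unset Strict Implicit.
Unset Printing Implicit Defensive.

Import Order.TTheory GRing.Theory Num.Theory.
Import numFieldNormedType.Exports.

Local Open Scope classical_set_scope.
Local Open Scope ring_scope.

(* Outer measure generated by a gauge tau on the sets S i, i \in C: the infimum
   of the total gauge over the at most countable coverings of A.  A covering is
   a sequence in option I, None standing for an unused term, so that the empty
   set always has the empty covering. *)
Definition countable_cover (T I : Type) (C : set I) (S : I -> set T)
    (A : set T) : set (nat -> option I) :=
  [set F | (forall k i, F k = Some i -> C i) /\
           A `<=` \bigcup_k oapp S set0 (F k)].

Definition cover_outer (R : realType) (T I : Type) (C : set I)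
    (S : I -> set T) (tau : I -> \bar R) (A : set T) : \bar R :=
  ereal_inf [set (\sum_(k <oo) oapp tau 0 (F k))%E
            | F in countable_cover C S A].

Section cover_outer_theory.
Context (R : realType) (T I : Type) (C : set I) (S : I -> set T)
  (tau : I -> \bar R).
Context (tau_ge0 : forall i, C i -> (0 <= tau i)%E).
Local Open Scope ereal_scope.
Local Notation mu := (cover_outer C S tau).

Lemma cover_term_ge0 A F : countable_cover C S A F ->
  forall k, 0 <= oapp tau 0 (F k).
Proof.
move=> [CF _] k; case Fk : (F k) => [i|]//=; exact/tau_ge0/(CF k).
Qed.

Lemma cover_outer_ge0 A : 0 <= mu A.
Proof.
apply: le_ereal_inf_tmp => _ [F cF <-]; apply: nneseries_ge0 => k _ _.
exact: (cover_term_ge0 cF).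
Qed.

Lemma le_cover_outer : {homo mu : A B / A `<=` B >-> A <= B}.
Proof.
move=> A B AB; apply: ereal_inf_le_tmp => _ [F [CF BF] <-].
by exists F => //; split => //; exact: subset_trans AB BF.
Qed.

Lemma cover_outer0 : mu set0 = 0.
Proof.
apply/eqP; rewrite eq_le cover_outer_ge0 andbT.
apply: ereal_inf_lbound; exists (fun=> None); first by split.
by rewrite /= eseries0.
Qed.

Lemma cover_outer_sigma_subadditive : sigma_subadditive mu.
Proof.
move=> A; have [[i ioo]|] := pselect (exists i, mu (A i) = +oo).
  rewrite (eseries_pinfty _ _ ioo) ?leey// => n _.
  by rewrite -ltNye (lt_le_trans _ (cover_outer_ge0 _)).
rewrite -forallNE => Aoo.
suff add2e (e : {posnum R}) :
    mu (\bigcup_n A n) <= \sum_(i <oo) mu (A i) + e%:num%:E.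
  by apply/lee_addgt0Pr => _/posnumP[].
rewrite (le_trans _ (epsilon_trick _ _ _))//; last first.
  by move=> n; exact: cover_outer_ge0.
pose P n (B : nat -> option I) := countable_cover C S (A n) B /\
  \sum_(k <oo) oapp tau 0 (B k) <= mu (A n) + (e%:num / (2 ^ n.+1)%:R)%:E.
have [G PG] : {G : nat -> nat -> option I & forall n, P n (G n)}.
  apply: (@choice _ _ P) => n; rewrite /P /cover_outer.
  set X := (X in ereal_inf X); move infX : (ereal_inf X) => iX.
  case: iX infX => [r Xr|Xoo|Xoo].
  - have en1 : (0 < e%:num / (2 ^ n.+1)%:R)%R by [].
    have /(lb_ereal_inf_adherent en1) : ereal_inf X \is a fin_num by rewrite Xr.
    move=> [x [B cB muBx] xX].
    by exists B; split => //; rewrite muBx -Xr; exact/ltW.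
  - by have := Aoo n; rewrite /cover_outer -/X Xoo.
  - have := cover_outer_ge0 (A n).
    by rewrite /cover_outer -/X Xoo.
pose g x := oapp tau 0 (uncurry G x).
have g_ge0 x : 0 <= g x.
  by case: x => n k; exact: (cover_term_ge0 (PG n).1).
apply: (@le_trans _ _ (\esum_(i in setT) g i)).
  rewrite /cover_outer; apply: ereal_inf_lbound => /=.
  have /card_esym/ppcard_eqP[h] := card_nat2.
  exists (uncurry G \o h).
    split => [k i /=|t [i _]].
      by case: (h k) => a b /= Gi; exact: ((PG a).1.1 b).
    move=> /(PG i).1.2[j _ Bijt]; exists (h^-1%FUN (i, j)) => //=.
    by rewrite invK ?inE.
  rewrite -(esum_pred_image g _ xpredT) ?[fun=> _]set_true//.
  by rewrite image_eq.
rewrite (_ : esum _ _ = \sum_(i <oo) \sum_(j <oo) g (i, j)); last first.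
  pose J : nat -> set (nat * nat) := fun i => [set (i, j) | j in setT].
  rewrite (_ : setT = \bigcup_k J k); last first.
    by rewrite predeqE => -[a b]; split => // _; exists a => //; exists b.
  rewrite esum_bigcupT /=; last 2 first.
    - apply/trivIsetP => i j _ _ ij.
      rewrite predeqE => -[n m] /=; split => //= -[] [_] _ [<-{n} _].
      by move=> [m' _] [] /esym/eqP; rewrite (negbTE ij).
    - by move=> x; exact: g_ge0.
  rewrite -(image_id [set: nat]) -fun_true esum_pred_image//; last first.
    by move=> n _; exact: esum_ge0.
  apply: eq_eseriesr => /= j _.
  rewrite -(esum_pred_image g (pair j) predT)//=; last first.
    by move=> ? ? _ _; exact: (@can_inj _ _ _ snd).
  by congr esum; rewrite predeqE => -[a b]; split; move=> [i _ <-]; exists i.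
apply: lee_lim.
- apply: is_cvg_nneseries => n *.
  by apply: nneseries_ge0 => m *; exact: (g_ge0 (n, m)).
- by apply: is_cvg_nneseries => n *; apply: adde_ge0 => //; exact: cover_outer_ge0.
- by near=> n; apply: lee_sum => i _; exact: (PG i).2.
Unshelve. all: by end_near. Qed.

End cover_outer_theory.

Section euclidean.
Context (R : realType) (n : nat).
Implicit Types (x y : 'rV[R]_n) (r : R).

(* The norm `|x| of the normed module 'rV[R]_n is the maximum norm. *)
Definition enorm x : R := Num.sqrt (\sum_(i < n) x 0 i ^+ 2).

Definition eball x r : set 'rV[R]_n := [set y | enorm (y - x) < r].

Definition esphere x r : set 'rV[R]_n := [set y | enorm (y - x) = r].

(* dist(x, \partial A); it is +oo when the boundary is empty. *)
Definition boundary_dist (A : set 'rV[R]_n) x : \bar R :=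
  ereal_inf [set (enorm (x - y))%:E | y in closure A `\` interior A].

(* The point 0 makes the diameter of set0 equal to 0 rather than -oo. *)
Definition ediam (A : set 'rV[R]_n) : \bar R :=
  ereal_sup (0%E |` [set (enorm (x - y))%:E | x in A & y in A]).

Lemma ediam_ge0 A : (0 <= ediam A)%E.
Proof. by apply: ereal_sup_ubound; left. Qed.

End euclidean.

Section lebesgue.
Context (R : realType) (n : nat).
Local Notation corners := ('rV[R]_n * 'rV[R]_n)%type.

Definition le_corners : set corners :=
  [set ab : corners | forall i, ab.1 0 i <= ab.2 0 i].

Definition box (ab : corners) : set 'rV[R]_n :=
  [set x | forall i, ab.1 0 i < x 0 i <= ab.2 0 i].

Definition box_vol (ab : corners) : \bar R :=
  (\prod_(i < n) (ab.2 0 i - ab.1 0 i))%:E.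

Let box_vol_ge0 ab : le_corners ab -> (0 <= box_vol ab)%E.
Proof. by move=> ab0; rewrite lee_fin prodr_ge0// => i _; rewrite subr_ge0. Qed.

Definition lebesgue_outer : set 'rV[R]_n -> \bar R :=
  cover_outer le_corners box box_vol.

Let lebesgue_outer0 : lebesgue_outer set0 = 0%E.
Proof. exact: cover_outer0. Qed.

Let lebesgue_outer_ge0 A : (0 <= lebesgue_outer A)%E.
Proof. exact: cover_outer_ge0. Qed.

Let le_lebesgue_outer : {homo lebesgue_outer : A B / A `<=` B >-> (A <= B)%E}.
Proof. exact: le_cover_outer. Qed.

Let lebesgue_outer_sigma_subadditive : sigma_subadditive lebesgue_outer.
Proof. exact: cover_outer_sigma_subadditive. Qed.

HB.instance Definition _ := isOuterMeasure.Build R 'rV[R]_n lebesgue_outer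
  lebesgue_outer0 lebesgue_outer_ge0 le_lebesgue_outer
  lebesgue_outer_sigma_subadditive.

(* The measurable sets of this type are the Lebesgue measurable subsets of R^n,
   not only the Borel ones. *)
Definition lebesgue_type := caratheodory_type lebesgue_outer.

HB.instance Definition _ := Measurable.on lebesgue_type.

Definition lebesgue_rV : set lebesgue_type -> \bar R := lebesgue_outer.

HB.instance Definition _ := isMeasure.Build _ _ _ lebesgue_rV
  lebesgue_outer0 lebesgue_outer_ge0
  (@caratheodory_measure_sigma_additive _ _ lebesgue_outer).

End lebesgue.
Arguments lebesgue_rV {R n}.

Section hausdorff.
Context (R : realType) (n m : nat).
Implicit Types (delta : R) (A E : set 'rV[R]_n).

(* |B_1| / 2 ^ m with B_1 the unit ball of R^m: the normalization for which the
   m-dimensional Hausdorff measure on R^m is the Lebesgue measure. *)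
Definition hausdorff_cst : R :=
  fine (lebesgue_rV (eball (0 : 'rV[R]_m) 1)) / 2 ^+ m.

Definition hausdorff_gauge E : \bar R :=
  (hausdorff_cst * fine (ediam E) ^+ m)%:E.

Let hausdorff_gauge_ge0 E : (0 <= hausdorff_gauge E)%E.
Proof.
rewrite lee_fin mulr_ge0 ?exprn_ge0 ?fine_ge0 ?ediam_ge0//.
by rewrite divr_ge0 ?fine_ge0 ?exprn_ge0.
Qed.

Definition hausdorff_pre delta : set 'rV[R]_n -> \bar R :=
  cover_outer [set E | (ediam E <= delta%:E)%E] id hausdorff_gauge.

Definition hausdorff_outer A : \bar R :=
  ereal_sup [set hausdorff_pre delta A | delta in [set delta | 0 < delta]].

Let hausdorff_pre_ge0 delta A : (0 <= hausdorff_pre delta A)%E.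
Proof. exact: cover_outer_ge0. Qed.

Let hausdorff_outer_ge0 A : (0 <= hausdorff_outer A)%E.
Proof.
apply: (le_trans (hausdorff_pre_ge0 1 A)).
by apply: ereal_sup_ubound; exists 1 => //=.
Qed.

Let hausdorff_outer0 : hausdorff_outer set0 = 0%E.
Proof.
apply/eqP; rewrite eq_le hausdorff_outer_ge0 andbT.
by apply: ge_ereal_sup => _ [d _ <-]; rewrite /hausdorff_pre cover_outer0.
Qed.

Let le_hausdorff_outer :
  {homo hausdorff_outer : A B / A `<=` B >-> (A <= B)%E}.
Proof.
move=> A B AB; apply: ge_ereal_sup => _ [d d0 <-].
apply: (le_trans (le_cover_outer _ _ _ AB)).
by apply: ereal_sup_ubound; exists d.
Qed.

Let hausdorff_outer_sigma_subadditive : sigma_subadditive hausdorff_outer.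
Proof.
move=> F; apply: ge_ereal_sup => _ [d d0 <-].
apply: (@le_trans _ _ (\sum_(i <oo) hausdorff_pre d (F i))%E).
  exact: cover_outer_sigma_subadditive.
apply: lee_nneseries => [i _ _|i _]; first exact: hausdorff_pre_ge0.
by apply: ereal_sup_ubound; exists d.
Qed.

HB.instance Definition _ := isOuterMeasure.Build R 'rV[R]_n hausdorff_outer
  hausdorff_outer0 hausdorff_outer_ge0 le_hausdorff_outer
  hausdorff_outer_sigma_subadditive.

Definition hausdorff_type := caratheodory_type hausdorff_outer.

HB.instance Definition _ := Measurable.on hausdorff_type.

Definition hausdorff_measure : set hausdorff_type -> \bar R := hausdorff_outer.

HB.instance Definition _ := isMeasure.Build _ _ _ hausdorff_measure
  hausdorff_outer0 hausdorff_outer_ge0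
  (@caratheodory_measure_sigma_additive _ _ hausdorff_outer).

End hausdorff.
Arguments hausdorff_measure {R n} m.

Section averages.
Context (R : realType) (n : nat).
Implicit Types (f g : 'rV[R]_n -> R) (x : 'rV[R]_n) (r eps : R).
Local Notation H := (@hausdorff_measure R n n.-1).

Definition ball_avg g x r : R :=
  (\int[lebesgue_rV]_(y in eball x r) g y) / fine (lebesgue_rV (eball x r)).

Definition sphere_avg g x r : R :=
  (\int[H]_(y in esphere x r) g y) / fine (H (esphere x r)).

Definition mean_kernel eps r : R :=
  if n == 2%N then r * ln (eps / r)
  else r / (n - 2)%N%:R * (1 - (r / eps) ^+ (n - 2)%N).

(* r |-> sphere_avg f x r need only be Lebesgue measurable, so the integrals in
   r are with respect to the completed measure. *)
Definition ball_int g x eps : R :=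
  \int[completed_lebesgue_measure]_(r in `[0, eps]) (ball_avg g x r * (r / n%:R)).

Definition sphere_int g x eps : R :=
  \int[completed_lebesgue_measure]_(r in `[0, eps])
     (sphere_avg g x r * mean_kernel eps r).

Definition remainder f x eps : R := ball_int (fun y => f y - f x) x eps.

End averages.

Section functions.
Context (R : realType) (n : nat).
Implicit Types (Omega : set 'rV[R]_n) (f v : 'rV[R]_n -> R).

Definition partial v (i : 'I_n) : 'rV[R]_n -> R := 'D_(delta_mx 0 i) v.

Definition C1 Omega v : Prop :=
  forall x, Omega x -> forall i,
    derivable v x (delta_mx 0 i) /\ {for x, continuous (partial v i)}.

Definition locally_lipschitz Omega f : Prop :=
  forall x, Omega x -> exists2 U, nbhs x U & [lipschitz f y | y in U].

Definition C11 Omega v : Prop :=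
  C1 Omega v /\ forall i, locally_lipschitz Omega (partial v i).

(* Delta v (x) = l, including the existence of the second derivatives involved
   (which may fail on a null set for v of class C^{1,1}). *)
Definition is_laplacian v x (l : R) : Prop :=
  (forall i, derivable (partial v i) x (delta_mx 0 i)) /\
  \sum_(i < n) partial (partial v i) i x = l.

Definition Linfty_loc Omega f : Prop :=
  measurable_fun (Omega : set (lebesgue_type R n)) f /\
  forall K, compact K -> K `<=` Omega ->
    exists M : R, {ae lebesgue_rV, forall x, K x -> `|f x| <= M}.

(* The restriction \_ K extends a function by 0 outside of K. *)
Definition loc_unif_little_o Omega (S : R -> 'rV[R]_n -> R) (k : nat) : Prop :=
  forall K, compact K -> K `<=` Omega -> forall eta, 0 < eta ->
    exists2 eps0, 0 < eps0 & forall eps, 0 < eps < eps0 ->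
      (ess_sup lebesgue_rV ((fun x => `|S eps x|%:E) \_ K)
         <= (eta * eps ^+ k)%:E)%E.

End functions.

(* Main.v *)
(* Truncate the radial fundamental solution at two radii delta < eps.  Against
   this Lipschitz cut-off, the integral of Delta v is, after an integration by
   parts, the flux of grad v through the annulus delta < |z - x| < eps, and in
   polar coordinates this flux is the difference of the spherical means of v at
   eps and delta, by the fundamental theorem of calculus on each ray.  Letting
   delta tend to 0 gives the formula with the kernel K_eps; writing K_eps(s) as
   the integral of s^(n-1) r^(1-n) for r in [s, eps] and exchanging the integrals
   turns it into the formula with ball averages.  As K_eps has integral
   eps^2 / (2n), subtracting the constant f(x) from f gives the expansion, at
   every x of Omega, and a bound of the oscillation of f on B_eps(x) is a bound
   of the remainder.

   The integration by parts does not use the divergence theorem: the difference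
   quotients of a compactly supported Lipschitz field have integral 0 by
   translation invariance, and converge boundedly almost everywhere.

   Up to a constant, the Hausdorff measure of a sphere is the image of the
   Lebesgue measure of the ball under the radial projection: both give equal
   mass to all caps of equal radius, which determines a finite Borel measure up
   to a factor.  The polar coordinates formula then follows from the scaling
   of the Lebesgue measure.  Finally f is a bounded Borel function off a Borel
   null set, which meets almost every sphere centred at x in a null set. *)

Require Import Defs.
From HB Require Import structures.
From mathcomp Require Import all_boot all_order all_algebra.
From mathcomp Require Import all_classical all_reals all_analysis.
From mathcomp Require Import ess_sup_inf measurable_realfun.
From mathcomp Require Import ring lra.

Set Implicit Arguments.
Unset Strict Implicit.
Unset Printing Implicit Defensive.

Import Order.TTheory GRing.Theory Num.Theory.
Import numFieldNormedType.Exports.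

Local Open Scope classical_set_scope.
Local Open Scope ring_scope.

(** * Euclidean geometry *)

(** The density is only Lebesgue measurable: on a given sphere it may fail to be measurable for the
    Hausdorff measure, and Fubini in radius and direction asks for a product sigma-algebra. The
    analysis is therefore done for bounded Borel functions, on [borel_rV], to which the Lebesgue and
    Hausdorff measures are transported by the identity; Lebesgue measurable data come back only at
    the end. The mean value and both radial integrals are compared with a single quantity,
    [potential g x eps], with [g] a Borel representative of f. Rotational symmetry enters through
    reflections: one of them swaps two given points of equal norm, and its invariance for Lebesgue
    measure is itself read off from the measure of balls. Averages are quotients, so the factor
    between the measure of the sphere and the projected volume cancels; what remains is to show that
    this measure is positive and finite, by volumes of cones and by counting cubes. The inner radius
    delta keeps the field Lipschitz; its contribution disappears because a potential at delta is at
    most M delta^2 / (2 n). *)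

Section euclidean_geometry.
Context (R : realType) (n : nat).
Implicit Types (x y z d : 'rV[R]_n) (r t : R).

Definition edot x y : R := \sum_(i < n) x 0 i * y 0 i.

Lemma edotC x y : edot x y = edot y x.
Proof. by apply: eq_bigr => i _; rewrite mulrC. Qed.

Lemma edotDl x y z : edot (x + y) z = edot x z + edot y z.
Proof. by rewrite -big_split; apply: eq_bigr => i _; rewrite mxE mulrDl. Qed.

Lemma edotZl t x y : edot (t *: x) y = t * edot x y.
Proof. by rewrite mulr_sumr; apply: eq_bigr => i _; rewrite mxE mulrA. Qed.

Lemma edotNl x y : edot (- x) y = - edot x y.
Proof. by rewrite -scaleN1r edotZl mulN1r. Qed.

Lemma edotBl x y z : edot (x - y) z = edot x z - edot y z.
Proof. by rewrite edotDl edotNl. Qed.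

Lemma edotDr x y z : edot z (x + y) = edot z x + edot z y.
Proof. by rewrite edotC edotDl !(edotC z). Qed.

Lemma edotZr t x y : edot y (t *: x) = t * edot y x.
Proof. by rewrite edotC edotZl edotC. Qed.

Lemma edotBr x y z : edot z (x - y) = edot z x - edot z y.
Proof. by rewrite edotC edotBl !(edotC z). Qed.

Lemma edotxx_ge0 x : 0 <= edot x x.
Proof. by apply: sumr_ge0 => i _; rewrite -expr2 sqr_ge0. Qed.

Lemma enormE x : enorm x = Num.sqrt (edot x x).
Proof. by congr Num.sqrt; apply: eq_bigr => i _; rewrite expr2. Qed.

Lemma enorm_ge0 x : 0 <= enorm x.
Proof. exact: sqrtr_ge0. Qed.

Lemma enorm_sqr x : enorm x ^+ 2 = edot x x.
Proof. by rewrite enormE sqr_sqrtr// edotxx_ge0. Qed.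

Lemma enorm0 : enorm (0 : 'rV[R]_n) = 0.
Proof. by rewrite /enorm big1 ?sqrtr0// => i _; rewrite mxE expr0n. Qed.

Lemma enormZ t x : enorm (t *: x) = `|t| * enorm x.
Proof.
by rewrite !enormE edotZl edotZr mulrA -expr2 sqrtrM ?sqr_ge0// sqrtr_sqr.
Qed.

Lemma enormN x : enorm (- x) = enorm x.
Proof. by rewrite -scaleN1r enormZ normrN normr1 mul1r. Qed.

Lemma enormC x y : enorm (x - y) = enorm (y - x).
Proof. by rewrite -enormN opprB. Qed.

Lemma coord_le_enorm x i : `|x 0 i| <= enorm x.
Proof.
rewrite -sqrtr_sqr ler_wsqrtr// (bigD1 i)//= lerDl.
by apply: sumr_ge0 => j _; rewrite sqr_ge0.
Qed.

Lemma enorm_eq0 x : (enorm x == 0) = (x == 0).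
Proof.
apply/eqP/eqP => [x0|->]; last exact: enorm0.
apply/rowP => i; rewrite mxE; apply/eqP; rewrite -normr_le0 -x0.
exact: coord_le_enorm.
Qed.

Lemma enorm_gt0 x : (0 < enorm x) = (x != 0).
Proof. by rewrite lt0r enorm_ge0 andbT enorm_eq0. Qed.

(** Cauchy-Schwarz: the squared norm of [edot y y *: x - edot x y *: y] is [edot y y] times the
    defect. *)
Lemma edot_le x y : `|edot x y| <= enorm x * enorm y.
Proof.
have [->|y0] := eqVneq y 0.
  rewrite enorm0 mulr0 normr_le0 edotC -(scale0r (0 : 'rV[R]_n)) edotZl mul0r.
  by [].
rewrite -(@ler_pXn2r _ 2)// ?nnegrE ?mulr_ge0 ?enorm_ge0//.
rewrite real_normK ?num_real// exprMn !enorm_sqr.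
have yy : 0 < edot y y by rewrite -enorm_sqr exprn_gt0// enorm_gt0.
rewrite -subr_ge0 -(pmulr_rge0 _ yy).
have := edotxx_ge0 (edot y y *: x - edot x y *: y).
rewrite !edotBl !edotBr !edotZl !edotZr (edotC y x).
by congr (0 <= _); ring.
Qed.

Lemma enormD x y : enorm (x + y) <= enorm x + enorm y.
Proof.
rewrite -(@ler_pXn2r _ 2)// ?nnegrE ?addr_ge0 ?enorm_ge0//.
rewrite sqrrD !enorm_sqr edotDl !edotDr (edotC y x).
have := le_trans (ler_norm _) (edot_le x y); lra.
Qed.

Lemma enormB_le y x z : enorm (x - z) <= enorm (x - y) + enorm (y - z).
Proof. by rewrite (le_trans _ (enormD _ _))// subrKA. Qed.

Lemma enorm_lip x y : `|enorm x - enorm y| <= enorm (x - y).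
Proof.
have h (a b : 'rV[R]_n) : enorm a - enorm b <= enorm (a - b).
  by rewrite lerBlDr; have := enormD (a - b) b; rewrite subrK.
by rewrite ler_norml h lerNl opprB enormC h.
Qed.

Lemma norm_le_enorm x : `|x| <= enorm x.
Proof.
rewrite /Num.Def.normr/= mx_normrE; apply/bigmax_leP; split=> [|[i j] _ /=].
  exact: enorm_ge0.
by rewrite (ord1 i) coord_le_enorm.
Qed.

Lemma coord_le_norm x i : `|x 0 i| <= `|x|.
Proof.
rewrite [leRHS]/Num.Def.normr/= mx_normrE.
exact: (@le_bigmax _ _ _ _ (fun ij => `|x ij.1 ij.2|) (0, i)).
Qed.

Lemma enorm_le_coord x r : 0 <= r -> (forall i, `|x 0 i| <= r) ->
  enorm x <= n%:R * r.
Proof.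
move=> r0 xr; rewrite -(@ler_pXn2r _ 2)// ?nnegrE ?mulr_ge0 ?enorm_ge0//.
rewrite enorm_sqr; have [n0|n0] := posnP n.
  by rewrite /edot big1 ?sqr_ge0// => -[i ilt]; exfalso; rewrite n0 in ilt.
apply: (@le_trans _ _ (n%:R * r ^+ 2)).
  rewrite mulr_natl -[n in leRHS]card_ord -sumr_const.
  by apply: ler_sum => i _; rewrite -expr2 -real_normK ?num_real// lerXn2r ?nnegrE.
rewrite exprMn ler_wpM2r ?sqr_ge0// expr2 ler_peMl//.
by rewrite ler1n.
Qed.

Lemma enorm_le_norm x : enorm x <= n%:R * `|x|.
Proof. by apply: enorm_le_coord => // i; exact: coord_le_norm. Qed.

Lemma nbhs_eball x r : 0 < r -> nbhs x (eball x r).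
Proof.
move=> r0; apply/nbhs_ballP; exists (r / n.+1%:R); first by rewrite /= divr_gt0.
move=> y; rewrite -ball_normE /eball/= -normrN opprB => xy.
apply: (le_lt_trans (enorm_le_norm _)).
rewrite (le_lt_trans (y := n.+1%:R * `|y - x|))//.
  by rewrite ler_wpM2r// ler_nat.
by rewrite mulrC -ltr_pdivlMr.
Qed.

(** The topology is that of the maximum norm; equivalence of the norms lets neighbourhoods be tested
    on Euclidean balls. *)
Lemma nbhs_eballP x (U : set 'rV[R]_n) :
  nbhs x U <-> exists2 r, 0 < r & eball x r `<=` U.
Proof.
split=> [/nbhs_ballP[r /= r0 rU]|[r r0 rU]].
  exists r => // y xy; apply: rU; rewrite -ball_normE/= -normrN opprB.
  exact: le_lt_trans (norm_le_enorm _) xy.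
exact: (@filterS _ (nbhs x) _ _ _ rU (nbhs_eball x r0)).
Qed.

Lemma lip_continuous (g : 'rV[R]_n -> R) (K : R) :
  (forall x y, `|g x - g y| <= K * enorm (x - y)) -> continuous g.
Proof.
move=> gK x U /nbhs_ballP[e /= e0 eU].
have e1 : 0 < e / (`|K| + 1) by rewrite divr_gt0// ltr_pwDr.
apply: (@filterS _ (nbhs x) _ _ _ _ (nbhs_eball x e1)) => y /= xy.
apply: eU; rewrite /ball/= (le_lt_trans (gK _ _))// enormC.
apply: (@le_lt_trans _ _ (`|K| * enorm (y - x))).
  by rewrite ler_wpM2r ?enorm_ge0 ?ler_norm.
apply: (@le_lt_trans _ _ ((`|K| + 1) * enorm (y - x))).
  by rewrite ler_wpM2r ?enorm_ge0// lerDl.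
by rewrite mulrC -ltr_pdivlMr// ltr_pwDr.
Qed.

Lemma continuous_enormB x : continuous (fun y => enorm (y - x)).
Proof.
apply: (@lip_continuous _ 1) => y z; rewrite mul1r.
by have := enorm_lip (y - x) (z - x); rewrite opprB subrKA.
Qed.

Lemma continuous_enorm : continuous (@enorm R n).
Proof. by apply: (@lip_continuous _ 1) => y z; rewrite mul1r enorm_lip. Qed.

Lemma open_eball x r : open (eball x r).
Proof.
have -> : eball x r = (fun y => enorm (y - x)) @^-1` [set t | t < r] by [].
by apply: open_comp; [move=> y _; exact: continuous_enormB|exact: open_lt].
Qed.

(* The reflection in the hyperplane orthogonal to d (the identity if d = 0). *)
Definition refl d y := y - (2 * edot y d / edot d d) *: d.

Lemma edot_refl d x y : edot (refl d x) (refl d y) = edot x y.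
Proof.
rewrite /refl !edotBl !edotBr !edotZl !edotZr (edotC d y).
have [->|d0] := eqVneq (edot d d) 0; first by rewrite invr0; lra.
by field.
Qed.

Lemma refl_linear d : linear (refl d).
Proof.
move=> t x y; apply/rowP => i; rewrite /refl edotDl edotZl !mxE; ring.
Qed.

Lemma reflB d x y : refl d (x - y) = refl d x - refl d y.
Proof.
by rewrite addrC -scaleN1r refl_linear scaleN1r addrC.
Qed.

Lemma reflZ d t x : refl d (t *: x) = t *: refl d x.
Proof.
have r0 : refl d 0 = 0.
  by rewrite /refl -(scale0r d) edotZl mul0r mulr0 mul0r !scale0r subr0.
by have := refl_linear d t x 0; rewrite !addr0 r0 addr0.
Qed.

Lemma enorm_refl d x : enorm (refl d x) = enorm x.
Proof. by rewrite !enormE edot_refl. Qed.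

Lemma reflK d : involutive (refl d).
Proof.
move=> x; rewrite /refl !edotBl !edotZl; apply/rowP => i.
rewrite !mxE.
have [->|d0] := eqVneq (edot d d) 0; first by rewrite invr0; lra.
by field.
Qed.

(** Equal norms give 2 x.(x - y) = |x - y|^2, so the reflection subtracts exactly x - y. Every
    rotational symmetry below comes from this lemma. *)
Lemma refl_swap x y : enorm x = enorm y -> refl (x - y) x = y.
Proof.
move=> xy; have {}xy : edot x x = edot y y by rewrite -!enorm_sqr xy.
rewrite /refl; have [/eqP d0|d0] := eqVneq (edot (x - y) (x - y)) 0.
  move: d0; rewrite -enorm_sqr sqrf_eq0 enorm_eq0 subr_eq0 => /eqP ->.
  by rewrite subrr scaler0 subr0.
have -> : 2 * edot x (x - y) = edot (x - y) (x - y).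
  by rewrite !edotBl !edotBr (edotC y x) xy; ring.
by rewrite divff// scale1r opprB addrC subrK.
Qed.

End euclidean_geometry.

(** * Outer measures and the Lebesgue measure *)

Section cover_transport.
Context (R : realType) (T T' I I' : Type) (C : set I) (S : I -> set T)
  (tau : I -> \bar R) (C' : set I') (S' : I' -> set T') (tau' : I' -> \bar R).
Hypothesis tau_ge0 : forall i, C i -> (0 <= tau i)%E.
Hypothesis tau'_ge0 : forall i, C' i -> (0 <= tau' i)%E.
Local Open Scope ereal_scope.

(** Coverings are carried over term by term. Translations and dilations of the Lebesgue measure and
    isometries of the Hausdorff measure are instances. *)
Lemma cover_outer_image (phi : T -> T') (j : I -> I') (k : R) (A : set T) :
  (0 < k)%R -> (forall i, C i -> C' (j i)) ->
  (forall i, C i -> phi @` S i `<=` S' (j i)) ->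
  (forall i, C i -> tau' (j i) <= k%:E * tau i) ->
  cover_outer C' S' tau' (phi @` A) <= k%:E * cover_outer C S tau A.
Proof.
move=> k0 jC jS jtau; rewrite -lee_pdivrMl//.
apply: le_ereal_inf_tmp => _ [F [CF AF] <-].
rewrite lee_pdivrMl//.
pose F' m := omap j (F m).
have cF' : countable_cover C' S' (phi @` A) F'.
  split=> [m i'|_ [x /AF[m _ Fmx] <-]].
    by rewrite /F'; case E : (F m) => [i|]//= [<-]; apply/jC/(CF m).
  exists m => //; rewrite /F'; case E : (F m) Fmx => [i|]//= Six.
  by apply: (jS i); [exact: (CF m)|exists x].
apply: (@le_trans _ _ (\sum_(m <oo) oapp tau' 0 (F' m))).
  by apply: ereal_inf_lbound; exists F'.
rewrite -nneseriesZl; last first.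
  by move=> m _; apply: (cover_term_ge0 tau_ge0); split; [exact: CF|exact: AF].
apply: lee_nneseries => m.
  by move=> _ _; exact: (cover_term_ge0 tau'_ge0 cF').
move=> _; rewrite /F'; case E : (F m) => [i|]/=; last by rewrite mule0.
by apply: jtau; exact: (CF m).
Qed.

End cover_transport.

Lemma nneseries_single (R : realType) (u : nat -> \bar R) :
  (forall k, (0 < k)%N -> u k = 0%E) -> (0 <= u 0%N)%E ->
  (\sum_(k <oo) u k = u 0%N)%E.
Proof.
move=> u0 u00; rewrite nneseries_recl//.
  by rewrite eseries0 ?adde0// => k k1 _; exact: u0.
by case=> // k _; rewrite u0.
Qed.

Lemma cover_outer_le (R : realType) (T I : Type) (C : set I) (S : I -> set T)
    (tau : I -> \bar R) (i : I) (A : set T) :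
  C i -> (0 <= tau i)%E -> A `<=` S i -> (cover_outer C S tau A <= tau i)%E.
Proof.
move=> Ci taui AS; apply: ereal_inf_lbound.
exists (fun k => if k is 0%N then Some i else None).
  by split=> [[|k] j//= [<-]//|x /AS Six]; exists 0%N.
by rewrite nneseries_single// => -[].
Qed.

Lemma cover_outer_sum_le (R : realType) (T I : Type) (C : set I)
    (S : I -> set T) (tau : I -> \bar R) (F : nat -> option I) (A : set T) :
  countable_cover C S A F ->
  (cover_outer C S tau A <= \sum_(k <oo) oapp tau 0 (F k))%E.
Proof. by move=> cF; apply: ereal_inf_lbound; exists F. Qed.

Section preimage_open.
Context d (T : measurableType d) (R : realType) (n : nat).

(* Testing on coordinate half-spaces is enough: open sets are countable unions
   of cubes with rational centres. *)
Lemma measurable_preimage_open (phi : T -> 'rV[R]_n) :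
  (forall i, measurable_fun setT (fun t => phi t 0 i)) ->
  forall U, open U -> measurable (phi @^-1` U).
Proof.
move=> mphi U oU.
pose Q (qk : 'rV[rat]_n * nat) : set 'rV[R]_n :=
  [set y | forall i, `|y 0 i - ratr (qk.1 0 i)| < qk.2.+1%:R^-1].
pose G (m : nat) : set 'rV[R]_n :=
  if unpickle m is Some qk then (if pselect (Q qk `<=` U) then Q qk else set0)
  else set0.
have mQ qk : measurable (phi @^-1` Q qk).
  have -> : phi @^-1` Q qk = \bigcap_(i in [set: 'I_n])
      (fun t => phi t 0 i) @^-1` [set s | `|s - ratr (qk.1 0 i)| < qk.2.+1%:R^-1].
    by apply/seteqP; split=> [t Qt i _|t Qt i]; exact: Qt.
  apply: fin_bigcap_measurable => // i _; rewrite -[X in measurable X]setTI.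
  apply: mphi => //; apply: open_measurable.
  rewrite (_ : mkset _ = ball (ratr (qk.1 0 i) : R) (qk.2.+1%:R^-1)).
    exact: ball_open.
  by apply/seteqP; split=> s; rewrite /ball/= distrC.
have mG m : measurable (phi @^-1` G m).
  rewrite /G; case: unpickle => [qk|]; last by rewrite preimage_set0.
  by case: pselect => [QU|QU] /=; [exact: mQ|rewrite preimage_set0].
suff -> : U = \bigcup_m G m.
  by rewrite preimage_bigcup; exact: bigcupT_measurable.
apply/seteqP; split=> [x Ux|x [m _]]; last first.
  by rewrite /G; case: unpickle => [qk|]//; case: pselect => //= QU /QU.
have /nbhs_ballP[r /= r0 rU] : nbhs x U by exact: open_nbhs_nbhs.
(* A cube of half-side 1/(k+1) whose centre is within 1/(k+1) of x stays within 2/(k+1) < r of x. *)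
have [k kr] : exists k, k.+1%:R^-1 < r / 2.
  have r2 : 0 < r / 2 by rewrite divr_gt0.
  by have [k] := ltr_add_invr r2; rewrite add0r; exists k.
have k0 : 0 < k.+1%:R^-1 :> R by rewrite invr_gt0.
have qP i : exists q : rat, `|x 0 i - ratr q| < k.+1%:R^-1.
  have /rat_in_itvoo[q] : x 0 i - k.+1%:R^-1 < x 0 i + k.+1%:R^-1.
    by rewrite ltrBlDr -addrA ltrDl addr_gt0.
  rewrite in_itv/= => /andP[q1 q2]; exists q.
  by rewrite ltr_norml; move: q1 q2; set e := k.+1%:R^-1; lra.
have [q {}qP] := choice qP.
exists (pickle (\row_i q i, k)) => //; rewrite /G pickleK.
have Qx : Q (\row_i q i, k) x by move=> i /=; rewrite mxE.
case: pselect => //= -[] y Qy; apply: rU; split=> // i j; rewrite (ord1 i) /ball/=.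
have h1 : `|x 0 j - ratr (q j)| < k.+1%:R^-1 by have := Qx j; rewrite /= mxE.
have h2 : `|ratr (q j) - y 0 j| < k.+1%:R^-1.
  by have := Qy j; rewrite /= mxE distrC.
rewrite -(subrKA (ratr (q j))) (le_lt_trans (ler_normD _ _))//.
by rewrite (lt_trans (ltrD h1 h2))// [ltRHS]splitr ltrD.
Qed.

End preimage_open.

Section lebesgue_outer_theory.
Context (R : realType) (n : nat).
Implicit Types (A : set 'rV[R]_n) (ab : 'rV[R]_n * 'rV[R]_n).
Local Notation leb := (@lebesgue_outer R n).

Lemma box_volume_ge0 ab : @le_corners R n ab -> (0 <= box_vol ab)%E.
Proof. by move=> ab0; rewrite lee_fin prodr_ge0// => i _; rewrite subr_ge0. Qed.

Lemma lebesgue_outer_translate_le (a : 'rV[R]_n) A :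
  (leb [set (a + y)%R | y in A] <= leb A)%E.
Proof.
rewrite -[leRHS]mul1e.
apply: (@cover_outer_image _ _ _ _ _ _ _ _ _ _ _ box_volume_ge0
  box_volume_ge0 (fun y => a + y) (fun ab => (a + ab.1, a + ab.2))) => //.
- by move=> ab h i /=; rewrite !mxE lerD2l.
- move=> ab h _ [y yab <-] i /=; rewrite !mxE ltrD2l lerD2l; exact: yab.
- move=> ab h; rewrite mul1e lee_fin le_eqVlt; apply/orP; left; apply/eqP.
  by apply: eq_bigr => i _; rewrite !mxE opprD addrACA subrr add0r.
Qed.

Lemma lebesgue_outer_translate (a : 'rV[R]_n) A :
  leb [set a + y | y in A] = leb A.
Proof.
apply/eqP; rewrite eq_le lebesgue_outer_translate_le/=.
have {1}-> : A = [set - a + y | y in [set a + y | y in A]].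
  apply/seteqP; split=> [y Ay|_ [_ [y Ay <-] <-]]; last by rewrite addKr.
  by exists (a + y); [exists y|rewrite addKr].
exact: lebesgue_outer_translate_le.
Qed.

Lemma lebesgue_outer_scale_le (t : R) A : 0 < t ->
  (leb [set (t *: y)%R | y in A] <= (t ^+ n)%:E * leb A)%E.
Proof.
move=> t0; apply: (@cover_outer_image _ _ _ _ _ _ _ _ _ _ _ box_volume_ge0
  box_volume_ge0 (fun y => t *: y) (fun ab => (t *: ab.1, t *: ab.2))) => //.
- exact: exprn_gt0.
- by move=> ab h i /=; rewrite !mxE ler_pM2l.
- move=> ab h _ [y yab <-] i /=; rewrite !mxE ltr_pM2l// ler_pM2l//; exact: yab.
- move=> ab h; rewrite -EFinM lee_fin le_eqVlt; apply/orP; left; apply/eqP.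
  rewrite -[n in t ^+ n]card_ord -prodr_const -big_split/=.
  by apply: eq_bigr => i _; rewrite !mxE mulrBr.
Qed.

Lemma lebesgue_outer_scale (t : R) A : 0 < t ->
  leb [set t *: y | y in A] = ((t ^+ n)%:E * leb A)%E.
Proof.
move=> t0; apply/eqP; rewrite eq_le lebesgue_outer_scale_le//=.
have ti : 0 < t^-1 by rewrite invr_gt0.
have := @lebesgue_outer_scale_le t^-1 [set t *: y | y in A] ti.
rewrite [X in (leb X <= _)%E](_ : _ = A).
  by rewrite exprVn lee_pdivlMl ?exprn_gt0.
apply/seteqP; split=> [_ [_ [y Ay <-] <-]|y Ay].
  by rewrite scalerA mulVf ?gt_eqF// scale1r.
by exists (t *: y); [exists y|rewrite scalerA mulVf ?gt_eqF// scale1r].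
Qed.

(* Cutting every box of a covering along the hyperplane x_i = c does not change
   the total volume. *)
Lemma lebesgue_halfspace i (c : R) :
  (@lebesgue_outer R n).-caratheodory [set x | c < x 0 i].
Proof.
apply: le_caratheodory_measurable => X /=.
apply: le_ereal_inf_tmp => _ [F [CF XF] <-].
(* The height c clamped to the i-th side: a box lying on one side of the hyperplane gets one half of
   volume 0. *)
pose m ab := Num.max (ab.1 0 i) (Num.min (ab.2 0 i) c).
pose up ab : 'rV[R]_n * 'rV[R]_n :=
  (\row_j (if j == i then m ab else ab.1 0 j), ab.2).
pose dn ab : 'rV[R]_n * 'rV[R]_n :=
  (ab.1, \row_j (if j == i then m ab else ab.2 0 j)).
have m_ge ab : ab.1 0 i <= m ab by rewrite le_max lexx.
have m_le ab : @le_corners R n ab -> m ab <= ab.2 0 i.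
  by move=> /(_ i) h; rewrite ge_max h ge_min lexx.
have Cup ab : @le_corners R n ab -> @le_corners R n (up ab).
  move=> h j /=; rewrite mxE; case: eqP => [->|_]; last exact: h.
  exact: m_le.
have Cdn ab : @le_corners R n ab -> @le_corners R n (dn ab).
  by move=> h j /=; rewrite mxE; case: eqP => [->|_]; [exact: m_ge|exact: h].
have vol ab : box_vol ab = (box_vol (up ab) + box_vol (dn ab))%E.
  rewrite /box_vol -EFinD; congr EFin.
  rewrite (bigD1 i)//= [X in _ = X + _](bigD1 i)//= [X in _ = _ + X](bigD1 i)//= !mxE eqxx.
  set p := \prod_(j < n | j != i) (ab.2 0 j - ab.1 0 j).
  have -> : \prod_(j < n | j != i) (ab.2 0 j - (up ab).1 0 j) = p.
    by apply: eq_bigr => j /negbTE ji; rewrite mxE ji.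
  have -> : \prod_(j < n | j != i) ((dn ab).2 0 j - ab.1 0 j) = p.
    by apply: eq_bigr => j /negbTE ji; rewrite mxE ji.
  by rewrite -mulrDl addrA subrK.
pose Fu k := omap up (F k); pose Fd k := omap dn (F k).
have cu : countable_cover (@le_corners R n) (@box R n)
    (X `&` [set x | c < x 0 i]) Fu.
  split=> [k ab|x [/XF[k _] Fkx cx]].
    by rewrite /Fu; case Fk : (F k) => [ab'|]//= [<-]; apply: Cup; exact: CF Fk.
  exists k => //; rewrite /Fu; case: (F k) Fkx => [ab|]//= xab j /=.
  rewrite mxE; case: eqP => [->|_]; last exact: xab.
  have /andP[h1 h2] := xab i; rewrite h2 andbT gt_max h1/= gt_min.
  by move: cx => /= ->; rewrite orbT.
have cd : countable_cover (@le_corners R n) (@box R n)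
    (X `&` ~` [set x | c < x 0 i]) Fd.
  split=> [k ab|x [/XF[k _] Fkx /negP cx]].
    by rewrite /Fd; case Fk : (F k) => [ab'|]//= [<-]; apply: Cdn; exact: CF Fk.
  exists k => //; rewrite /Fd; case: (F k) Fkx => [ab|]//= xab j /=.
  rewrite mxE; case: eqP => [->|_]; last exact: xab.
  have /andP[h1 h2] := xab i; rewrite h1/= le_max le_min h2/=.
  by move: cx; rewrite -leNgt => ->; rewrite orbT.
apply: (le_trans (leeD (cover_outer_sum_le _ cu) (cover_outer_sum_le _ cd))).
rewrite -nneseriesD.
- apply: lee_nneseries => k.
    by move=> _ _; apply: adde_ge0;
      [exact: (cover_term_ge0 box_volume_ge0 cu)|
       exact: (cover_term_ge0 box_volume_ge0 cd)].
  move=> _; rewrite /Fu /Fd; case: (F k) => [ab|]/=; last by rewrite adde0.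
  by rewrite -vol.
- by move=> k _ _; exact: (cover_term_ge0 box_volume_ge0 cu).
- by move=> k _ _; exact: (cover_term_ge0 box_volume_ge0 cd).
Qed.

End lebesgue_outer_theory.

Section box_volume.
Context (R : realType) (n : nat).
Hypothesis n_gt0 : (0 < n)%N.
Local Notation leb := (@lebesgue_outer R n).
Local Notation corners := ('rV[R]_n * 'rV[R]_n)%type.

Let side (ab : corners) i : R := ab.2 0 i - ab.1 0 i.
Let ind (ab : corners) (x : 'rV[R]_n) i : R :=
  \1_(`]ab.1 0 i, ab.2 0 i]%classic) (x 0 i).
Let mixed m ab x : R := \prod_(i < n) (if (i < m)%N then side ab i else ind ab x i).

Let mixed_ge0 m ab x : @le_corners R n ab -> 0 <= mixed m ab x.
Proof.
move=> h; apply: prodr_ge0 => i _; case: ifPn => _; first by rewrite subr_ge0.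
by rewrite /ind indicE ler0n.
Qed.

(* Integrating the inequality 1 <= sum_k 1_(box k) over the box in one
   coordinate at a time turns indicators into side lengths. *)
Let cover_mixed (ab : corners) (F : nat -> corners) :
  (forall i, ab.1 0 i < ab.2 0 i) -> (forall k, @le_corners R n (F k)) ->
  box ab `<=` \bigcup_k box (F k) ->
  forall m, (m <= n)%N -> forall x, box ab x ->
  ((\prod_(i < n | (i < m)%N) side ab i)%:E <= \sum_(k <oo) (mixed m (F k) x)%:E)%E.
Proof.
move=> ab_lt leF covF; elim=> [_ x abx|m IH mn x abx].
  rewrite big1//.
  have [k _ Fkx] := covF _ abx.
  apply: (@le_trans _ _ (mixed 0 (F k) x)%:E).
    rewrite lee_fin /mixed big1// => i _ /=; rewrite /ind indicE mem_set//=.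
    by rewrite in_itv/=; exact: Fkx.
  rewrite (@nneseriesD1 _ _ k)//; last by move=> j _; rewrite lee_fin mixed_ge0.
  by rewrite leeDl// nneseries_ge0// => j _ _; rewrite lee_fin mixed_ge0.
pose i0 := Ordinal mn.
pose upd (t : R) : 'rV[R]_n := \row_j (if j == i0 then t else x 0 j).
pose c k : R := \prod_(i < n | i != i0)
  (if (i < m)%N then side (F k) i else ind (F k) x i).
pose D := `]ab.1 0 i0, ab.2 0 i0]%classic : set R.
have c_ge0 k : 0 <= c k.
  apply: prodr_ge0 => i _; case: ifPn => _; first by rewrite subr_ge0; exact: leF.
  by rewrite /ind indicE ler0n.
have mixed_upd k t : mixed m (F k) (upd t) =
    c k * \1_(`](F k).1 0 i0, (F k).2 0 i0]%classic) t.
  rewrite /mixed (bigD1 i0)//= ltnn mulrC; congr (_ * _).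
    by apply: eq_bigr => i ii0; rewrite /ind mxE (negbTE ii0).
  by rewrite /ind mxE eqxx.
have mixedS k : mixed m.+1 (F k) x = c k * side (F k) i0.
  rewrite /mixed (bigD1 i0)//= ltnSn mulrC; congr (_ * _).
  apply: eq_bigr => i ii0; rewrite ltnS leq_eqVlt.
  suff -> : (i == m :> nat) = false by [].
  by apply/negbTE; apply: contra ii0 => /eqP im; apply/eqP/val_inj.
have prodS : \prod_(i < n | (i < m.+1)%N) side ab i =
    (\prod_(i < n | (i < m)%N) side ab i) * side ab i0.
  rewrite (bigD1 i0)/= ?ltnSn// mulrC; congr (_ * _).
  apply: eq_bigl => i; rewrite ltnS leq_eqVlt; case: eqVneq => /= im.
    by rewrite im ltnn; apply/negbTE; rewrite negbK; apply/eqP/val_inj.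
  by rewrite andb_idr// => _; apply: contra im => /eqP ->.
have mD : measurable D by exact: measurable_itv.
have muI (ab' : corners) : ab'.1 0 i0 <= ab'.2 0 i0 ->
    lebesgue_measure (`]ab'.1 0 i0, ab'.2 0 i0]%classic : set R) =
    (side ab' i0)%:E.
  move=> le_ab'; rewrite lebesgue_measure_itv/= lte_fin.
  case: ltP => // ge_ab'; congr EFin; apply/esym/eqP; rewrite subr_eq0.
  by rewrite eq_le ge_ab'.
rewrite prodS EFinM -(muI ab) ?(ltW (ab_lt _))//.
have -> : (((\prod_(i < n | (i < m)%N) side ab i)%:E *
    lebesgue_measure D)%E = \int[lebesgue_measure]_(t in D)
    (\prod_(i < n | (i < m)%N) side ab i)%:E)%E.
  by rewrite integral_cst.
apply: (@le_trans _ _ (\int[lebesgue_measure]_(t in D)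
    (\sum_(k <oo) (mixed m (F k) (upd t))%:E))%E).
  apply: ge0_le_integral => //.
  - by move=> t _; rewrite lee_fin prodr_ge0// => i _; rewrite subr_ge0 ltW.
  - apply: ge0_emeasurable_sum => k.
      by move=> t Dt _; rewrite lee_fin mixed_ge0.
    move=> _; apply/measurable_EFinP; under eq_fun do rewrite mixed_upd.
    by apply: measurable_funM => //; exact: measurable_indic.
  - move=> t Dt; apply: IH; first exact: ltnW.
    move=> j; rewrite mxE; case: eqVneq => [->|_]; last exact: abx.
    by move: Dt; rewrite /D/= in_itv.
rewrite integral_nneseries//; last 2 first.
- move=> k; apply/measurable_EFinP; under eq_fun do rewrite mixed_upd.
  by apply: measurable_funM => //; exact: measurable_indic.
- by move=> k t _; rewrite lee_fin mixed_ge0.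
apply: lee_nneseries => k.
  by move=> _ _; apply: integral_ge0 => t _; rewrite lee_fin mixed_ge0.
move=> _; under eq_integral do rewrite mixed_upd EFinM.
rewrite ge0_integralZl//; last 2 first.
- by apply/measurable_EFinP; exact: measurable_indic.
- by rewrite lee_fin c_ge0.
rewrite mixedS EFinM lee_wpmul2l ?lee_fin// integral_indic// -muI ?leF//.
by apply: le_measure; rewrite ?inE//; exact: measurableI.
Qed.

Lemma lebesgue_outer_box (ab : corners) :
  @le_corners R n ab -> leb (box ab) = box_vol ab.
Proof.
move=> le_ab; apply/eqP; rewrite eq_le; apply/andP; split.
  exact: (cover_outer_le le_ab (box_volume_ge0 le_ab)).
have [lt_ab|] := pselect (forall i, ab.1 0 i < ab.2 0 i); last first.
  move=> /existsNP[i /negP]; rewrite -leNgt => ge_ab.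
  rewrite [box_vol ab](_ : _ = 0%E); first exact: outer_measure_ge0.
  congr EFin; rewrite (bigD1 i)//=.
  by have -> : ab.2 0 i = ab.1 0 i; [apply/eqP; rewrite eq_le ge_ab le_ab|
    rewrite subrr mul0r].
apply: le_ereal_inf_tmp => _ [F [CF covF] <-].
pose G k := odflt (0, 0) (F k).
have leG k : @le_corners R n (G k).
  by rewrite /G; case Fk : (F k) => [ab'|]//=; exact: CF Fk.
have covG : box ab `<=` \bigcup_k box (G k).
  move=> x /covF[k _ Fkx]; exists k => //; rewrite /G.
  by case: (F k) Fkx.
(* With all n coordinates integrated out, the terms no longer depend on the point. The corner [ab.2]
   is a legitimate point since boxes contain their upper faces. *)
have := @cover_mixed ab G lt_ab leG covG n (leqnn n) ab.2.
have -> : \prod_(i < n | (i < n)%N) side ab i = \prod_(i < n) side ab i.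
  by apply: eq_bigl => i; rewrite ltn_ord.
move=> /(_ _)/le_trans; apply; first by move=> i; rewrite lt_ab lexx.
apply: lee_nneseries => k; first by move=> _ _; rewrite lee_fin mixed_ge0.
move=> _; rewrite /G; case: (F k) => [ab'|]/=.
  by rewrite lee_fin le_eqVlt; apply/orP; left; apply/eqP/eq_bigr => i _;
    rewrite ltn_ord.
rewrite lee_fin /mixed (bigD1 (Ordinal n_gt0))//= n_gt0 /side/= !mxE subrr.
by rewrite mul0r.
Qed.

End box_volume.

Lemma measurable_fun_gt d (T : measurableType d) (R : realType) (g : T -> R) :
  (forall c, measurable [set t | c < g t]) -> measurable_fun setT g.
Proof.
move=> mg; apply: (measurability _ (RGenOInfty.measurableE R)).
move=> _ [_ [c ->] <-]; rewrite setTI.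
rewrite (_ : g @^-1` _ = [set t | c < g t]); first exact: mg.
by apply/seteqP; split=> t /=; rewrite in_itv/= andbT.
Qed.

(** The Lebesgue and the Hausdorff measurable sets are two different Caratheodory classes. The Borel
    sets belong to both and are generated by the open sets, so measures can be compared there. *)
Definition borel_rV (R : realType) (n : nat) :=
  g_sigma_algebraType (@open 'rV[R]_n).

Section borel.
Context (R : realType) (n : nat).
Local Notation brV := (borel_rV R n).

Lemma borel_open (U : set 'rV[R]_n) : open U -> measurable (U : set brV).
Proof. by move=> oU; exact: sub_sigma_algebra. Qed.

Lemma borel_closed (U : set 'rV[R]_n) : closed U -> measurable (U : set brV).
Proof.
by move=> cU; rewrite -[U]setCK; apply: measurableC; apply: borel_open; exact: closed_openC.
Qed.

Lemma borel_measurable_fun d (T : measurableType d) (phi : T -> brV) :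
  (forall i, measurable_fun setT (fun t => (phi t : 'rV[R]_n) 0 i)) ->
  measurable_fun setT phi.
Proof.
move=> mphi; apply: (@measurability _ _ _ _ setT phi (@open 'rV[R]_n)) => //.
by move=> _ [U oU <-]; rewrite setTI; exact: (measurable_preimage_open mphi).
Qed.

Lemma borel_continuous (g : 'rV[R]_n -> R) :
  continuous g -> measurable_fun setT (g : brV -> R).
Proof.
move=> cg; apply: measurable_fun_gt => c; apply: borel_open.
have -> : [set t | c < g t] = g @^-1` [set s | c < s] by [].
by apply: open_comp; [move=> x _; exact: cg|exact: open_gt].
Qed.

Lemma borel_continuous_in (D : set 'rV[R]_n) (g : 'rV[R]_n -> R) :
  open D -> (forall x, D x -> {for x, continuous g}) ->
  measurable_fun (D : set brV) (g : brV -> R).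
Proof.
move=> oD cg; apply: (measurability _ (RGenOInfty.measurableE R)).
move=> _ [_ [c ->] <-]; apply: borel_open.
rewrite openE => x [Dx gx]; apply: filterI; first exact: open_nbhs_nbhs.
apply: (cg x Dx); apply: open_nbhs_nbhs; split => //.
Qed.

Lemma continuous_coord i : continuous (fun y : 'rV[R]_n => y 0 i).
Proof.
apply: (@lip_continuous _ _ _ 1) => x y; rewrite mul1r.
by have := coord_le_enorm (x - y) i; rewrite !mxE.
Qed.

Lemma borel_coord i : measurable_fun setT (fun y : brV => (y : 'rV[R]_n) 0 i).
Proof. by apply: borel_continuous; exact: continuous_coord. Qed.

Lemma borel_enorm : measurable_fun setT (@enorm R n : brV -> R).
Proof. by apply: borel_continuous; exact: continuous_enorm. Qed.

Lemma borel_eball x r : measurable (eball x r : set brV).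
Proof. by apply: borel_open; exact: open_eball. Qed.

Lemma closed_enorm_le x r : closed [set y : 'rV[R]_n | enorm (y - x) <= r].
Proof.
have -> : [set y | enorm (y - x) <= r] =
  (fun y => enorm (y - x)) @^-1` [set t | t <= r] by [].
by apply: closed_comp; [move=> y _; exact: continuous_enormB|exact: closed_le].
Qed.

Lemma closed_esphere x r : closed (@esphere R n x r).
Proof.
have -> : @esphere R n x r = (fun y => enorm (y - x)) @^-1` [set r].
  by apply/seteqP; split.
by apply: closed_comp; [move=> y _; exact: continuous_enormB|exact: closed_eq].
Qed.

Lemma borel_esphere x r : measurable (@esphere R n x r : set brV).
Proof. by apply: borel_closed; exact: closed_esphere. Qed.

Lemma borel_set1 x : measurable ([set x] : set brV).
Proof.
rewrite (_ : [set x] = esphere x 0); first exact: borel_esphere.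
apply/seteqP; split=> [_ ->|y]; first by rewrite /esphere/= subrr enorm0.
by rewrite /esphere/= => /eqP; rewrite enorm_eq0 subr_eq0 => /eqP.
Qed.

End borel.

Section lebesgue_basics.
Context (R : realType) (n : nat).
Local Notation leb := (@lebesgue_rV R n).
Local Notation lebT := (lebesgue_type R n).
Local Notation brV := (borel_rV R n).

Lemma lebesgue_coord i : measurable_fun setT (fun y : lebT => (y : 'rV[R]_n) 0 i).
Proof. by apply: measurable_fun_gt => c; exact: lebesgue_halfspace. Qed.

Lemma measurable_leb_borel : measurable_fun setT (id : lebT -> brV).
Proof. by apply: borel_measurable_fun => i; exact: lebesgue_coord. Qed.

Lemma borel_lebesgue (A : set 'rV[R]_n) :
  measurable (A : set brV) -> measurable (A : set lebT).
Proof.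
by move=> mA; have := measurable_leb_borel measurableT mA; rewrite setTI.
Qed.

Lemma le_lebesgue (A B : set 'rV[R]_n) : A `<=` B -> (leb A <= leb B)%E.
Proof. exact: le_outer_measure. Qed.

Lemma lebesgue_box_le (ab : 'rV[R]_n * 'rV[R]_n) :
  @le_corners R n ab -> (leb (box ab) <= box_vol ab)%E.
Proof. by move=> h; exact: (cover_outer_le h (box_volume_ge0 h)). Qed.

Let cube (k : nat) : 'rV[R]_n * 'rV[R]_n :=
  (const_mx (- k%:R), const_mx k%:R).

Let le_cube k : @le_corners R n (cube k).
Proof. by move=> i; rewrite !mxE; have := ler0n R k; lra. Qed.

Lemma borel_box (ab : 'rV[R]_n * 'rV[R]_n) : measurable (box ab : set brV).
Proof.
have -> : box ab = \bigcap_(i in [set: 'I_n])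
   ((fun y : brV => (y : 'rV[R]_n) 0 i) @^-1` `]ab.1 0 i, ab.2 0 i]%classic).
  apply/seteqP; split=> [y aby i _|y aby i]; rewrite ?in_itv/=.
    by rewrite in_itv/=; exact: aby.
  by have := aby i Logic.I; rewrite /= in_itv.
apply: fin_bigcap_measurable => // i _; rewrite -[X in measurable X]setTI.
exact: borel_coord.
Qed.

Let eball_cube x r : exists k, eball x r `<=` box (cube k).
Proof.
have [k kb] : exists k : nat, enorm x + r < k%:R.
  by exists (Num.truncn (enorm x + r)).+1; exact: truncnS_gt.
exists k => y /= xy i; rewrite !mxE.
have : `|y 0 i| < k%:R.
  rewrite (le_lt_trans (coord_le_enorm _ _))// (le_lt_trans _ kb)//.
  have := enormD (y - x) x; rewrite subrK addrC => /le_trans; apply.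
  by rewrite lerD2l ltW.
by rewrite ltr_norml => /andP[-> /ltW ->].
Qed.

Lemma lebesgue_sigma_finite : sigma_finite setT leb.
Proof.
exists (fun k => box (cube k)).
  apply/seteqP; split=> // x _; have [k xk] := eball_cube x 1.
  by exists k => //; apply: xk; rewrite /eball/= subrr enorm0.
move=> k; split.
  by apply: borel_lebesgue; exact: borel_box.
by rewrite (le_lt_trans (lebesgue_box_le (le_cube _)))// ltry.
Qed.

HB.instance Definition _ := @isSigmaFinite.Build _ _ _ leb lebesgue_sigma_finite.

Lemma lebesgue_eball_lty x r : (leb (eball x r) < +oo)%E.
Proof.
have [k xk] := eball_cube x r.
rewrite (le_lt_trans (le_lebesgue xk))//.
by rewrite (le_lt_trans (lebesgue_box_le (le_cube _)))// ltry.
Qed.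

Lemma lebesgue_translate (a : 'rV[R]_n) (A : set 'rV[R]_n) :
  leb [set a + y | y in A] = leb A.
Proof. exact: lebesgue_outer_translate. Qed.

Lemma lebesgue_scale (t : R) (A : set 'rV[R]_n) : 0 < t ->
  leb [set t *: y | y in A] = ((t ^+ n)%:E * leb A)%E.
Proof. exact: lebesgue_outer_scale. Qed.

Definition unit_vol : R := fine (leb (eball 0 1)).

Lemma unit_volE : leb (eball 0 1) = unit_vol%:E.
Proof. by rewrite fineK// ge0_fin_numE ?measure_ge0// lebesgue_eball_lty. Qed.

Lemma lebesgue_eball x r : 0 < r -> leb (eball x r) = (unit_vol * r ^+ n)%:E.
Proof.
move=> r0; rewrite mulrC EFinM -unit_volE -lebesgue_scale//.
rewrite -(lebesgue_translate x [set r *: y | y in _]); congr (leb _); apply/seteqP; split=> y /=.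
  rewrite /eball/= => xy; exists (y - x); last by rewrite addrCA subrr addr0.
  exists (r^-1 *: (y - x)); last by rewrite scalerA divff ?gt_eqF// scale1r.
  by rewrite subr0 enormZ ger0_norm ?invr_ge0 ?ltW// mulrC ltr_pdivrMr// mul1r.
move=> [_ [z z1 <-] <-]; rewrite /eball/= addrAC subrr add0r enormZ.
by move: z1; rewrite /eball/= subr0 gtr0_norm// gtr_pMr.
Qed.

Hypothesis n_gt0 : (0 < n)%N.

Lemma lebesgue_box (ab : 'rV[R]_n * 'rV[R]_n) :
  @le_corners R n ab -> leb (box ab) = box_vol ab.
Proof. exact: lebesgue_outer_box. Qed.

Lemma lebesgue_open_gt0 (U : set 'rV[R]_n) x : open U -> U x -> (0 < leb U)%E.
Proof.
move=> oU Ux; have /nbhs_eballP[r r0 rU] : nbhs x U by exact: open_nbhs_nbhs.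
pose s := r / n.+1%:R; have s0 : 0 < s by rewrite divr_gt0.
pose ab : 'rV[R]_n * 'rV[R]_n := (x, x + const_mx s).
have lab : @le_corners R n ab by move=> i /=; rewrite !mxE lerDl ltW.
have abU : box ab `<=` U.
  move=> y aby; apply: rU; rewrite /eball/=.
  apply: (@le_lt_trans _ _ (n%:R * s)).
    apply: enorm_le_coord => [|i]; first exact: ltW.
    by have := aby i; rewrite /= !mxE ler_norml; lra.
  by rewrite /s mulrCA gtr_pMr// ltr_pdivrMr// mul1r ltr_nat.
rewrite (lt_le_trans _ (le_lebesgue abU))//.
rewrite lebesgue_box//.
rewrite lte_fin prodr_gt0// => i _; rewrite !mxE addrAC subrr add0r//.
Qed.

Lemma unit_vol_gt0 : 0 < unit_vol.
Proof.
rewrite -lte_fin -unit_volE; apply: (@lebesgue_open_gt0 _ 0).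
  exact: open_eball.
by rewrite /eball/= subrr enorm0.
Qed.

Lemma lebesgue_set1 x : leb [set x] = 0%E.
Proof.
apply/eqP; rewrite eq_le measure_ge0 andbT.
apply/lee_addgt0Pr => e e0; rewrite add0e.
(* The choice r <= 1 gives r^n <= r; the second bound then makes the volume of the ball at most
   e. *)
pose r := Num.min 1 (e / (unit_vol + 1)).
have c1 : 0 < unit_vol + 1 by rewrite addr_gt0 ?unit_vol_gt0.
have r0 : 0 < r by rewrite lt_min ltr01 divr_gt0.
have xr : [set x] `<=` eball x r by move=> _ ->; rewrite /eball/= subrr enorm0.
rewrite (le_trans (le_lebesgue xr))//.
rewrite lebesgue_eball//.
rewrite lee_fin (@le_trans _ _ ((unit_vol + 1) * r))//; last first.
  by rewrite mulrC -ler_pdivlMr// ge_min lexx orbT.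
apply: ler_pM; rewrite ?exprn_ge0 ?(ltW r0) ?(ltW unit_vol_gt0) ?lerDl//.
by rewrite -[leRHS]expr1 ler_wiXn2l ?(ltW r0) ?ge_min ?lexx.
Qed.

End lebesgue_basics.

(** * The Hausdorff measure *)

Section metric_outer_measure.
Context (R : realType) (n : nat).
Variable mu : {outer_measure set 'rV[R]_n -> \bar R}.
Hypothesis mu_metric : forall (A B : set 'rV[R]_n) (d : R), 0 < d ->
  (forall a b, A a -> B b -> d <= enorm (a - b)) ->
  (mu A + mu B <= mu (A `|` B))%E.
Variables (i : 'I_n) (c : R) (X : set 'rV[R]_n).
Hypothesis X_lty : (mu X < +oo)%E.

Let P : set 'rV[R]_n := [set x | c < x 0 i].
Let Pa (k : nat) : set 'rV[R]_n := [set x | k.+1%:R^-1 < x 0 i - c].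
Let phi (x : 'rV[R]_n) : R := x 0 i - c.
Let a (j : nat) : R := j.+1%:R^-1.
Let a_gt0 j : 0 < a j. Proof. by rewrite invr_gt0. Qed.
Let a_lt j k : (j < k)%N -> a k < a j.
Proof. by move=> jk; rewrite /a ltf_pV2 ?posrE// ltr_nat. Qed.
Let a_le j k : (j <= k)%N -> a k <= a j.
Proof. by move=> jk; rewrite /a lef_pV2 ?posrE// ler_nat. Qed.

Let phi_sep s t x y : s < phi x -> phi y <= t -> s - t <= enorm (x - y).
Proof.
move=> sx yt; apply: le_trans (coord_le_enorm _ i).
by rewrite (le_trans _ (ler_norm _))// !mxE; move: sx yt; rewrite /phi; lra.
Qed.

Let mu_sep A B s t : t < s -> (forall x, A x -> s < phi x) ->
  (forall x, B x -> phi x <= t) -> (mu A + mu B <= mu (A `|` B))%E.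
Proof.
move=> ts As Bt; apply: (@mu_metric A B (s - t)); first by rewrite subr_gt0.
by move=> x y /As + /Bt; exact: phi_sep.
Qed.

(** Layers of [X] that accumulate at the hyperplane from above. Two layers with another one between
    them are at positive distance. *)
Let shell j := X `&` [set x | a j.+1 < phi x <= a j].

Let shell_parity p N :
  (\sum_(j < N) mu (shell (j.*2 + p)%N) <=
   mu (\big[setU/set0]_(j < N) shell (j.*2 + p)%N))%E.
Proof.
elim: N => [|N IH]; first by rewrite !big_ord0 outer_measure0.
rewrite !big_ord_recr/=; case: N IH => [|N] IH.
  by rewrite !big_ord0 add0e set0U.
apply: (le_trans (leeD2r _ IH)).
apply: (@mu_sep _ _ (a (N.*2 + p).+1) (a (N.+1.*2 + p))).
- by apply: a_lt; rewrite doubleS !addSn ltnS.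
- move=> x; rewrite -(bigcup_mkord _ (fun j => shell (j.*2 + p)%N)) => -[j /= jN [_ /andP[+ _]]].
  apply: le_lt_trans; apply: a_le.
  by rewrite ltnS leq_add2r leq_double -ltnS.
- by move=> x [_ /andP[]].
Qed.

(** Even and odd layers are summed apart: within one parity the layers are separated, so their total
    is at most [mu X]. *)
Let shell_sum_le N : (\sum_(j < N.*2) mu (shell j) <= mu X + mu X)%E.
Proof.
have h p : (\sum_(j < N) mu (shell (j.*2 + p)%N) <= mu X)%E.
  apply: (le_trans (shell_parity p N)); apply: le_outer_measure.
  by rewrite -(bigcup_mkord _ (fun j => shell (j.*2 + p)%N)) => x [j _ []].
have -> : (\sum_(j < N.*2) mu (shell j) =
    \sum_(j < N) mu (shell (j.*2 + 0)%N) + \sum_(j < N) mu (shell (j.*2 + 1)%N))%E.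
  elim: (N) => [|M IH]; first by rewrite !big_ord0 adde0.
  by rewrite doubleS !big_ord_recr/= IH addn0 addn1 addeACA addeA.
exact: leeD.
Qed.

Let shell_series_lty : (\sum_(j <oo) mu (shell j) < +oo)%E.
Proof.
have sh0 j : true -> (0 <= mu (shell j))%E by move=> _; exact: outer_measure_ge0.
apply: (@le_lt_trans _ _ (mu X + mu X)%E); last by rewrite lte_add_pinfty.
apply: lime_le; first exact: is_cvg_nneseries.
near=> N; apply: le_trans (shell_sum_le N).
rewrite -(big_mkord xpredT (fun j => mu (shell j))).
by apply: lee_sum_nneg_natr => //; rewrite -addnn leq_addr.
Unshelve. all: by end_near. Qed.

Let halfspace_cover k : X `&` P `<=`
  (X `&` Pa k) `|` \bigcup_(j in ~` `I_k) shell j.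
Proof.
move=> x [Xx /= cx]; have [akx|xak] := ltP (a k) (phi x); first by left.
right; have x0 : 0 < phi x by rewrite subr_gt0.
have ex : exists j, a j.+1 < phi x.
  have [j] := ltr_add_invr x0; rewrite add0r => jx; exists j.
  by rewrite (lt_trans _ jx)// a_lt.
have [j jx jmin] := ex_minnP ex.
have jk : (k <= j)%N.
  by rewrite leqNgt; apply/negP => /a_le /(le_trans xak); rewrite leNgt jx.
exists j; first by rewrite /= ltnNge jk.
split=> //=; rewrite jx/=.
case: j jx jmin jk => [_ _ k0|j jx jmin jk].
  by move: xak; move: k0; rewrite leqn0 => /eqP ->.
by rewrite leNgt; apply/negP => /jmin; rewrite ltnn.
Qed.

(** The series of the layers converges, so for large k the part of [X] between the hyperplane and
    the height [a k] has measure below e. The part above that height is at positive distance from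
    the complement of the half-space. *)
Lemma metric_outer_halfspace_fin :
  (mu (X `&` P) + mu (X `&` ~` P) <= mu X)%E.
Proof.
apply/lee_addgt0Pr => e e0.
have sh0 j : true -> (0 <= mu (shell j))%E by move=> _; exact: outer_measure_ge0.
have [k tailk] : exists k, (\sum_(k <= j <oo) mu (shell j) < e%:E)%E.
  have /fine_cvgP[fin /cvgrPdist_lt/(_ _ e0) cv] :=
    nneseries_tail_cvg shell_series_lty sh0.
  near \oo => k; exists k.
  rewrite -[ltLHS]fineK ?lte_fin; last by near: k.
  rewrite (le_lt_trans (ler_norm _))// -normrN -sub0r.
  by near: k.
apply: (@le_trans _ _ ((mu (X `&` Pa k) + e%:E) +
    mu (X `&` ~` P))%E).
  apply: leeD2r; apply: (le_trans (le_outer_measure mu _ _ (@halfspace_cover k))).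
  apply: (le_trans (outer_measureU2 _ _ _)); apply: leeD2l.
  exact: (le_trans (outer_measure_sigma_subadditive_tail _ _ _) (ltW tailk)).
rewrite addeAC; apply: leeD2r.
apply: (@le_trans _ _ (mu ((X `&` Pa k) `|`
    (X `&` ~` P)))).
  apply: (@mu_sep _ _ (a k) 0) => //; first by move=> x [].
  by move=> x [_ /negP]; rewrite -leNgt subr_le0.
by apply: le_outer_measure => x [[]|[]].
Unshelve. all: by end_near. Qed.

End metric_outer_measure.

Lemma metric_outer_halfspace (R : realType) (n : nat)
    (mu : {outer_measure set 'rV[R]_n -> \bar R}) (i : 'I_n) (c : R) :
  (forall (A B : set 'rV[R]_n) (d : R), 0 < d ->
     (forall a b, A a -> B b -> d <= enorm (a - b)) ->
     (mu A + mu B <= mu (A `|` B))%E) ->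
  mu.-caratheodory [set x | c < x 0 i].
Proof.
move=> mu_metric; apply: le_caratheodory_measurable => X.
have [Xoo|Xoo] := ltP (mu X) +oo%E; first exact: metric_outer_halfspace_fin.
by move: Xoo; rewrite leye_eq => /eqP ->; exact: leey.
Qed.

Section hausdorff_theory.
Context (R : realType) (n m : nat).
Implicit Types (A B E : set 'rV[R]_n) (delta : R).
Local Notation cst := (@hausdorff_cst R m).
Local Notation gauge := (@hausdorff_gauge R n m).
Local Notation H := (@hausdorff_outer R n m).
Local Notation Hpre := (@hausdorff_pre R n m).

Lemma hausdorff_cst_ge0 : 0 <= cst.
Proof. by rewrite divr_ge0 ?fine_ge0 ?exprn_ge0. Qed.

Lemma hausdorff_gaugeE_ge0 E : (0 <= gauge E)%E.
Proof.
by rewrite lee_fin mulr_ge0 ?hausdorff_cst_ge0 ?exprn_ge0 ?fine_ge0 ?ediam_ge0.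
Qed.

Lemma ediam_le E d : 0 <= d -> (forall x y, E x -> E y -> enorm (x - y) <= d) ->
  (ediam E <= d%:E)%E.
Proof.
move=> d0 Ed; apply: ge_ereal_sup => _ [->|[x Ex [y Ey <-]]]; rewrite lee_fin//.
exact: Ed.
Qed.

Lemma le_ediam E x y : E x -> E y -> ((enorm (x - y))%:E <= ediam E)%E.
Proof.
by move=> Ex Ey; apply: ereal_sup_ubound; right; exists x => //; exists y.
Qed.

Lemma hausdorff_pre_ge0' delta A : (0 <= Hpre delta A)%E.
Proof. by apply: cover_outer_ge0 => E _; exact: hausdorff_gaugeE_ge0. Qed.

Lemma hausdorff_pre_le delta delta' A : delta <= delta' ->
  (Hpre delta' A <= Hpre delta A)%E.
Proof.
move=> dd; apply: ereal_inf_le_tmp => _ [F [CF AF] <-].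
exists F => //; split=> // k E /CF /= h; apply: le_trans h _.
by rewrite lee_fin.
Qed.

Lemma hausdorff_pre_le_outer delta A : 0 < delta -> (Hpre delta A <= H A)%E.
Proof. by move=> d0; apply: ereal_sup_ubound; exists delta. Qed.

Lemma hausdorff_isometry_le (phi : 'rV[R]_n -> 'rV[R]_n) A :
  (forall x y, enorm (phi x - phi y) = enorm (x - y)) ->
  (H (phi @` A) <= H A)%E.
Proof.
move=> iso; apply: ge_ereal_sup => _ [d /= d0 <-].
apply: le_trans (hausdorff_pre_le_outer A d0).
have diam_le E : (ediam E <= d%:E)%E -> (ediam (phi @` E) <= ediam E)%E.
  move=> Ed; apply: ge_ereal_sup => _ [->|[_ [x Ex <-] [_ [y Ey <-] <-]]].
    exact: ediam_ge0.
  by rewrite iso; exact: le_ediam.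
rewrite -[leRHS]mul1e.
apply: (@cover_outer_image _ _ _ _ _ _ _ _ _ _ _ _ _ phi
  (fun E => phi @` E)) => //.
- by move=> E _; exact: hausdorff_gaugeE_ge0.
- by move=> E _; exact: hausdorff_gaugeE_ge0.
- by move=> E /= Ed; exact: le_trans (diam_le _ Ed) Ed.
- by move=> E _.
- move=> E Ed; rewrite mul1e lee_fin ler_wpM2l ?hausdorff_cst_ge0//.
  have fE : ediam E \is a fin_num.
    by rewrite ge0_fin_numE ?ediam_ge0// (le_lt_trans Ed)// ltry.
  rewrite lerXn2r ?nnegrE ?fine_ge0 ?ediam_ge0// fine_le ?diam_le//.
  rewrite ge0_fin_numE ?ediam_ge0// (le_lt_trans (diam_le _ Ed))//.
  by rewrite (le_lt_trans Ed)// ltry.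
Qed.

Lemma hausdorff_isometry (phi psi : 'rV[R]_n -> 'rV[R]_n) A :
  cancel phi psi -> (forall x y, enorm (phi x - phi y) = enorm (x - y)) ->
  (forall x y, enorm (psi x - psi y) = enorm (x - y)) ->
  H (phi @` A) = H A.
Proof.
move=> phiK iphi ipsi; apply/eqP; rewrite eq_le hausdorff_isometry_le//=.
have {1}-> : A = psi @` (phi @` A).
  apply/seteqP; split=> [x Ax|_ [_ [x Ax <-] <-]]; last by rewrite phiK.
  by exists (phi x); [exists x|rewrite phiK].
exact: hausdorff_isometry_le.
Qed.

(** A set of diameter at most delta < d cannot meet both A and B, so every covering of the union
    splits into a covering of A and one of B. *)
Lemma hausdorff_pre_sep A B d delta : delta < d ->
  (forall a b, A a -> B b -> d <= enorm (a - b)) ->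
  (Hpre delta A + Hpre delta B <= Hpre delta (A `|` B))%E.
Proof.
move=> dd AB; apply: le_ereal_inf_tmp => _ [F [CF ABF] <-].
pose meets E := if pselect (exists2 a, A a & E a) then true else false.
pose FA k := if F k is Some E then (if meets E then Some E else None) else None.
pose FB k := if F k is Some E then (if meets E then None else Some E) else None.
have cA : countable_cover [set E | (ediam E <= delta%:E)%E] id A FA.
  split=> [k E|a Aa].
    rewrite /FA; case Fk : (F k) => [E'|]//; case: (meets E') => // -[<-].
    exact: CF Fk.
  have [k _ Fka] := ABF a (or_introl Aa); exists k => //; rewrite /FA.
  case: (F k) Fka => [E|]//= Ea; rewrite /meets; case: pselect => //=.
  by case; exists a.
have cB : countable_cover [set E | (ediam E <= delta%:E)%E] id B FB.
  split=> [k E|b Bb].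
    rewrite /FB; case Fk : (F k) => [E'|]//; case: (meets E') => // -[<-].
    exact: CF Fk.
  have [k _ Fkb] := ABF b (or_intror Bb); exists k => //; rewrite /FB.
  case Fk : (F k) Fkb => [E|]//= Eb; rewrite /meets; case: pselect => //=.
  move=> [a Aa Ea]; have := le_ediam Ea Eb; have /= := CF _ _ Fk.
  move=> h /le_trans/(_ h); rewrite lee_fin leNgt.
  by rewrite (lt_le_trans dd (AB _ _ Aa Bb)).
apply: (le_trans (leeD (cover_outer_sum_le _ cA) (cover_outer_sum_le _ cB))).
have tg0 : forall E, [set E | (ediam E <= delta%:E)%E] E -> (0 <= gauge E)%E.
  by move=> E _; exact: hausdorff_gaugeE_ge0.
rewrite -nneseriesD.
- apply: lee_nneseries => k.
    by move=> _ _; apply: adde_ge0;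
      [exact: (cover_term_ge0 tg0 cA)|exact: (cover_term_ge0 tg0 cB)].
  move=> _; rewrite /FA /FB; case: (F k) => [E|]/=; last by rewrite adde0.
  by case: (meets E) => /=; rewrite ?adde0 ?add0e.
- by move=> k _ _; exact: (cover_term_ge0 tg0 cA).
- by move=> k _ _; exact: (cover_term_ge0 tg0 cB).
Qed.

Lemma hausdorff_metric A B d : 0 < d ->
  (forall a b, A a -> B b -> d <= enorm (a - b)) ->
  (H A + H B <= H (A `|` B))%E.
Proof.
move=> d0 AB.
have Hge0 C : (0 <= H C)%E by exact: outer_measure_ge0.
(* The two suprema over scales are taken one after the other, which asks for the inequality at
   independent scales s and t; a scale below s, t and d yields it. *)
have key s t : 0 < s -> 0 < t -> (Hpre s A + Hpre t B <= H (A `|` B))%E.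
  move=> s0 t0; pose u := Num.min (Num.min s t) (d / 2).
  have u0 : 0 < u by rewrite !lt_min s0 t0 divr_gt0.
  have ud : u < d.
    by rewrite gt_min; apply/orP; right; rewrite ltr_pdivrMr// ltr_pMr// ltr1n.
  apply: le_trans (hausdorff_pre_le_outer _ u0).
  apply: le_trans (hausdorff_pre_sep ud AB).
  by apply: leeD; apply: hausdorff_pre_le; rewrite !ge_min lexx ?orbT.
have [Uoo|Uoo] := eqVneq (H (A `|` B)) +oo%E; first by rewrite Uoo leey.
have Ufin : H (A `|` B) \is a fin_num by rewrite ge0_fin_numE// ltey.
have fin s C : 0 < s -> (H C < +oo)%E -> Hpre s C \is a fin_num.
  move=> s0 Coo; rewrite ge0_fin_numE ?hausdorff_pre_ge0'//.
  exact: le_lt_trans (hausdorff_pre_le_outer _ s0) Coo.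
have Boo : (H B < +oo)%E.
  apply: (@le_lt_trans _ _ (H (A `|` B))); last by rewrite ltey.
  by apply: le_outer_measure; exact: subsetUr.
rewrite -leeBrDr ?ge0_fin_numE//.
apply: ge_ereal_sup => _ [s /= s0 <-].
rewrite leeBrDr ?ge0_fin_numE// addeC -leeBrDr; last first.
  apply: fin => //; apply: (@le_lt_trans _ _ (H (A `|` B))); last by rewrite ltey.
  by apply: le_outer_measure; exact: subsetUl.
apply: ge_ereal_sup => _ [t /= t0 <-].
rewrite leeBrDr; first by rewrite addeC; exact: key.
apply: fin => //; apply: (@le_lt_trans _ _ (H (A `|` B))); last by rewrite ltey.
by apply: le_outer_measure; exact: subsetUl.
Qed.

Local Notation HT := (hausdorff_type R n m).

Lemma measurable_hausdorff_borel : measurable_fun setT (id : HT -> borel_rV R n).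
Proof.
apply: borel_measurable_fun => i; apply: measurable_fun_gt => c.
by apply: metric_outer_halfspace; exact: hausdorff_metric.
Qed.

Lemma borel_hausdorff (A : set 'rV[R]_n) :
  measurable (A : set (borel_rV R n)) -> measurable (A : set HT).
Proof.
by move=> mA; have := measurable_hausdorff_borel measurableT mA; rewrite setTI.
Qed.

End hausdorff_theory.

(** * Spheres have positive and finite Hausdorff measure *)

Section sphere_hausdorff.
Context (R : realType) (n : nat).
Hypothesis n_ge2 : (2 <= n)%N.
Local Notation m := n.-1.
Local Notation cst := (@hausdorff_cst R m).
Local Notation H := (@hausdorff_outer R n m).
Local Notation Hpre := (@hausdorff_pre R n m).
Local Notation leb := (@lebesgue_rV R n).
Local Notation vol := (unit_vol R n).

Let n_gt0 : (0 < n)%N. Proof. exact: ltnW. Qed.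
Let m_gt0 : (0 < m)%N. Proof. by rewrite -ltnS prednK. Qed.

Lemma hausdorff_cst_gt0 : 0 < cst.
Proof. by rewrite divr_gt0 ?exprn_gt0//; exact: (unit_vol_gt0 R m_gt0). Qed.

Section upper.
Variables (r t : R).
Hypotheses (t_gt0 : 0 < t) (tr : t < r).
(** Half-open cubes of side t / n have diameter at most t by [enorm_le_coord]. Those meeting the
    sphere lie in a shell of thickness 3 t, and comparing volumes bounds their number by a multiple
    of t^(1-n). *)
Let rho : R := t / n%:R.
Let rho_gt0 : 0 < rho. Proof. by rewrite divr_gt0// ltr0n. Qed.
Let corner (k : 'rV[int]_n) : 'rV[R]_n * 'rV[R]_n :=
  (\row_i (rho * (k 0 i)%:~R), \row_i (rho * ((k 0 i)%:~R + 1))).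
Let S := @esphere R n 0 r.
(** With [pickle_inv], unlike [unpickle], each integer vector is listed at one index only; this
    makes the cubes [G j] disjoint. *)
Let used (j : nat) : option 'rV[int]_n :=
  if pickle_inv j is Some k then
    (if pselect (exists2 y, S y & box (corner k) y) then Some k else None)
  else None.
Let F j : option (set 'rV[R]_n) := omap (fun k => box (corner k)) (used j).

Let le_corner k : @le_corners R n (corner k).
Proof. by move=> i; rewrite /= !mxE ler_pM2l// lerDl. Qed.

Let box_diam k x y : box (corner k) x -> box (corner k) y -> enorm (x - y) <= t.
Proof.
move=> kx ky; have -> : t = n%:R * rho by rewrite mulrC divfK// pnatr_eq0 -lt0n.
apply: enorm_le_coord => [|i]; first exact: ltW.
have := kx i; have := ky i; rewrite /= !mxE mulrDr mulr1 => /andP[a b] /andP[c d].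
by rewrite ler_norml; lra.
Qed.

Let box_mem (y : 'rV[R]_n) :
  box (corner (\row_i (Num.ceil (y 0 i / rho) - 1))) y.
Proof.
move=> i; rewrite /= !mxE.
rewrite -ltr_pdivlMl// -ler_pdivrMl// ![rho^-1 * _]mulrC ceilB1_lt/=.
by rewrite intrB subrK ceil_ge.
Qed.

Let box_inj k l y : box (corner k) y -> box (corner l) y -> k = l.
Proof.
move=> ky ly; apply/rowP => i.
have := ky i; have := ly i; rewrite /= !mxE => /andP[a b] /andP[c d].
have := lt_le_trans a d; have := lt_le_trans c b; rewrite !ltr_pM2l//.
rewrite -!intrD1 !ltr_int => h1 h2; apply/eqP; rewrite eq_le.
by rewrite -!ltzD1 h1 h2.
Qed.

Let used_some j k : used j = Some k -> pickle k = j /\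
  exists2 y, S y & box (corner k) y.
Proof.
rewrite /used; case E : (pickle_inv j) => [k'|]//; case: pselect => // h [<-].
by split=> //; have := pickle_invK (T := 'rV[int]_n) j; rewrite /oapp E.
Qed.

Let shell_cover k y : (exists2 z, S z & box (corner k) z) -> box (corner k) y ->
  (eball 0 (r + 2 * t) `\` eball 0 (r - t)) y.
Proof.
move=> [z Sz kz] ky; have := box_diam ky kz; have := box_diam kz ky.
have := enormD (y - z) z; have := enormD (z - y) y; rewrite !subrK.
move: Sz; rewrite /S /esphere/= subr0 => ->.
move=> h1 h2 h3 h4; split; rewrite /eball/= subr0; first by have := t_gt0; lra.
by apply/negP; rewrite -leNgt; lra.
Qed.

Let G j : set 'rV[R]_n := oapp (fun k => box (corner k)) set0 (used j).

Let mG j : measurable (G j : set (lebesgue_type R n)).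
Proof.
rewrite /G; case: used => [k|]/=; last exact: measurable0.
by apply: borel_lebesgue; exact: borel_box.
Qed.

Let trivG : trivIset setT G.
Proof.
apply/trivIsetP => j j' _ _ jj'; apply/seteqP; split=> // y [].
rewrite /G; case E : (used j) => [k|]//=; case E' : (used j') => [k'|]//= ky k'y.
have kk' := box_inj ky k'y; have [h _] := used_some E; have [h' _] := used_some E'.
by move/eqP: jj'; apply; rewrite -h -h' kk'.
Qed.

Let powB_le (a b : R) : 0 <= b -> b <= a -> a ^+ n - b ^+ n <= (a - b) * (n%:R * a ^+ m).
Proof.
move=> b0 ba; have a0 := le_trans b0 ba.
rewrite subrXX ler_wpM2l ?subr_ge0// mulr_natl -[n in _ *+ n]card_ord -sumr_const.
apply: ler_sum => i _.
have -> : a ^+ m = a ^+ (n.-1 - i) * a ^+ i.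
  by rewrite -exprD subnK// -ltnS prednK.
by rewrite ler_wpM2l ?exprn_ge0// lerXn2r.
Qed.

(** The bound does not depend on t: of order t^(1-n) cubes are used, each of gauge at most
    [cst * t ^+ m] with m = n - 1. Hence the supremum over scales is finite. *)
Lemma hausdorff_pre_sphere_le : (Hpre t (@esphere R n 0 r) <=
  (cst * vol * 3 * n%:R ^+ n.+1 * (3 * r) ^+ m)%:E)%E.
Proof.
have cF : countable_cover [set E | (ediam E <= t%:E)%E] id S F.
  split=> [j E|y Sy].
    rewrite /F; case: used => [k|]//= [<-]; apply: ediam_le; first exact: ltW.
    exact: box_diam.
  pose k := \row_i (Num.ceil (y 0 i / rho) - 1).
  exists (pickle k) => //; rewrite /F /used pickleK_inv.
  by case: pselect => [h|h] /=; [exact: box_mem|apply: h; exists y; [|exact: box_mem]].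
apply: (le_trans (cover_outer_sum_le _ cF)).
have vk k : leb (box (corner k)) = (rho ^+ n)%:E.
  rewrite lebesgue_box//; congr EFin.
  rewrite -[n in _ ^+ n]card_ord -prodr_const; apply: eq_bigr => i _.
  by rewrite !mxE mulrDr mulr1 addrAC subrr add0r.
(* Ratio of the gauge bound of a cube to its volume; it turns the sum of gauges into the volume of a
   disjoint union. *)
pose q : R := cst * t ^+ m / rho ^+ n.
have q_ge0 : 0 <= q.
  apply: divr_ge0; last by rewrite exprn_ge0// ltW.
  by apply: mulr_ge0; [exact: hausdorff_cst_ge0|rewrite exprn_ge0// ltW].
apply: (@le_trans _ _ (\sum_(j <oo) (q%:E * leb (G j)))%E).
  apply: lee_nneseries => j _.
    move=> _; rewrite /F; case: used => [k|]//=; exact: hausdorff_gaugeE_ge0.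
  rewrite /F /G; case: used => [k|]/=; last by rewrite measure0 mule0.
  rewrite vk -EFinM lee_fin /q divfK ?gt_eqF ?exprn_gt0//.
  rewrite ler_wpM2l ?hausdorff_cst_ge0// lerXn2r ?nnegrE ?fine_ge0 ?ediam_ge0//.
    exact: ltW.
  have dk : (ediam (box (corner k)) <= t%:E)%E.
    by apply: ediam_le; [exact: ltW|exact: box_diam].
  rewrite -[leRHS]/(fine t%:E) fine_le// ge0_fin_numE ?ediam_ge0//.
  exact: le_lt_trans dk (ltry _).
rewrite nneseriesZl; last by move=> j _; exact: measure_ge0.
have -> : (\sum_(j <oo) leb (G j) = leb (\bigcup_j G j))%E.
  by rewrite measure_semi_bigcup//; exact: bigcupT_measurable.
have Gshell : \bigcup_j G j `<=` eball 0 (r + 2 * t) `\` eball 0 (r - t).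
  move=> y [j _]; rewrite /G; case E : (used j) => [k|]//= ky.
  by have [_ h] := used_some E; exact: shell_cover h ky.
have rt : 0 < r - t by rewrite subr_gt0.
have r2t : 0 < r + 2 * t by have := t_gt0; have := tr; lra.
have shell_le : (leb (\bigcup_j G j) <=
    (vol * (3 * t * (n%:R * (3 * r) ^+ m)))%:E)%E.
  apply: (le_trans (le_lebesgue Gshell)).
  rewrite measureD/=; [|by apply: borel_lebesgue; exact: borel_eball..|
    exact: lebesgue_eball_lty].
  rewrite setIidr => [|y]; last first.
    by rewrite /eball/= subr0 => /lt_le_trans; apply; have := t_gt0; lra.
  rewrite !lebesgue_eball// -EFinB lee_fin -mulrBr.
  rewrite ler_wpM2l ?(ltW (unit_vol_gt0 _ _))//.
  apply: (le_trans (powB_le (ltW rt) _)); first by have := t_gt0; lra.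
  rewrite [X in X * _](_ : _ = 3 * t); last by ring.
  rewrite ler_wpM2l ?mulr_ge0 ?(ltW t_gt0)// ler_wpM2l//.
  rewrite lerXn2r ?nnegrE ?(ltW r2t)//; have := tr; have := t_gt0; lra.
apply: (@le_trans _ _ (q%:E * (vol * (3 * t * (n%:R * (3 * r) ^+ m)))%:E)%E).
  by rewrite lee_wpmul2l// lee_fin.
rewrite -EFinM lee_fin le_eqVlt; apply/orP; left; apply/eqP.
rewrite /q /rho exprMn exprVn invfM invrK.
have -> : t ^+ n = t ^+ m * t by rewrite -exprSr prednK.
rewrite exprSr; have tm : t ^+ m != 0 by rewrite gt_eqF// exprn_gt0.
by field; rewrite tm gt_eqF.
Qed.

End upper.

Section lower.
Variable r : R.
Hypothesis r_gt0 : 0 < r.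

Definition cone (E : set 'rV[R]_n) : set 'rV[R]_n :=
  [set z | exists2 s, 0 < s <= 1 & exists2 y, E y /\ enorm y = r & z = s *: y].

(* The cone over E lies in a union of O(r/d) balls of radius 3d centred on the
   segment from 0 to a point of E. *)
Let cone_tube (E : set 'rV[R]_n) d : 0 < d -> d <= 2 * r ->
  (forall x y, E x -> E y -> enorm (x - y) <= d) ->
  (leb (cone E) <= (3 * r * vol * 3 ^+ n * d ^+ m)%:E)%E.
Proof.
move=> d0 dr Ed.
have c0 := unit_vol_gt0 R n_gt0.
have [[y0 [Ey0 y0r]]|noy] := pselect (exists y, E y /\ enorm y = r); last first.
  have -> : cone E = set0.
    apply/seteqP; split=> // z [s _ [y Ey _]]; apply: noy.
    by exists y.
  by rewrite measure0 lee_fin !mulr_ge0 ?exprn_ge0// ltW.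
(* The centres are d apart along the segment; d <= 2 r bounds their number by 3 r / d. *)
pose N := (Num.truncn (r / d)).+1.
pose B j := eball ((j%:R * d / r) *: y0) (3 * d).
have cover : cone E `<=` \big[setU/set0]_(j < N) B j.
  move=> _ [s /andP[s0 s1] [y [Ey yr] ->]].
  have srd0 : 0 <= s * r / d by rewrite !mulr_ge0 ?invr_ge0 ?(ltW d0) ?(ltW r_gt0)// ltW.
  pose j := Num.truncn (s * r / d).
  have /andP[j1 j2] := truncn_itv srd0.
  have jN : (j < N)%N.
    rewrite ltnS; apply: le_truncn; rewrite ler_pM2r ?invr_gt0//.
    by rewrite ler_piMl// ltW.
  rewrite -(bigcup_mkord _ B); exists j => //; rewrite /B /eball/=.
  apply: (le_lt_trans (enormB_le (s *: y0) _ _)).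
  rewrite -scalerBr -scalerBl !enormZ y0r gtr0_norm//.
  have h1 : s * enorm (y - y0) <= d.
    by rewrite (le_trans _ (Ed _ _ Ey Ey0))// ler_piMl// enorm_ge0.
  have h2 : `|s - j%:R * d / r| * r <= d.
    rewrite -[X in _ * X](gtr0_norm r_gt0) -normrM mulrBl divfK ?gt_eqF//.
    have : j%:R * d <= s * r by rewrite -ler_pdivlMr.
    have : s * r < j%:R * d + d.
      by move: j2; rewrite ltr_pdivrMr// -/j -natr1 mulrDl mul1r.
    by rewrite ler_norml; lra.
  by have := d0; lra.
apply: (le_trans (le_lebesgue cover)).
apply: (le_trans (outer_measure_subadditive (@lebesgue_outer R n) B N)).
apply: (@le_trans _ _ (\sum_(j < N) (vol * (3 * d) ^+ n)%:E)).
  by apply: lee_sum => j _; rewrite -[leLHS]/(leb (B j)) lebesgue_eball// mulr_gt0.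
rewrite sumEFin lee_fin sumr_const card_ord.
have Nle : N%:R <= 3 * r / d.
  have rd0 : 0 <= r / d by rewrite divr_ge0// ltW.
  have /andP[N1 _] := truncn_itv rd0.
  have dr2 : 1 <= 2 * (r / d) by rewrite mulrA ler_pdivlMr// mul1r.
  by rewrite /N -natr1 -mulrA; lra.
apply: (@le_trans _ _ (vol * (3 * d) ^+ n * (3 * r / d))).
  by rewrite -[leLHS]mulr_natr ler_wpM2l// mulr_ge0 ?exprn_ge0 ?mulr_ge0// ltW.
rewrite exprMn; have -> : d ^+ n = d ^+ m * d by rewrite -exprSr prednK.
rewrite le_eqVlt; apply/orP; left; apply/eqP.
by field; rewrite gt_eqF.
Qed.

Let cone_diam (E : set 'rV[R]_n) : (ediam E <= r%:E)%E ->
  (leb (cone E) <= (3 * r * vol * 3 ^+ n * fine (ediam E) ^+ m)%:E)%E.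
Proof.
move=> Er; have fE : ediam E \is a fin_num.
  by rewrite ge0_fin_numE ?ediam_ge0// (le_lt_trans Er)// ltry.
have Ed d : fine (ediam E) <= d -> forall x y, E x -> E y -> enorm (x - y) <= d.
  by move=> dd x y Ex Ey; rewrite (le_trans _ dd)// -lee_fin fineK// le_ediam.
have fr : fine (ediam E) <= r by rewrite -lee_fin fineK.
have [d0|] := ltP 0 (fine (ediam E)).
  by apply: cone_tube => //; [have := r_gt0; lra|exact: Ed].
move=> d0; have {}d0 : fine (ediam E) = 0.
  by apply/eqP; rewrite eq_le d0 fine_ge0// ediam_ge0.
rewrite d0 expr0n gtn_eqF//= mulr0.
(* For diameter 0 the tube bound is used with arbitrarily small d > 0; d <= 1 gives d^m <= d since m
   >= 1. *)
apply/lee_addgt0Pr => e e0; rewrite add0e.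
pose K := 3 * r * vol * 3 ^+ n.
have K0 : 0 < K by rewrite !mulr_gt0 ?exprn_gt0// unit_vol_gt0.
pose d := Num.min (Num.min 1 r) (e / K).
have dpos : 0 < d by rewrite !lt_min ltr01 r_gt0 divr_gt0.
have d1 : d <= 1 by rewrite !ge_min lexx.
have dr : d <= r by rewrite !ge_min lexx orbT.
have dK : d <= e / K by rewrite !ge_min lexx !orbT.
apply: (le_trans (@cone_tube E d dpos _ _)).
- by have := r_gt0; lra.
- by apply: Ed; rewrite d0 ltW.
- rewrite lee_fin -/K mulrC -ler_pdivlMr// (le_trans _ dK)//.
  by rewrite -[leRHS]expr1 ler_wiXn2l// ltW.
Qed.

(** The cones over the sets of a covering of the sphere fill the punctured ball, and a cone has
    volume at most a constant times the gauge of its base. So the coverings at scale r already have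
    total gauge bounded below by a multiple of the volume of the ball. *)
Lemma hausdorff_sphere0_gt0 : (0 < H (esphere 0 r))%E.
Proof.
have c0 := unit_vol_gt0 R n_gt0.
have k0 := hausdorff_cst_gt0.
pose K := 3 * r * vol * 3 ^+ n.
have K0 : 0 < K by rewrite !mulr_gt0 ?exprn_gt0.
apply: (@lt_le_trans _ _ (cst / K * (vol * r ^+ n))%:E).
  by rewrite lte_fin mulr_gt0 ?(divr_gt0 k0 K0)// mulr_gt0// exprn_gt0.
apply: le_trans (hausdorff_pre_le_outer m _ r_gt0).
apply: le_ereal_inf_tmp => _ [F [CF SF] <-].
have kK : 0 < cst / K by exact: divr_gt0.
rewrite EFinM -lee_pdivlMl//.
rewrite invfM invrK -nneseriesZl; last first.
  by move=> j _; case: (F j) => //= E; exact: hausdorff_gaugeE_ge0.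
rewrite -(lebesgue_eball 0 r_gt0).
have -> : leb (eball 0 r) = leb (eball 0 r `\` [set 0]).
  rewrite measureD/=; [|by apply: borel_lebesgue; exact: borel_eball|
    by apply: borel_lebesgue; exact: borel_set1|exact: lebesgue_eball_lty].
  rewrite setIidr; last by move=> _ ->; rewrite /eball/= subrr enorm0.
  by rewrite lebesgue_set1// sube0.
have cov : eball 0 r `\` [set 0] `<=` \bigcup_k oapp cone set0 (F k).
  move=> z [/=]; rewrite /eball/= subr0 => zr /eqP z0.
  have nz : 0 < enorm z by rewrite enorm_gt0.
  have [k _ Fk] : (\bigcup_k oapp id set0 (F k)) ((r / enorm z) *: z).
    apply: SF; rewrite /esphere/= subr0 enormZ ger0_norm ?divr_ge0 ?(ltW r_gt0) ?ltW//.
    by rewrite divfK ?gt_eqF.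
  exists k => //; case: (F k) Fk => [E|]//= Ez.
  exists (enorm z / r); first by rewrite divr_gt0//= ler_pdivrMr// mul1r ltW.
  exists ((r / enorm z) *: z); first split=> //.
    rewrite enormZ ger0_norm ?divr_ge0 ?(ltW r_gt0) ?ltW//.
    by rewrite divfK ?gt_eqF.
  rewrite scalerA mulrA divfK ?gt_eqF// divff ?gt_eqF// scale1r//.
apply: (le_trans (le_lebesgue cov)).
apply: (le_trans (outer_measure_sigma_subadditive (@lebesgue_outer R n) _)).
apply: lee_nneseries => j; first by move=> _ _; exact: outer_measure_ge0.
move=> _; case Fj : (F j) => [E|]/=; last by rewrite mule0 outer_measure0.
apply: (le_trans (cone_diam (CF _ _ Fj))).
rewrite -EFinM lee_fin -/K le_eqVlt; apply/orP; left; apply/eqP.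
by field; rewrite gt_eqF.
Qed.

End lower.

Lemma hausdorff_sphere_translate x r : H (esphere x r) = H (esphere 0 r).
Proof.
have -> : esphere x r = (fun y => x + y) @` (esphere 0 r).
  apply/seteqP; split=> [y Sy|_ [y Sy <-]].
    exists (y - x); last by rewrite addrCA subrr addr0.
    by rewrite /esphere/= subr0.
  by rewrite /esphere/= addrAC subrr add0r; move: Sy; rewrite /esphere/= subr0.
apply: (@hausdorff_isometry _ _ _ _ (fun y => - x + y)) => [y|y z|y z].
- by rewrite addKr.
- by rewrite opprD addrACA subrr add0r.
- by rewrite opprD addrACA subrr add0r.
Qed.

Lemma hausdorff_sphere_gt0 x r : 0 < r -> (0 < H (esphere x r))%E.
Proof. by rewrite hausdorff_sphere_translate; exact: hausdorff_sphere0_gt0. Qed.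

Lemma hausdorff_sphere_lty x r : 0 < r -> (H (esphere x r) < +oo)%E.
Proof.
rewrite hausdorff_sphere_translate => r0.
apply: (@le_lt_trans _ _ (cst * vol * 3 * n%:R ^+ n.+1 * (3 * r) ^+ m)%:E);
  last exact: ltry.
apply: ge_ereal_sup => _ [d /= d0 <-].
pose t := Num.min d (r / 2).
have t0 : 0 < t by rewrite lt_min d0 divr_gt0.
have tr : t < r by rewrite gt_min; apply/orP; right; lra.
have td : t <= d by rewrite ge_min lexx.
apply: (le_trans (hausdorff_pre_le m _ td)); exact: hausdorff_pre_sphere_le.
Qed.

End sphere_hausdorff.

(** * Measures determined by their values on balls *)

Definition image_measure d d' (T1 : measurableType d) (T2 : measurableType d')
    (R : realFieldType) (m : {measure set T1 -> \bar R}) (f : T1 -> T2)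
    (mf : measurable_fun setT f) : {measure set T2 -> \bar R}.
Proof. by refine (pushforward m f : {measure set T2 -> \bar R}). Defined.

Section sigma_finite_measure_of.
Context d (T : measurableType d) (R : realType).
Variables (m : {measure set T -> \bar R}) (s : sigma_finite setT m).

(** The dummy [let] keeps the proof [s] in the term, from which the sigma-finite instance recovers
    it. *)
Definition sigma_finite_measure_of : set T -> \bar R := let _ := s in m.

HB.instance Definition _ := isMeasure.Build _ _ _ sigma_finite_measure_of
  (measure0 m) (@measure_ge0 _ _ _ m) (@measure_semi_sigma_additive _ _ _ m).

HB.instance Definition _ := @Measure_isSigmaFinite.Build _ _ _
  sigma_finite_measure_of s.
End sigma_finite_measure_of.

Section equal_ball_measures.
Context (R : realType) (n : nat).
Local Notation brV := (borel_rV R n).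
Local Open Scope ereal_scope.

Lemma measurable_rV_sub :
  measurable_fun setT (fun p : brV * brV => ((p.2 : 'rV[R]_n) - p.1)%R : brV).
Proof.
apply: borel_measurable_fun => i.
apply: (eq_measurable_fun (fun p : brV * brV =>
  ((p.2 : 'rV[R]_n) ord0 i - (p.1 : 'rV[R]_n) ord0 i)%R)).
  by move=> p _; rewrite !mxE.
apply: measurable_funB.
  exact: (measurableT_comp (borel_coord i) measurable_snd).
exact: (measurableT_comp (borel_coord i) measurable_fst).
Qed.

(** Both sides are the product measure of the set of pairs in A x B at distance less than rho. *)
Lemma fubini_balls (mu nu : {sigma_finite_measure set brV -> \bar R})
    (A B : set brV) (rho : R) : measurable A -> measurable B ->
  \int[nu]_(x in A) mu (B `&` eball x rho) =
  \int[mu]_(y in B) nu (A `&` eball y rho).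
Proof.
move=> mA mB.
pose D : set (brV * brV) :=
  (fst @^-1` A) `&` (snd @^-1` B) `&` [set p | (enorm (p.2 - p.1)%R < rho)%R].
have mD : measurable D.
  apply: measurableI; first apply: measurableI.
  - by rewrite -[X in measurable X]setTI; exact: measurable_fst.
  - by rewrite -[X in measurable X]setTI; exact: measurable_snd.
  - rewrite -[X in measurable X]setTI.
    rewrite (_ : [set p | _] = (fun p : brV * brV =>
        enorm ((p.2 : 'rV[R]_n) - p.1)%R) @^-1` `]-oo, rho[%classic).
      exact: (measurableT_comp (@borel_enorm R n) measurable_rV_sub).
    by apply/seteqP; split=> p /=; rewrite in_itv.
have := indic_fubini_tonelli nu mu mD.
rewrite indic_fubini_tonelli_FE// indic_fubini_tonelli_GE//.
rewrite [X in _ -> X = _]integral_mkcond [X in _ -> _ = X]integral_mkcond.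
have -> : (mu \o xsection D) = (fun x => mu (B `&` eball x rho)) \_ A.
  apply/funext => x; rewrite patchE /=; case: ifPn => [/set_mem Ax|xA].
    congr (mu _); apply/seteqP; split=> y; rewrite /xsection/= inE /D/=.
      by move=> [[_ By] xy].
    by move=> [By xy].
  rewrite (_ : xsection D x = set0) ?measure0//.
  apply/seteqP; split=> // y; rewrite /xsection/= inE /D/= => -[[Ax _] _].
  by move/negP: xA; apply; exact: mem_set.
have -> : (nu \o ysection D) = (fun y => nu (A `&` eball y rho)) \_ B.
  apply/funext => y; rewrite patchE /=; case: ifPn => [/set_mem By|yB].
    congr (nu _); apply/seteqP; split=> x; rewrite /ysection/= inE /D/=.
      by move=> [[Ax _] xy]; split=> //; rewrite /eball/= enormC.
    by move=> [Ax xy]; split=> //; rewrite enormC.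
  rewrite (_ : ysection D y = set0) ?measure0//.
  apply/seteqP; split=> // x; rewrite /ysection/= inE /D/= => -[[_ By] _].
  by move/negP: yB; apply; exact: mem_set.
by [].
Qed.

Lemma measurable_ball_measure (mu : {sigma_finite_measure set brV -> \bar R})
    (B : set brV) (rho : R) : measurable B ->
  measurable_fun setT (fun x : brV => mu (B `&` eball x rho)).
Proof.
move=> mB.
pose D : set (brV * brV) :=
  (snd @^-1` B) `&` [set p | (enorm (p.2 - p.1)%R < rho)%R].
have mD : measurable D.
  apply: measurableI.
  - by rewrite -[X in measurable X]setTI; exact: measurable_snd.
  - rewrite -[X in measurable X]setTI.
    rewrite (_ : [set p | _] = (fun p : brV * brV =>
        enorm ((p.2 : 'rV[R]_n) - p.1)%R) @^-1` `]-oo, rho[%classic).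
      exact: (measurableT_comp (@borel_enorm R n) measurable_rV_sub).
    by apply/seteqP; split=> p /=; rewrite in_itv.
have := measurable_fun_xsection mu mD.
rewrite (_ : (mu \o _) = (fun x : brV => mu (B `&` eball x rho)))//.
apply/funext => x /=; congr (mu _); apply/seteqP.
by split=> y; rewrite /xsection/= inE.
Qed.

Let inner (U : set 'rV[R]_n) (rho : R) : set 'rV[R]_n :=
  [set x | eball x rho `<=` U].

Let inner_measurable U rho : measurable (inner U rho : set brV).
Proof.
apply: borel_closed; rewrite -[inner U rho]setCK; apply: open_closedC.
rewrite openE => x /existsNP[y /not_implyP[xy Uy]].
apply/nbhs_eballP; exists (rho - enorm (y - x))%R; first by rewrite subr_gt0.
move=> z /= xz; apply/existsNP; exists y; apply/not_implyP; split=> //.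
rewrite /eball/= (le_lt_trans (enormB_le x _ _))// [X in (_ + X)%R]enormC.
by rewrite addrC -ltrBrDr.
Qed.

(* Christensen's lemma: compare nu and mu on {x : B(x, rho) is included in U}
   by integrating the measure of balls, and let rho tend to 0. *)
Lemma measure_le_of_balls (mu nu : {sigma_finite_measure set brV -> \bar R})
    (T : set brV) (h : R -> R) (k : R) :
  measurable T -> mu (~` T) = 0 -> nu (~` T) = 0 -> (0 <= k)%R ->
  (forall rho, 0 < rho -> 0 < h rho)%R ->
  (forall x rho, T x -> (0 < rho)%R -> (h rho)%:E <= mu (eball x rho)) ->
  (forall y rho, T y -> (0 < rho)%R -> nu (eball y rho) <= (k * h rho)%:E) ->
  forall U : set 'rV[R]_n, open U -> nu U <= k%:E * mu U.
Proof.
move=> mT muT nuT k0 h0 hmu hnu U oU.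
have mU : measurable (U : set brV) by exact: borel_open.
have onT (m : {sigma_finite_measure set brV -> \bar R}) (V : set brV) :
    m (~` T) = 0 -> measurable V -> m V = m (V `&` T).
  move=> mT0 mV; rewrite [LHS](@measureDI _ _ _ m V T)//.
  rewrite [X in X + _](_ : _ = 0) ?add0e//; apply/eqP.
  rewrite eq_le measure_ge0 andbT -mT0; apply: le_measure; rewrite ?inE//.
    exact: measurableD.
  exact: measurableC.
(* With [A] and [B] as set below, h(rho) nu(A) is at most the integral over A of mu(B cap ball),
   which equals the integral over B of nu(A cap ball), at most k h(rho) mu(B); then h(rho) > 0
   cancels. *)
have step rho : (0 < rho)%R -> nu (inner U rho `&` T) <= k%:E * mu U.
  move=> rho0; set A : set brV := inner U rho `&` T; set B : set brV := U `&` T.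
  have mA : measurable A by exact: measurableI.
  have mB : measurable B by exact: measurableI.
  have hr := h0 _ rho0.
  rewrite -(@lee_pmul2l _ (h rho)%:E)// ?lte_fin//.
  rewrite -integral_cst//.
  apply: (@le_trans _ _ (\int[nu]_(x in A) mu (B `&` eball x rho))).
    apply: ge0_le_integral => //.
    - by move=> x _; rewrite lee_fin ltW.
    - by apply: measurable_funTS; exact: measurable_ball_measure.
    - move=> x [Ux Tx]; apply: (le_trans (hmu x rho Tx rho0)).
      rewrite (onT mu (eball x rho) muT (borel_eball _ _)).
      rewrite (_ : eball x rho `&` T = B `&` eball x rho)//.
      apply/seteqP; split=> [y [xy Ty]|y [[Uy Ty] xy]]; last by split.
      by split=> //; split=> //; exact: Ux.
  rewrite fubini_balls//.
  apply: (@le_trans _ _ (\int[mu]_(y in B) (k * h rho)%:E)).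
    apply: ge0_le_integral => //.
    - by apply: measurable_funTS; exact: measurable_ball_measure.
    - move=> y [Uy Ty]; apply: le_trans (hnu y rho Ty rho0).
      apply: le_measure; rewrite ?inE//; last exact: borel_eball.
      by apply: measurableI => //; exact: borel_eball.
  rewrite integral_cst// mulrC EFinM -muleA (onT mu U)//.
pose F (j : nat) : set brV := inner U j.+1%:R^-1 `&` T.
have FU : \bigcup_j F j = U `&` T.
  apply/seteqP; split=> [x [j _ [Ux Tx]]|x [Ux Tx]].
    by split=> //; apply: Ux; rewrite /eball/= subrr enorm0 invr_gt0.
  have /nbhs_eballP[r r0 rU] : nbhs x U by exact: open_nbhs_nbhs.
  have [j] := ltr_add_invr r0; rewrite add0r => jr.
  exists j => //; split=> // y; rewrite /eball/= => xy; apply: rU.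
  exact: lt_trans xy jr.
rewrite (onT nu U)// -FU.
have cvF : nu \o F @ \oo --> nu (\bigcup_j F j).
  apply: nondecreasing_cvg_mu.
  - by move=> j; exact: measurableI.
  - by rewrite FU; exact: measurableI.
  - move=> i j ij; apply/subsetPset => x [Ux Tx]; split=> // y xy; apply: Ux.
    move: xy; rewrite /eball/= => /lt_le_trans; apply.
    by rewrite lef_pV2 ?posrE// ler_nat.
rewrite -(cvg_lim _ cvF)//; apply: lime_le; first by apply/cvg_ex; eexists; exact: cvF.
by apply: nearW => j; apply: step; rewrite invr_gt0.
Qed.

End equal_ball_measures.

(** * Invariance of the Lebesgue measure under reflections *)

Section rotation_invariance.
Context (R : realType) (n : nat).
Hypothesis n_gt0 : (0 < n)%N.
Local Notation brV := (borel_rV R n).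
Local Notation leb := (@lebesgue_rV R n).
Local Notation vol := (unit_vol R n).

Lemma open_refl d (U : set 'rV[R]_n) : open U -> open (refl d @^-1` U).
Proof.
rewrite !openE => oU x /= /oU /nbhs_eballP[r r0 rU].
apply/nbhs_eballP; exists r => // y xy; apply: rU.
by rewrite /eball/= -reflB enorm_refl.
Qed.

Lemma measurable_refl d : measurable_fun setT (refl d : brV -> brV).
Proof.
apply: (@measurability _ _ _ _ setT (refl d : brV -> brV) (@open 'rV[R]_n)) => //.
by move=> _ [U oU <-]; rewrite setTI; apply: borel_open; exact: open_refl.
Qed.

Definition borel_lebesgue_measure : {measure set brV -> \bar R} :=
  image_measure leb (@measurable_leb_borel R n).

Lemma borel_lebesgue_sigma_finite : sigma_finite setT borel_lebesgue_measure.
Proof.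
exists (fun k => eball 0 k.+1%:R).
  apply/seteqP; split=> // x _; exists (Num.truncn (enorm x)) => //=.
  by rewrite /eball/= subr0 truncnS_gt.
by move=> k; split; [exact: borel_eball|exact: lebesgue_eball_lty].
Qed.

Lemma borel_lebesgue_refl_sigma_finite d :
  sigma_finite setT (image_measure borel_lebesgue_measure (measurable_refl d)).
Proof.
exists (fun k => eball 0 k.+1%:R).
  apply/seteqP; split=> // x _; exists (Num.truncn (enorm x)) => //=.
  by rewrite /eball/= subr0 truncnS_gt.
move=> k; split; first exact: borel_eball.
have -> : image_measure borel_lebesgue_measure (measurable_refl d)
    (eball 0 k.+1%:R) = leb (eball 0 k.+1%:R).
  congr (leb _); apply/seteqP.
  by split=> y; rewrite /eball/= !subr0 enorm_refl.
exact: lebesgue_eball_lty.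
Qed.

(** The Lebesgue measure and its image under the reflection agree on balls, so [measure_le_of_balls]
    with k = 1 gives one inequality; the other follows because the reflection is an involution. *)
Lemma lebesgue_refl d (U : set 'rV[R]_n) : open U ->
  leb (refl d @^-1` U) = leb U.
Proof.
have le V : open V -> (leb (refl d @^-1` V) <= leb V)%E.
  move=> oV; rewrite -[leRHS]mul1e.
  apply: (@measure_le_of_balls R n
    (sigma_finite_measure_of borel_lebesgue_sigma_finite)
    (sigma_finite_measure_of (borel_lebesgue_refl_sigma_finite d))
    setT (fun rho => vol * rho ^+ n)) => //.
  - by rewrite setCT measure0.
  - by rewrite setCT measure0.
  - by move=> rho rho0; rewrite mulr_gt0 ?unit_vol_gt0 ?exprn_gt0.
  - by move=> x rho _ rho0; rewrite -(lebesgue_eball x rho0).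
  - move=> y rho _ rho0; rewrite mul1r -(lebesgue_eball (refl d y) rho0).
    rewrite le_eqVlt; apply/orP; left; apply/eqP; congr (leb _).
    apply/seteqP; split=> z; rewrite /eball/= => h.
      by rewrite -(enorm_refl d) reflB reflK.
    by rewrite -(enorm_refl d) reflB reflK.
move=> oU; apply/eqP; rewrite eq_le le//=.
have := le _ (open_refl (d := d) oU); congr (leb _ <= _)%E.
by apply/seteqP; split=> z /=; rewrite reflK.
Qed.

End rotation_invariance.

Section unit_direction.
Context (R : realType) (n : nat).
Local Notation brV := (borel_rV R n).

Definition udir (y : 'rV[R]_n) : 'rV[R]_n := (enorm y)^-1 *: y.

Lemma enorm_udir y : y != 0 -> enorm (udir y) = 1.
Proof.
rewrite -enorm_gt0 => y0; rewrite enormZ ger0_norm ?invr_ge0 ?ltW//.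
by rewrite mulVf ?gt_eqF.
Qed.

Lemma udirZ t y : 0 < t -> udir (t *: y) = udir y.
Proof.
move=> t0; rewrite /udir enormZ gtr0_norm// scalerA invfM mulrAC mulVf ?gt_eqF//.
by rewrite mul1r.
Qed.

Lemma udir_udir y : udir (udir y) = udir y.
Proof.
have [->|y0] := eqVneq y 0; first by rewrite /udir !scaler0.
by rewrite {1}/udir enorm_udir// invr1 scale1r.
Qed.

Lemma scale_udir y : enorm y *: udir y = y.
Proof.
have [->|y0] := eqVneq y 0; first by rewrite /udir !scaler0.
by rewrite /udir scalerA divff ?enorm_eq0// scale1r.
Qed.

Lemma measurable_udir : measurable_fun setT (udir : brV -> brV).
Proof.
apply: borel_measurable_fun => i.
(* Written as a real power, the inverse is measurable on the whole line, 0 included. *)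
apply: (eq_measurable_fun (fun y : brV =>
  (enorm (y : 'rV[R]_n) `^ (-1)) * (y : 'rV[R]_n) 0 i)).
  by move=> y _; rewrite !mxE powR_inv1// enorm_ge0.
apply: measurable_funM; last exact: borel_coord.
exact: (measurableT_comp (measurable_powR (-1)) (@borel_enorm R n)).
Qed.

Lemma measurable_affine d (T : measurableType d) (x : 'rV[R]_n) (g : T -> R)
    (phi : T -> brV) : measurable_fun setT g -> measurable_fun setT phi ->
  measurable_fun setT (fun t => (x + g t *: (phi t : 'rV[R]_n)) : brV).
Proof.
move=> mg mphi; apply: borel_measurable_fun => i.
apply: (eq_measurable_fun (fun t => x 0 i + g t * (phi t : 'rV[R]_n) 0 i)).
  by move=> t _; rewrite !mxE.
apply: measurable_funD => //; apply: measurable_funM => //.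
exact: (measurableT_comp (borel_coord i) mphi).
Qed.

End unit_direction.

(** * The Hausdorff measure of a sphere as a projected volume *)

Section sphere_representation.
Context (R : realType) (n : nat).
Hypothesis n_ge2 : (2 <= n)%N.
Local Notation brV := (borel_rV R n).
Local Notation leb := (@lebesgue_rV R n).
Local Notation vol := (unit_vol R n).
Local Notation HT := (hausdorff_type R n n.-1).
Local Notation H := (@hausdorff_measure R n n.-1).

Let n_gt0 : (0 < n)%N. Proof. exact: ltnW. Qed.

(** Away from the null point 0 the radial projection lands on the sphere. *)
Definition punctured_ball : set 'rV[R]_n := eball 0 1 `\` [set 0].

Lemma borel_punctured_ball : measurable (punctured_ball : set brV).
Proof. by apply: measurableD; [exact: borel_eball|exact: borel_set1]. Qed.

Lemma measurable_punctured_ball :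
  measurable (punctured_ball : set (lebesgue_type R n)).
Proof. by apply: borel_lebesgue; exact: borel_punctured_ball. Qed.

Lemma lebesgue_punctured_ball : leb punctured_ball = vol%:E.
Proof.
rewrite -unit_volE measureD/=; [|by apply: borel_lebesgue; exact: borel_eball|
  by apply: borel_lebesgue; exact: borel_set1|exact: lebesgue_eball_lty].
rewrite setIidr; last by move=> _ ->; rewrite /eball/= subrr enorm0.
by rewrite lebesgue_set1// sube0.
Qed.

Section fixed_sphere.
Variables (x : 'rV[R]_n) (r : R).
Hypothesis r_gt0 : 0 < r.
Let S : set 'rV[R]_n := esphere x r.

Definition sphere_proj (y : 'rV[R]_n) : 'rV[R]_n := x + r *: udir y.

Lemma measurable_sphere_proj :
  measurable_fun setT (sphere_proj : lebesgue_type R n -> brV).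
Proof.
apply: (measurableT_comp (f := fun y : brV => sphere_proj y : brV)
  _ (@measurable_leb_borel R n)).
by apply: measurable_affine => //; exact: measurable_udir.
Qed.

Let mS : measurable (S : set HT).
Proof. by apply: borel_hausdorff; exact: borel_esphere. Qed.

Let nuH : {measure set brV -> \bar R} :=
  image_measure (mrestr H mS) (@measurable_hausdorff_borel R n n.-1).

Let muS : {measure set brV -> \bar R} :=
  image_measure (mrestr leb measurable_punctured_ball) measurable_sphere_proj.

Let nuHE E : nuH E = H (E `&` S). Proof. by []. Qed.

Let muSE E : muS E = leb ([set y | E (sphere_proj y)] `&` punctured_ball).
Proof. by []. Qed.

Let sphere_proj_in y : y != 0 -> S (sphere_proj y).
Proof.
move=> y0; rewrite /S /esphere/= /sphere_proj addrAC subrr add0r enormZ.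
by rewrite enorm_udir// mulr1 gtr0_norm.
Qed.

Let muS_T : muS setT = vol%:E.
Proof. by rewrite muSE -lebesgue_punctured_ball setTI. Qed.

Let muS_fin E : measurable E -> muS E \is a fin_num.
Proof.
move=> mE; rewrite ge0_fin_numE ?measure_ge0//.
by rewrite (@le_lt_trans _ _ (muS setT)) ?le_measure ?inE// muS_T ltry.
Qed.

Let nuH_T : nuH setT = H S.
Proof. by rewrite nuHE setTI. Qed.

Let nuH_fin E : measurable E -> nuH E \is a fin_num.
Proof.
move=> mE; rewrite ge0_fin_numE ?measure_ge0//.
rewrite (@le_lt_trans _ _ (nuH setT)) ?le_measure ?inE// nuH_T.
exact: hausdorff_sphere_lty.
Qed.

Let muS_sigma : sigma_finite setT muS.
Proof. by apply: fin_num_fun_sigma_finite; [rewrite measure0|exact: muS_fin]. Qed.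

Let nuH_sigma : sigma_finite setT nuH.
Proof. by apply: fin_num_fun_sigma_finite; [rewrite measure0|exact: nuH_fin]. Qed.

Let area : R := fine (H S).

Let areaE : H S = area%:E.
Proof. by rewrite fineK// -nuH_T nuH_fin. Qed.

Let area_gt0 : 0 < area.
Proof. by rewrite -lte_fin -areaE; exact: hausdorff_sphere_gt0. Qed.

(* Pulled back by [sphere_proj], a ball centred at x + r w becomes an open cone
   around w, written without division by |y|. *)
Let cap (w : 'rV[R]_n) (rho : R) : set 'rV[R]_n :=
  eball 0 1 `&` [set y | enorm (y - enorm y *: w) < rho / r * enorm y].

Let open_cap w rho : enorm w = 1 -> open (cap w rho).
Proof.
move=> w1; apply: openI; first exact: open_eball.
have -> : [set y | enorm (y - enorm y *: w) < rho / r * enorm y] =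
  (fun y => rho / r * enorm y - enorm (y - enorm y *: w)) @^-1` [set t | 0 < t].
  by apply/seteqP; split=> y /=; rewrite subr_gt0.
apply: open_comp; last exact: open_gt.
move=> y0 _; apply: (@lip_continuous _ _ _ (`|rho / r| + 2)) => y z.
have h1 : `|rho / r * enorm y - rho / r * enorm z| <= `|rho / r| * enorm (y - z).
  by rewrite -mulrBr normrM ler_wpM2l// enorm_lip.
have h2 : `|enorm (y - enorm y *: w) - enorm (z - enorm z *: w)| <=
    2 * enorm (y - z).
  apply: (le_trans (enorm_lip _ _)).
  have -> : y - enorm y *: w - (z - enorm z *: w) =
      (y - z) + (enorm z - enorm y) *: w.
    by rewrite scalerBl; apply/rowP => i; rewrite !mxE; ring.
  apply: (le_trans (enormD _ _)); rewrite enormZ w1 mulr1.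
  by have := enorm_lip z y; rewrite enormC; lra.
have -> : rho / r * enorm y - enorm (y - enorm y *: w) -
    (rho / r * enorm z - enorm (z - enorm z *: w)) =
    (rho / r * enorm y - rho / r * enorm z) -
    (enorm (y - enorm y *: w) - enorm (z - enorm z *: w)) by ring.
by rewrite (le_trans (ler_normB _ _))// mulrDl lerD.
Qed.

Let cap_eq w rho : enorm w = 1 ->
  [set y | eball (x + r *: w) rho (sphere_proj y)] `&` punctured_ball = cap w rho.
Proof.
move=> w1.
have key y : y != 0 -> (enorm (y - enorm y *: w) < rho / r * enorm y) =
    (enorm (sphere_proj y - (x + r *: w)) < rho).
  move=> y0; have ny : 0 < enorm y by rewrite enorm_gt0.
  rewrite /sphere_proj opprD addrACA subrr add0r -scalerBr enormZ gtr0_norm//.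
  rewrite -{1}[y]scale_udir -scalerBr enormZ gtr0_norm// mulrC ltr_pM2r//.
  by rewrite ltr_pdivlMr// mulrC.
apply/seteqP; split=> [y [/= h [y1 /= /eqP y0]]|y [y1 /= h]].
  by split=> //=; rewrite key.
have y0 : y != 0.
  by apply: contraTneq h => ->; rewrite enorm0 mulr0 scale0r subrr enorm0 ltxx.
by split; [rewrite /eball/= -key|split=> //=; apply/eqP].
Qed.

Let dir_of z : S z -> exists2 w, enorm w = 1 & z = x + r *: w.
Proof.
move=> Sz; exists (r^-1 *: (z - x)).
  by rewrite enormZ Sz ger0_norm ?mulVf ?gt_eqF// invr_ge0 ltW.
by rewrite scalerA divff ?gt_eqF// scale1r addrCA subrr addr0.
Qed.

(** The reflection that swaps the directions of z and z' maps one cap onto the other, and caps are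
    open, so [lebesgue_refl] applies. *)
Let muS_eball z z' rho : S z -> S z' -> muS (eball z rho) = muS (eball z' rho).
Proof.
move=> /dir_of[w w1 ->] /dir_of[w' w1' ->].
rewrite !muSE !cap_eq// -(lebesgue_refl n_gt0 (w - w') (@open_cap w' rho w1')).
congr (leb _); apply/seteqP.
have ww' : refl (w - w') w = w' by apply: refl_swap; rewrite w1.
have key y : enorm (refl (w - w') y - enorm (refl (w - w') y) *: w') =
    enorm (y - enorm y *: w).
  by rewrite -[X in _ *: X]ww' enorm_refl -reflZ -reflB enorm_refl.
split=> y [y1 y2]; split.
- by move: y1; rewrite /eball/= !subr0 enorm_refl.
- by move: y2; rewrite /= key enorm_refl.
- by move: y1; rewrite /eball/= !subr0 enorm_refl.
- by move: y2; rewrite /= key enorm_refl.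
Qed.

Let muS_eball_gt0 z rho : S z -> 0 < rho -> (0 < muS (eball z rho))%E.
Proof.
move=> /dir_of[w w1 ->] rho0; rewrite muSE cap_eq//.
apply: (@lebesgue_open_gt0 _ _ n_gt0 _ (2^-1 *: w) (@open_cap w rho w1)).
have nw : enorm (2^-1 *: w) = 2^-1 by rewrite enormZ w1 mulr1 gtr0_norm ?invr_gt0.
split; first by rewrite /eball/= subr0 nw; lra.
by rewrite /= nw subrr enorm0 mulr_gt0 ?divr_gt0 ?invr_gt0.
Qed.

(** Here the reflection is centred at x: an isometry that preserves the sphere and exchanges z and
    z'. *)
Let nuH_eball z z' rho : S z -> S z' -> nuH (eball z rho) = nuH (eball z' rho).
Proof.
move=> Sz Sz'; rewrite !nuHE.
pose d := z - z'; pose phi y := x + refl d (y - x).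
have phiK : cancel phi phi by move=> y; rewrite /phi addrAC subrr add0r reflK addrCA subrr addr0.
have iso a b : enorm (phi a - phi b) = enorm (a - b).
  rewrite /phi opprD addrACA subrr add0r -reflB enorm_refl.
  by rewrite opprB addrA subrK.
have phix : phi x = x.
  by rewrite /phi subrr -(scale0r (0 : 'rV[R]_n)) reflZ !scale0r addr0.
have phiz : phi z = z'.
  rewrite /phi (_ : d = (z - x) - (z' - x)); last by rewrite opprB addrA subrK.
  by rewrite refl_swap ?Sz ?Sz'// addrCA subrr addr0.
have -> : eball z' rho `&` S = phi @` (eball z rho `&` S).
  apply/seteqP; split=> [y [yz' Sy]|_ [y [yz Sy] <-]].
    exists (phi y); last exact: phiK.
    split; first by rewrite /eball/= -(phiK z) phiz iso.
    by rewrite /S /esphere/= -{1}phix iso.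
  split; first by rewrite /eball/= -phiz iso.
  by rewrite /S /esphere/= -{1}phix iso.
by apply/esym; exact: (@hausdorff_isometry R n n.-1 phi phi).
Qed.

Let muS_out : muS (~` S) = 0%E.
Proof.
rewrite muSE (_ : _ `&` _ = set0) ?measure0//.
by apply/seteqP; split=> // y [/= nS [_ /= /eqP y0]]; apply: nS; exact: sphere_proj_in.
Qed.

Let nuH_out : nuH (~` S) = 0%E.
Proof. by rewrite nuHE setICl measure0. Qed.

Let z0 : 'rV[R]_n := x + r *: delta_mx 0 (Ordinal n_gt0).

Let z0S : S z0.
Proof.
rewrite /S /esphere/= /z0 addrAC subrr add0r enormZ gtr0_norm//.
rewrite enormE /edot (bigD1 (Ordinal n_gt0))//= big1 => [|i ii0].
  by rewrite addr0 !mxE !eqxx mulr1 sqrtr1 mulr1.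
by rewrite !mxE eqxx/= (negbTE ii0) mulr0.
Qed.

Let h (rho : R) : R := fine (muS (eball z0 rho)).

Let muS_h z rho : S z -> muS (eball z rho) = (h rho)%:E.
Proof. by move=> Sz; rewrite (muS_eball rho Sz z0S) fineK// muS_fin//; exact: borel_eball. Qed.

Let h_gt0 rho : 0 < rho -> 0 < h rho.
Proof. by move=> rho0; rewrite -lte_fin -(muS_h rho z0S); exact: muS_eball_gt0. Qed.

Let k : R := area / vol.

Let k_gt0 : 0 < k.
Proof. by rewrite divr_gt0 ?unit_vol_gt0. Qed.

(** By [fubini_balls] on S x S, the two constant ball masses satisfy h(rho) area = g vol. So the
    ratio of the masses of a ball is k at every radius. *)
Let nuH_h z rho : S z -> nuH (eball z rho) = (k * h rho)%:E.
Proof.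
move=> Sz; pose g := fine (nuH (eball z rho)).
have gE z' : S z' -> nuH (eball z' rho) = g%:E.
  by move=> Sz'; rewrite (nuH_eball rho Sz' Sz) fineK// nuH_fin//; exact: borel_eball.
rewrite gE//; congr EFin.
have mS' : measurable (S : set brV) by exact: borel_esphere.
have := fubini_balls (sigma_finite_measure_of muS_sigma)
  (sigma_finite_measure_of nuH_sigma) rho mS' mS'.
have onS (m : {measure set brV -> \bar R}) y : m (~` S) = 0%E ->
    m (S `&` eball y rho) = m (eball y rho).
  move=> m0; rewrite [RHS](@measureDI _ _ _ m _ S)//; last exact: borel_eball.
  rewrite [X in _ = (X + _)%E](_ : _ = 0%E) ?add0e 1?setIC//; apply/eqP.
  rewrite eq_le measure_ge0 andbT -m0; apply: le_measure; rewrite ?inE//.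
    by apply: measurableD => //; exact: borel_eball.
  exact: measurableC.
have -> : (\int[sigma_finite_measure_of nuH_sigma]_(y in S)
    (sigma_finite_measure_of muS_sigma) (S `&` eball y rho) =
    \int[sigma_finite_measure_of nuH_sigma]_(y in S) (h rho)%:E)%E.
  by apply: eq_integral => y /set_mem Sy; rewrite -(muS_h rho Sy) -(onS muS y).
have -> : (\int[sigma_finite_measure_of muS_sigma]_(y in S)
    (sigma_finite_measure_of nuH_sigma) (S `&` eball y rho) =
    \int[sigma_finite_measure_of muS_sigma]_(y in S) g%:E)%E.
  by apply: eq_integral => y /set_mem Sy; rewrite -(gE y Sy) -(onS nuH y).
rewrite !integral_cst//= /sigma_finite_measure_of.
have -> : nuH S = area%:E by rewrite -areaE nuHE setIid.
have -> : muS S = vol%:E.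
  rewrite -muS_T [RHS](@measureDI _ _ _ muS _ S)// setTI setTD.
  by rewrite [X in (X + _)%E](_ : _ = 0%E) ?add0e//.
rewrite -!EFinM => -[hg]; rewrite /k mulrAC mulrC [_ * h rho]mulrC hg.
by rewrite mulrC mulfK// gt_eqF// unit_vol_gt0.
Qed.

(** The two measures are proportional on balls centred on the sphere and vanish off it, so
    [measure_le_of_balls] applies in both directions and gives equality on open sets. These are
    stable under intersection and generate the Borel sets. *)
Lemma hausdorff_sphere_lebesgue (E : set brV) : measurable E ->
  H (E `&` esphere x r) = ((fine (H (esphere x r)) / vol)%:E *
    leb ([set y | E (sphere_proj y)] `&` punctured_ball))%E.
Proof.
move=> mE; rewrite -/(nuH E) -/(muS E) -/area -/k.
have mS' : measurable (S : set brV) by exact: borel_esphere.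
pose kk : {nonneg R} := NngNum (ltW k_gt0).
rewrite -[RHS]/(mscale kk muS E).
apply: (@measure_unique _ R brV (@open 'rV[R]_n) (fun _ => setT) _ _ _ _
  nuH (mscale kk muS)) => //.
- by move=> A B oA oB; exact: openI.
- by move=> _; exact: openT.
- by rewrite bigcup_const.
- move=> U oU; rewrite /= /mscale/=; apply/eqP; rewrite eq_le; apply/andP; split.
    apply: (@measure_le_of_balls R n (sigma_finite_measure_of muS_sigma)
      (sigma_finite_measure_of nuH_sigma) S h k mS') => //.
    + exact: ltW.
    + by move=> z rho Sz _; rewrite -(muS_h rho Sz).
    + by move=> z rho Sz _; rewrite -(nuH_h rho Sz).
  rewrite -lee_pdivlMl//.
  apply: (@measure_le_of_balls R n (sigma_finite_measure_of nuH_sigma)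
    (sigma_finite_measure_of muS_sigma) S (fun rho => k * h rho) k^-1 mS') => //.
  + by rewrite invr_ge0 ltW.
  + by move=> rho rho0; rewrite mulr_gt0 ?h_gt0.
  + by move=> z rho Sz _; rewrite -(nuH_h rho Sz).
  + by move=> z rho Sz _; rewrite mulKf ?gt_eqF// -(muS_h rho Sz).
- by move=> _; rewrite nuH_T areaE ltry.
Qed.

End fixed_sphere.

End sphere_representation.

(** * Polar coordinates *)

Section integral_mrestr.
Local Open Scope ereal_scope.
Context d (T : measurableType d) (R : realType) (mu : {measure set T -> \bar R}).
Variables (D : set T) (mD : measurable D).

Lemma ge0_integral_mrestr (f : T -> \bar R) : measurable_fun setT f ->
  (forall x, 0 <= f x) -> \int[mrestr mu mD]_x f x = \int[mu]_(x in D) f x.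
Proof.
move=> mf f0; have mCD : measurable (~` D) by exact: measurableC.
rewrite -(setUv D) ge0_integral_setU//; last 2 first.
- by rewrite setUv.
- by apply/disj_set2P; rewrite setICr.
rewrite [X in _ + X](_ : _ = 0); last first.
  apply: null_set_integral => //; first exact: measurable_funTS.
  by rewrite -[LHS]/(mu (~` D `&` D)) setICl measure0.
rewrite adde0; apply: eq_measure_integral => A mA AD.
by rewrite -[LHS]/(mu (A `&` D)) setIidl.
Qed.

End integral_mrestr.

(* The measure with density w, realized as the area under the graph of w. *)
Section density_measure.
Local Open Scope ereal_scope.
Context d (T : measurableType d) (R : realType).
Variables (mu : {sigma_finite_measure set T -> \bar R}) (w : T -> R).
Hypotheses (w_ge0 : forall x, (0 <= w x)%R) (mw : measurable_fun setT w).
Local Notation RT := (measurableTypeR R).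

Let region : set (T * RT) := [set p | (0 < (p.2 : R) <= w p.1)%R].

Let mregion : measurable region.
Proof.
have -> : region = [set p | (0 < (p.2 : R))%R] `&` [set p | ((p.2 : R) <= w p.1)%R].
  by apply/seteqP; split=> [p /andP[]|p [/= a b]] //; apply/andP.
have msnd : measurable_fun setT (fun p : T * RT => (p.2 : R)).
  exact: measurable_snd.
have mfst : measurable_fun setT (fun p : T * RT => w p.1).
  by apply: measurableT_comp => //; exact: measurable_fst.
apply: measurableI.
  rewrite -[X in measurable X]setTI; rewrite (_ : [set p | _] =
    (fun p : T * RT => (p.2 : R)) @^-1` `]0%R, +oo[%classic).
    exact: msnd.
  by apply/seteqP; split=> p /=; rewrite in_itv/= andbT.
rewrite -[X in measurable X]setTI; rewrite (_ : [set p | _] =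
  (fun p : T * RT => w p.1 - (p.2 : R))%R @^-1` `[0%R, +oo[%classic).
  by apply: measurable_funB.
by apply/seteqP; split=> p /=; rewrite in_itv/= andbT subr_ge0.
Qed.

Definition density_measure : {measure set T -> \bar R} :=
  image_measure (mrestr (mu \x @lebesgue_measure R) mregion) measurable_fst.

Lemma ge0_integral_density (G : T -> \bar R) : measurable_fun setT G ->
  (forall x, 0 <= G x) ->
  \int[density_measure]_x G x = \int[mu]_x (G x * (w x)%:E).
Proof.
move=> mG G0.
have mGf : measurable_fun setT (G \o fst : T * RT -> \bar R).
  by apply: measurableT_comp => //; exact: measurable_fst.
rewrite (ge0_integral_pushforward measurable_fst)//.
rewrite preimage_setT ge0_integral_mrestr//; last by move=> x; exact: G0.
rewrite integral_mkcond.
rewrite [LHS](_ : _ = \int[mu \x @lebesgue_measure R]_p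
    (G p.1 * (\1_region p)%:E)); last first.
  apply: eq_integral => p _; rewrite patchE indicE.
  by case: ifPn => _ /=; rewrite ?mule1 ?mule0.
rewrite fubini_tonelli1/=; last 2 first.
- by apply: emeasurable_funM => //; apply/measurable_EFinP; exact: measurable_indic.
- by move=> p; rewrite mule_ge0// lee_fin.
apply: eq_integral => x _; rewrite /fubini_F/=.
have mI : measurable_fun setT (fun y : RT => (\1_region (x, y) : R)%:E).
  apply/measurable_EFinP.
  apply: (measurableT_comp (f := \1_region : T * RT -> R)
    (g := fun y : RT => (x, y))); first exact: measurable_indic.
  exact: pair1_measurable.
rewrite ge0_integralZl//.
congr (_ * _).
rewrite (_ : (fun y : RT => (\1_region (x, y))%:E) =
    (fun y : RT => (\1_(`]0%R, w x]%classic : set RT) y)%:E)); last first.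
  by apply/funext => y; rewrite !indicE.
rewrite integral_indic// setIT.
rewrite -[LHS]/(@lebesgue_measure R (`]0%R, w x]%classic : set R)).
rewrite lebesgue_measure_itv/= lte_fin.
by case: ltP => [_|h]; [rewrite sube0|congr EFin; apply/eqP; rewrite eq_le w_ge0].
Qed.

Lemma density_measureE (A : set T) : measurable A ->
  density_measure A = \int[mu]_(x in A) (w x)%:E.
Proof.
move=> mA; have := @ge0_integral_density (fun x => (\1_A x)%:E).
rewrite integral_indic// setIT => ->; last 2 first.
- by apply/measurable_EFinP; exact: measurable_indic.
- by move=> x; rewrite lee_fin.
rewrite [RHS]integral_mkcond; apply: eq_integral => x _.
by rewrite patchE indicE; case: ifPn => _; rewrite /= ?mul1e ?mul0e.
Qed.

End density_measure.

Lemma is_derive_continuous (R : realType) (F : R -> R) (s f : R) :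
  is_derive s 1 F f -> {for s, continuous F}.
Proof. by move=> [dF _]; exact/differentiable_continuous/derivable1_diffP. Qed.

Lemma integral_derive (R : realType) (F f : R -> R) (a b : R) : a < b ->
  (forall s, a <= s <= b -> is_derive s 1 F (f s)) ->
  (forall s, a <= s <= b -> {for s, continuous f}) ->
  (\int[lebesgue_measure]_(s in `[a, b]) (f s)%:E = (F b - F a)%:E)%E.
Proof.
move=> ab dF cf; rewrite EFinB; apply: continuous_FTC2 => //.
- apply: continuous_in_subspaceT => s /set_mem /=; rewrite in_itv/=; exact: cf.
- split.
  + move=> s; rewrite in_itv/= => /andP[/ltW a_s /ltW sb].
    by have [] := dF s (introT andP (conj a_s sb)).
  + apply: cvg_at_right_filter; apply: (@is_derive_continuous _ _ _ (f a)).
    by apply: dF; rewrite lexx ltW.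
  + apply: cvg_at_left_filter; apply: (@is_derive_continuous _ _ _ (f b)).
    by apply: dF; rewrite lexx ltW.
- move=> s; rewrite in_itv/= => /andP[/ltW a_s /ltW sb].
  have := dF s (introT andP (conj a_s sb)) => -[_ <-].
  by rewrite derive1E.
Qed.

Section signed_integrals.
Local Open Scope ereal_scope.
Context d d' (T : measurableType d) (T' : measurableType d') (R : realType).

Lemma integral_image (m : {measure set T -> \bar R}) (phi : T -> T')
    (mphi : measurable_fun setT phi) (f : T' -> \bar R) :
  measurable_fun setT f ->
  \int[image_measure m mphi]_x f x = \int[m]_x f (phi x).
Proof.
move=> mf; rewrite [LHS]integralE [RHS]integralE.
rewrite (ge0_integral_pushforward mphi)//; last exact: measurable_funepos.
rewrite (ge0_integral_pushforward mphi)//; last exact: measurable_funeneg.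
by rewrite preimage_setT -funepos_comp -funeneg_comp.
Qed.

Lemma integral_mrestr (m : {measure set T -> \bar R}) (D : set T)
    (mD : measurable D) (f : T -> \bar R) : measurable_fun setT f ->
  \int[mrestr m mD]_x f x = \int[m]_(x in D) f x.
Proof.
move=> mf; rewrite [LHS]integralE [RHS]integralE.
rewrite !ge0_integral_mrestr//; first exact: measurable_funeneg.
exact: measurable_funepos.
Qed.

Lemma integral_density (m : {sigma_finite_measure set T -> \bar R}) (w : T -> R)
    (w0 : forall x, (0 <= w x)%R) (mw : measurable_fun setT w) (f : T -> \bar R) :
  measurable_fun setT f ->
  \int[density_measure m mw]_x f x = \int[m]_x (f x * (w x)%:E).
Proof.
move=> mf; rewrite [LHS]integralE [RHS]integralE.
rewrite !ge0_integral_density//; [|exact: measurable_funeneg|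
  exact: measurable_funepos].
congr (_ - _); apply: eq_integral => x _.
  by rewrite !funeposE -[in RHS](mul0e (w x)%:E) maxe_pMl// lee_fin.
by rewrite !funenegE -mulNe -[in RHS](mul0e (w x)%:E) maxe_pMl// lee_fin.
Qed.

End signed_integrals.

Section polar.
Context (R : realType) (n : nat).
Hypothesis n_gt1 : (1 < n)%N.
Local Notation brV := (borel_rV R n).
Local Notation RT := (measurableTypeR R).
Local Notation leb := (@lebesgue_rV R n).
Local Notation lebT := (lebesgue_type R n).
Local Notation vol := (unit_vol R n).
Local Notation B' := (@punctured_ball R n).
Local Notation mu1 := (@lebesgue_measure R).

Let n_gt0 : (0 < n)%N. Proof. exact: ltnW. Qed.

(** Directions will be measured by sectors of the unit ball, of total mass |B_1|, so the radii below
    b must receive mass b^n: this is the density n s^(n-1), cut to 0 for negative s. *)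
Definition radial_weight (s : R) : R := n%:R * Num.max s 0 ^+ n.-1.

Lemma radial_weight_ge0 s : 0 <= radial_weight s.
Proof. by rewrite mulr_ge0// exprn_ge0// le_max lexx orbT. Qed.

Lemma radial_weight_pos s : 0 <= s -> radial_weight s = n%:R * s ^+ n.-1.
Proof. by move=> s0; rewrite /radial_weight max_l. Qed.

Lemma radial_weight_neg s : s <= 0 -> radial_weight s = 0.
Proof.
by move=> s0; rewrite /radial_weight max_r// expr0n -subn1 subn_eq0 leqNgt n_gt1 mulr0.
Qed.

Lemma measurable_radial_weight : measurable_fun setT (radial_weight : RT -> R).
Proof.
apply: measurable_funM => //; apply: measurable_funX.
by apply: measurable_maxr.
Qed.

Definition radial : {measure set RT -> \bar R} :=
  density_measure mu1 measurable_radial_weight.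

Lemma integral_pow (b : R) : 0 < b ->
  (\int[mu1]_(s in `[0%R, b]) (n%:R * s ^+ n.-1)%:E = (b ^+ n)%:E)%E.
Proof.
move=> b0.
have dF (s : R) : is_derive s 1 (fun s => s ^+ n) (n%:R * s ^+ n.-1).
  apply: DeriveDef; first exact: exprn_derivable.
  by rewrite exp_derive /GRing.scale/= mulr1.
have cf (s : R) : {for s, continuous (fun s : R => n%:R * s ^+ n.-1)}.
  by apply: cvgM; [exact: cvg_cst|exact: exprn_continuous].
rewrite (integral_derive b0 (fun s _ => dF s) (fun s _ => cf s)).
by rewrite expr0n gtn_eqF//= subr0.
Qed.

Lemma radial_ray (b : R) : radial `]-oo, b[%classic = (Num.max b 0 ^+ n)%:E.
Proof.
rewrite /radial density_measureE//; last exact: radial_weight_ge0.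
have neg (c : R) : c <= 0 ->
    (\int[mu1]_(s in `]-oo, c[) (radial_weight s)%:E = 0)%E.
  move=> c0; rewrite integral0_eq// => s; rewrite /= in_itv/= => sc.
  by rewrite radial_weight_neg// (le_trans (ltW sc)).
have [b0|b0] := leP b 0; first by rewrite neg// expr0n gtn_eqF.
rewrite (@itv_bndbnd_setU _ _ _ (BLeft 0))//; last by rewrite bnd_simp ltW.
have mw (A : set RT) : measurable A ->
    measurable_fun A (fun s : RT => (radial_weight s)%:E).
  by move=> mA; apply: measurable_funTS; apply/measurable_EFinP;
    exact: measurable_radial_weight.
rewrite ge0_integral_setU//=; last 3 first.
- by apply: mw; apply: measurableU.
- by move=> s _; rewrite lee_fin radial_weight_ge0.
- apply/disj_set2P/seteqP; split=> // s [/=]; rewrite !in_itv/= => s0 /andP[].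
  by rewrite leNgt s0.
rewrite neg// add0e integral_itv_bndo_bndc; last exact: mw.
rewrite -integral_pow//; apply: eq_integral => s /set_mem/=; rewrite in_itv/=.
by move=> /andP[s0 _]; rewrite radial_weight_pos.
Qed.

Lemma radial_sigma_finite : sigma_finite setT radial.
Proof.
exists (fun k => `]-oo, k%:R[%classic).
  apply/seteqP; split=> // s _; exists (Num.truncn s).+1 => //=.
  by rewrite in_itv/= truncnS_gt.
by move=> k; split => //; rewrite radial_ray ltry.
Qed.

Lemma measurable_leb_udir : measurable_fun setT (@udir R n : lebT -> brV).
Proof.
exact: (measurableT_comp (f := @udir R n : brV -> brV)
  (@measurable_udir R n) (@measurable_leb_borel R n)).
Qed.

Definition angular : {measure set brV -> \bar R} :=
  image_measure (mrestr leb (@measurable_punctured_ball R n)) measurable_leb_udir.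

Lemma angularE E : angular E = leb ([set y | E (udir y)] `&` B').
Proof. by []. Qed.

Lemma angular_fin E : measurable E -> angular E \is a fin_num.
Proof.
move=> mE; rewrite ge0_fin_numE ?measure_ge0//.
have aT : angular setT = vol%:E by rewrite angularE setTI lebesgue_punctured_ball.
by rewrite (@le_lt_trans _ _ (angular setT)) ?le_measure ?inE// aT ltry.
Qed.

Lemma angular_sigma_finite : sigma_finite setT angular.
Proof.
by apply: fin_num_fun_sigma_finite; [rewrite measure0|exact: angular_fin].
Qed.

Definition polar_map (y : 'rV[R]_n) : RT * brV := (enorm y, udir y).

Lemma measurable_polar_map : measurable_fun setT (polar_map : lebT -> RT * brV).
Proof.
apply: measurable_fun_pair; last exact: measurable_leb_udir.
exact: (measurableT_comp (f := @enorm R n : brV -> R)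
  (@borel_enorm R n) (@measurable_leb_borel R n)).
Qed.

Lemma measurable_nonzero : measurable (~` [set 0] : set lebT).
Proof. by apply: measurableC; apply: borel_lebesgue; exact: borel_set1. Qed.

Definition polar : {measure set (RT * brV) -> \bar R} :=
  image_measure (mrestr leb measurable_nonzero) measurable_polar_map.

(** For fixed E both sides are measures in I. On the ray below b > 0 the left side is the volume of
    a sector of radius b, the dilation by b of the sector of the unit ball, whence the factor b^n;
    rays determine the measure. *)
Let polar_rect (E : set brV) (I : set RT) : measurable E -> measurable I ->
  polar (I `*` E) = (radial I * angular E)%E.
Proof.
move=> mE mI.
have k0 : 0 <= fine (angular E) by rewrite fine_ge0.
pose kk : {nonneg R} := NngNum k0.
pose m1 : {measure set RT -> \bar R} := image_measure
  (mrestr polar (@measurableX _ _ RT brV setT E measurableT mE)) measurable_fst.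
have m1E J : m1 J = polar (J `*` E).
  rewrite /m1/= /pushforward/= /mrestr/=; congr (polar _).
  by apply/seteqP; split=> p /= [a]; [case|split].
rewrite -m1E muleC -(fineK (angular_fin mE)) -[RHS]/(mscale kk radial I).
apply: (@measure_unique _ R RT (@RGenInftyO.G R)
  (fun k => `]-oo, k%:R[%classic) _ _ _ _ m1 (mscale kk radial)) => //.
- exact: RGenInftyO.measurableE.
- move=> _ _ [a ->] [b ->]; exists (Num.min a b).
  apply/seteqP; split=> s /=; rewrite !in_itv/= lt_min; first by case=> -> ->.
  by move=> /andP[].
- by move=> k; exists k%:R.
- apply/seteqP; split=> // s _; exists (Num.truncn s).+1 => //=.
  by rewrite in_itv/= truncnS_gt.
- move=> _ [b ->]; rewrite m1E /= /mscale/= radial_ray fineK ?angular_fin//.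
  rewrite angularE.
  transitivity (leb ([set y | y != 0 /\ enorm y < b /\ E (udir y)])).
    congr (leb _); apply/seteqP; split=> y /=; rewrite in_itv/=.
      by move=> [[yb Ey] /eqP y0].
    by move=> [/eqP y0 [yb Ey]].
  have [b0|b0] := leP b 0.
    rewrite expr0n gtn_eqF//= mule0 (_ : mkset _ = set0) ?measure0//.
    apply/seteqP; split=> // y [_ [yb _]]; move: b0.
    by rewrite leNgt (le_lt_trans (enorm_ge0 y) yb).
  rewrite muleC -lebesgue_scale//; congr (leb _); apply/seteqP; split=> y.
    move=> [y0 [yb Ey]]; exists (b^-1 *: y); last first.
      by rewrite scalerA divff ?gt_eqF// scale1r.
    split; first by rewrite /= udirZ ?invr_gt0.
    split; last by apply/eqP; rewrite scaler_eq0 invr_eq0 gt_eqF.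
    rewrite /eball/= subr0 enormZ ger0_norm ?invr_ge0 ?ltW//.
    by rewrite mulrC ltr_pdivrMr// mul1r.
  move=> [z [Ez [z1 /eqP z0]] <-]; split; last split.
  - by rewrite scaler_eq0 gt_eqF.
  - move: z1; rewrite /eball/= subr0 enormZ gtr0_norm// => z1.
    by rewrite gtr_pMr.
  - by rewrite udirZ.
- move=> k; rewrite m1E.
  rewrite (@le_lt_trans _ _ (leb (eball 0 k%:R)))//; last exact: lebesgue_eball_lty.
  apply: le_lebesgue => y [/= [yk _] _]; move: yk; rewrite /= in_itv/= => yk.
  by rewrite /eball/= subr0.
Qed.

Local Notation radial_sf := (sigma_finite_measure_of radial_sigma_finite).
Local Notation angular_sf := (sigma_finite_measure_of angular_sigma_finite).

Lemma polar_product (X : set (RT * brV)) : measurable X ->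
  (radial_sf \x angular_sf)%E X = polar X.
Proof.
apply: (@product_measure_unique _ _ _ _ _ radial_sf angular_sf polar).
by move=> A B mA mB; exact: polar_rect.
Qed.

End polar.

Section polar_integral.
Local Open Scope ereal_scope.
Context (R : realType) (n : nat).
Hypothesis n_gt1 : (1 < n)%N.
Local Notation brV := (borel_rV R n).
Local Notation RT := (measurableTypeR R).
Local Notation leb := (@lebesgue_rV R n).
Local Notation B' := (@punctured_ball R n).
Local Notation mu1 := (@lebesgue_measure R).
Local Notation w := (@radial_weight R n).
Local Notation radial_sf := (sigma_finite_measure_of (radial_sigma_finite R n_gt1)).
Local Notation angular_sf := (sigma_finite_measure_of (angular_sigma_finite R n_gt1)).

Let n_gt0 : (0 < n)%N. Proof. exact: ltnW. Qed.

Lemma integral_angular (f : brV -> \bar R) : measurable_fun setT f ->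
  \int[@angular R n]_t f t = \int[leb]_(y in B') f (udir y).
Proof.
move=> mf; rewrite integral_image// integral_mrestr//.
exact: (measurableT_comp mf (@measurable_leb_udir R n)).
Qed.

Lemma integral_radial (f : RT -> \bar R) : measurable_fun setT f ->
  \int[@radial R n]_s f s = \int[mu1]_s (f s * (w s)%:E).
Proof. by move=> mf; rewrite integral_density//; exact: radial_weight_ge0. Qed.

Lemma integral_nonzero (f : 'rV[R]_n -> \bar R) :
  measurable_fun setT (f : lebesgue_type R n -> \bar R) ->
  \int[leb]_(y in ~` [set 0%R]) f y = \int[leb]_y f y.
Proof.
move=> mf; rewrite integral_mkcond; apply: ae_eq_integral => //.
  have h := measurable_restrictT (f : lebesgue_type R n -> \bar R)
    (@measurable_nonzero R n).
  by apply/h; exact: measurable_funTS.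
exists [set 0%R]; split.
- by apply: borel_lebesgue; exact: borel_set1.
- exact: (lebesgue_set1 n_gt0 0%R).
- move=> y /=; apply: contra_notP => /eqP y0 _; rewrite patchE mem_set//=.
  exact/eqP.
Qed.

Lemma integral_polar (G : RT * brV -> \bar R) : measurable_fun setT G ->
  \int[leb]_y G (polar_map y) = \int[radial_sf \x angular_sf]_p G p.
Proof.
move=> mG; have mGp : measurable_fun setT
    (G \o @polar_map R n : lebesgue_type R n -> \bar R).
  exact: (measurableT_comp mG (@measurable_polar_map R n)).
rewrite -(integral_nonzero mGp).
rewrite -(integral_mrestr _ (@measurable_nonzero R n))//.
rewrite -(integral_image _ (@measurable_polar_map R n))//.
apply: eq_measure_integral => X mX _; exact/esym/polar_product.
Qed.

Lemma polar_ge0 (G : RT * brV -> \bar R) : measurable_fun setT G ->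
  (forall p, 0 <= G p) ->
  \int[leb]_y G (polar_map y) =
  \int[mu1]_s ((\int[leb]_(y in B') G (s, udir y)) * (w s)%:E).
Proof.
move=> mG G0; rewrite integral_polar// fubini_tonelli1//.
rewrite integral_radial; last exact: measurable_fun_fubini_tonelli_F.
apply: eq_integral => s _; rewrite /fubini_F integral_angular//.
exact: (measurableT_comp mG (pair1_measurable s)).
Qed.

Section bounded.
Variables (G : RT * brV -> R) (M b : R).
Hypotheses (mG : measurable_fun setT G) (GM : forall p, (`|G p| <= M)%R).
Hypothesis G_supp : forall s t, (b <= s)%R -> G (s, t) = 0%R.

Let M_ge0 : (0 <= M)%R. Proof. by apply: le_trans (GM (0%R, 0%R)). Qed.

Let intG : (radial_sf \x angular_sf).-integrable setT (EFin \o G).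
Proof.
pose A : set (RT * brV) := `]-oo, b[%classic `*` setT.
have mA : measurable A by exact: measurableX.
have muA : (radial_sf \x angular_sf) A < +oo.
  rewrite product_measure1E//= /sigma_finite_measure_of radial_ray//.
  by rewrite -(fineK (angular_fin n_gt1 measurableT)) -EFinM ltry.
apply/integrableP; split; first exact/measurable_EFinP.
apply: (@le_lt_trans _ _ (\int[radial_sf \x angular_sf]_p (M%:E * (\1_A p)%:E))).
  apply: ge0_le_integral => //.
  - by apply: measurableT_comp => //; exact/measurable_EFinP.
  - by apply: emeasurable_funM => //; apply/measurable_EFinP; exact: measurable_indic.
  - move=> [s t] _ /=; have [bs|sb] := leP b s.
      by rewrite G_supp// normr0 -EFinM lee_fin mulr_ge0.
    by rewrite indicE mem_set ?mulr1 ?mule1 ?lee_fin//; split => //=; rewrite in_itv.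
have mI : measurable_fun setT (fun p : RT * brV => (\1_A p : R)%:E).
  by apply/measurable_EFinP; exact: measurable_indic.
rewrite ge0_integralZl//.
by rewrite integral_indic// setIT lte_mul_pinfty.
Qed.

(** With directions integrated first, the inner integrals become spherical means; [polar_bounded2],
    with rays first, prepares the fundamental theorem of calculus. Boundedness and the support
    condition provide the integrability for Fubini. *)
Lemma polar_bounded1 : \int[leb]_y (G (polar_map y))%:E =
  \int[mu1]_s ((\int[leb]_(y in B') (G (s, udir y))%:E) * (w s)%:E).
Proof.
rewrite (integral_polar (G := EFin \o G)); last exact/measurable_EFinP.
rewrite -integral12_prod_meas1// integral_radial; last exact: (measurable_fubini_F intG).
apply: eq_integral => s _; rewrite /fubini_F/=.
rewrite (integral_angular (f := fun t => (G (s, t))%:E))//.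
apply/measurable_EFinP.
exact: (measurableT_comp mG (pair1_measurable s)).
Qed.

Lemma polar_bounded2 : \int[leb]_y (G (polar_map y))%:E =
  \int[leb]_(y in B') \int[mu1]_s (G (s, udir y) * w s)%:E.
Proof.
rewrite (integral_polar (G := EFin \o G)); last exact/measurable_EFinP.
rewrite -integral21_prod_meas1//= integral_angular; last exact: (measurable_fubini_G intG).
apply: eq_integral => y _; rewrite /fubini_G/=.
rewrite (integral_radial (f := fun s => (G (s, udir y))%:E))//.
apply/measurable_EFinP.
exact: (measurableT_comp mG (pair2_measurable (udir y : brV))).
Qed.

End bounded.

End polar_integral.

(** * Spherical averages *)

Section borel_representative.
Context (R : realType) (n : nat).
Local Notation brV := (borel_rV R n).
Local Notation leb := (@lebesgue_rV R n).
Local Notation lebT := (lebesgue_type R n).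

(** Boxes are Borel, so one may intersect coverings whose total volumes exceed the measure of A by
    at most 1/(k+1). *)
Let hull_fin (A : set lebT) : measurable A -> (leb A < +oo)%E ->
  exists2 B : set brV, measurable B & A `<=` B /\ leb (B `\` A) = 0%E.
Proof.
move=> mA Aoo.
have Afin : leb A \is a fin_num by rewrite ge0_fin_numE ?measure_ge0.
have cov k : exists B : set brV,
    [/\ measurable B, A `<=` B & (leb B <= leb A + k.+1%:R^-1%:E)%E].
  have k0 : 0 < k.+1%:R^-1 :> R by rewrite invr_gt0.
  have [_ [F [CF AF] <-] Fk] := lb_ereal_inf_adherent k0 Afin.
  exists (\bigcup_j oapp (@box R n) set0 (F j)); split=> //.
    by apply: bigcupT_measurable => j; case: (F j) => [ab|] /=; [exact: borel_box|].
  apply: le_trans (ltW Fk).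
  apply: (le_trans (outer_measure_sigma_subadditive (@lebesgue_outer R n) _)).
  apply: lee_nneseries => j; first by move=> _ _; exact: outer_measure_ge0.
  case Fj : (F j) => [ab|] _ /=; last by rewrite outer_measure0.
  by apply: lebesgue_box_le; exact: CF Fj.
have [B BP] := choice cov.
exists (\bigcap_k B k).
  by apply: bigcapT_measurable => k; have [] := BP k.
have AB : A `<=` \bigcap_k B k by move=> y Ay k _; have [_ + _] := BP k; apply.
split=> //.
have mB : measurable (\bigcap_k B k : set lebT).
  by apply: borel_lebesgue; apply: bigcapT_measurable => k; have [] := BP k.
have Ble : (leb (\bigcap_k B k) <= leb A)%E.
  apply/lee_addgt0Pr => e e0.
  have [k ke] := ltr_add_invr e0; rewrite add0r in ke.
  have [_ _ Bk] := BP k.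
  apply: (@le_trans _ _ (leb (B k))); first by apply: le_lebesgue; exact: bigcap_inf.
  by apply: (le_trans Bk); rewrite leeD2l// lee_fin ltW.
rewrite measureD//=; last exact: le_lt_trans Ble Aoo.
rewrite setIidr//; apply/eqP; rewrite eq_le sube_le0 Ble/=.
by rewrite sube_ge0 ?Afin ?orbT// le_lebesgue.
Qed.

Lemma borel_hull (A : set lebT) : measurable A ->
  exists2 B : set brV, measurable B & A `<=` B /\ leb (B `\` A) = 0%E.
Proof.
move=> mA.
pose Q k : set brV := eball 0 k.+1%:R.
have mQ k : measurable (Q k : set lebT).
  by apply: borel_lebesgue; exact: borel_eball.
have hull k : exists B : set brV, [/\ measurable B, A `&` Q k `<=` B &
    leb (B `\` (A `&` Q k)) = 0%E].
  have [|B mB [AB B0]] := @hull_fin (A `&` Q k) (measurableI _ _ mA (mQ k)).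
    rewrite (@le_lt_trans _ _ (leb (Q k)))//; last exact: lebesgue_eball_lty.
    by apply: le_lebesgue; exact: subIsetr.
  by exists B.
have [B BP] := choice hull.
exists (\bigcup_k B k).
  by apply: bigcupT_measurable => k; have [] := BP k.
split=> [y Ay|].
  have [_ sub _] := BP (Num.truncn (enorm y)).
  exists (Num.truncn (enorm y)) => //; apply: sub; split=> //.
  by rewrite /Q /eball/= subr0 truncnS_gt.
apply/eqP; rewrite eq_le measure_ge0 andbT.
apply: (@le_trans _ _ (leb (\bigcup_k (B k `\` (A `&` Q k))))).
  by apply: le_lebesgue => y [[k _ Bk] nA]; exists k => //; split=> // -[].
apply: (le_trans (outer_measure_sigma_subadditive (@lebesgue_outer R n) _)).
by rewrite eseries0// => k _ _; have [_ _] := BP k.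
Qed.

(** For each rational q the sets f > q and f <= q have Borel hulls whose intersection is null; N
    collects these intersections. Off N, the set f > c is the union, over rational q > c, of the
    hulls of f > q. *)
Lemma borel_representative (f : lebT -> R) : measurable_fun setT f ->
  exists N : set brV, [/\ measurable N, leb N = 0%E &
    measurable_fun setT (fun y : brV => if y \in N then 0 else f y)].
Proof.
move=> mf.
pose A (q : rat) : set lebT := [set y | ratr q < f y].
have mA q : measurable (A q).
  rewrite -[A q]setTI (_ : A q = f @^-1` `]ratr q, +oo[%classic); first exact: mf.
  by apply/seteqP; split=> y; rewrite /A/= in_itv/= andbT.
have hulls q : exists BC : set brV * set brV, [/\ measurable BC.1, measurable BC.2,
    A q `<=` BC.1, ~` A q `<=` BC.2 & leb (BC.1 `&` BC.2) = 0%E].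
  have [B mB [AB B0]] := borel_hull (mA q).
  have [C mC [AC C0]] := borel_hull (measurableC (mA q)).
  exists (B, C); split=> //=; apply/eqP; rewrite eq_le measure_ge0 andbT.
  apply: (@le_trans _ _ (leb ((B `\` A q) `|` (C `\` ~` A q)))).
    apply: le_lebesgue => y [By Cy].
    have [Ay|nAy] := pselect (A q y); last by left.
    by right; split=> // nA; exact: nA.
  apply: (le_trans (outer_measureU2 (@lebesgue_outer R n) _ _)).
  by rewrite -[X in (X + _)%E]/(leb _) -[X in (_ + X)%E]/(leb _) B0 C0 adde0.
have [BC BCP] := choice hulls.
pose N : set brV := \bigcup_(j : nat) (if unpickle j is Some q then
  (BC q).1 `&` (BC q).2 else set0).
have mN : measurable N.
  apply: bigcupT_measurable => j; case: unpickle => [q|]//.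
  by have [h1 h2 _ _ _] := BCP q; exact: measurableI.
have N0 : leb N = 0%E.
  apply/eqP; rewrite eq_le measure_ge0 andbT.
  apply: (le_trans (outer_measure_sigma_subadditive (@lebesgue_outer R n) _)).
  rewrite eseries0// => j _ _; case: unpickle => [q|]; last exact: outer_measure0.
  by have [_ _ _ _] := BCP q.
exists N; split=> //.
apply: measurable_fun_gt => c.
have -> : [set y : brV | c < (if y \in N then 0 else f y)] =
    (if c < 0 then N else set0) `|` \bigcup_(j : nat) (if unpickle j is Some q then
       (if c < ratr q then (BC q).1 `\` N else set0) else set0).
  apply/seteqP; split=> y /=.
    have [/set_mem Ny c0|/negP yN cf] := boolP (y \in N); first by left; rewrite c0.
    right; have [q] := rat_in_itvoo cf; rewrite in_itv/= => /andP[cq qf].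
    exists (pickle q); first exact: Logic.I.
    rewrite pickleK cq; split; first by have [_ _ + _ _] := BCP q; apply.
    by move=> /mem_set.
  case=> [|[j _]].
    by have [c0|] := ltP c 0 => // Ny; rewrite mem_set.
  case: unpickle => [q|]//; have [cq|] := ltP c (ratr q) => // -[By nN].
  rewrite memNset//; apply: (lt_trans cq).
  have [//|nA] := pselect (A q y); exfalso; apply: nN.
  exists (pickle q); first exact: Logic.I.
  rewrite pickleK; split=> //.
  by have [_ _ _ + _] := BCP q; apply.
apply: measurableU; first by case: ifP.
apply: bigcupT_measurable => j; case: unpickle => [q|]//; case: ifP => // _.
by have [h1 _ _ _ _] := BCP q; exact: measurableD.
Qed.

End borel_representative.

Section sphere_average.
Context (R : realType) (n : nat).
Hypothesis n_ge2 : (2 <= n)%N.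
Local Notation brV := (borel_rV R n).
Local Notation leb := (@lebesgue_rV R n).
Local Notation lebT := (lebesgue_type R n).
Local Notation vol := (unit_vol R n).
Local Notation HT := (hausdorff_type R n n.-1).
Local Notation H := (@hausdorff_measure R n n.-1).
Local Notation B' := (@punctured_ball R n).
Local Notation mu1 := (@lebesgue_measure R).

Let n_gt0 : (0 < n)%N. Proof. exact: ltnW. Qed.

(** Infinite values are allowed: [fine] then sends both sides to 0, so positive and negative parts
    can be rescaled before integrability is known. *)
Let fineZ_sub (k : R) (a b : \bar R) : 0 < k -> (0 <= a)%E -> (0 <= b)%E ->
  fine (k%:E * a - k%:E * b)%E = k * fine (a - b)%E.
Proof.
move=> k0; case: a => [a| |]//; case: b => [b| |]// a0 b0.
- by rewrite -!EFinM -!EFinB /= mulrBr.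
- by rewrite gt0_muley ?lte_fin// -EFinM/= mulr0.
- by rewrite gt0_muley ?lte_fin// -EFinM/= mulr0.
- by rewrite gt0_muley ?lte_fin//= mulr0.
Qed.

(** The factor in [hausdorff_sphere_lebesgue] is the area of the sphere over the volume of the unit
    ball; dividing by the area leaves an average over the ball. *)
Lemma sphere_avg_borel (g : brV -> R) x r : 0 < r -> measurable_fun setT g ->
  sphere_avg g x r = (\int[leb]_(y in B') g (sphere_proj x r y)) / vol.
Proof.
move=> r0 mg.
have area0 : 0 < fine (H (esphere x r)).
  by rewrite fine_gt0// (hausdorff_sphere_gt0 n_ge2)// hausdorff_sphere_lty.
have c0 := unit_vol_gt0 R n_gt0.
have k0 : 0 < fine (H (esphere x r)) / vol by rewrite divr_gt0.
have mS : measurable (esphere x r : set HT).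
  by apply: borel_hausdorff; exact: borel_esphere.
have mproj := measurable_sphere_proj x r.
have key (f : brV -> \bar R) : measurable_fun setT f -> (forall y, 0 <= f y)%E ->
    (\int[H]_(y in esphere x r) f y = (fine (H (esphere x r)) / vol)%:E *
     \int[leb]_(y in B') f (sphere_proj x r y))%E.
  move=> mf f0.
  have mfH : measurable_fun setT (f : HT -> \bar R).
    exact: (measurableT_comp mf (@measurable_hausdorff_borel R n n.-1)).
  rewrite -(ge0_integral_mrestr _ mS mfH)//.
  rewrite -[LHS](integral_image _ (@measurable_hausdorff_borel R n n.-1) mf).
  pose kk : {nonneg R} := NngNum (ltW k0).
  pose muS : {measure set brV -> \bar R} :=
    image_measure (mrestr leb (@measurable_punctured_ball R n)) mproj.
  rewrite (eq_measure_integral (mscale kk muS)); last first.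
    by move=> A mA _; exact: hausdorff_sphere_lebesgue.
  rewrite ge0_integral_mscale//; congr (_ * _)%E.
  rewrite integral_image// ge0_integral_mrestr//.
  exact: (measurableT_comp mf mproj).
have mgE : measurable_fun setT (EFin \o g) by exact/measurable_EFinP.
rewrite /sphere_avg /Rintegral [X in fine X / _]integralE.
rewrite (key _ (measurable_funepos mgE) (funepos_ge0 _)).
rewrite (key _ (measurable_funeneg mgE) (funeneg_ge0 _)).
rewrite fineZ_sub//; last 2 first.
- by apply: integral_ge0 => y _; exact: funepos_ge0.
- by apply: integral_ge0 => y _; exact: funeneg_ge0.
rewrite mulrC mulrA mulrA mulVf ?gt_eqF// mul1r mulrC; congr (_ / _).
rewrite [X in _ = fine X]integralE; congr fine; congr (_ - _)%E.
  by apply: eq_integral => y _; rewrite !funeposE.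
by apply: eq_integral => y _; rewrite !funenegE.
Qed.

(* Fubini in polar coordinates. *)
Lemma ae_sphere_null (N : set brV) x : measurable N -> leb N = 0%E ->
  {ae mu1, forall s, 0 < s -> H (N `&` esphere x s) = 0%E}.
Proof.
move=> mN N0.
pose Gs : set (measurableTypeR R * brV) :=
  [set p | N (x + (p.1 : R) *: (p.2 : 'rV[R]_n))].
have mGs : measurable Gs.
  rewrite -[Gs]setTI.
  have := @measurable_affine R n _ (measurableTypeR R * brV)%type x
    (fun p => p.1 : R) (fun p => p.2 : brV) measurable_fst measurable_snd.
  by move/(_ measurableT N mN).
have mI : measurable_fun setT
    (fun p : measurableTypeR R * brV => (\1_Gs p : R)%:E).
  by apply/measurable_EFinP; exact: measurable_indic.
pose inner s := leb ([set y | N (sphere_proj x s y)] `&` B').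
have mslice s : measurable ([set y | N (sphere_proj x s y)] : set lebT).
  by rewrite -[X in measurable X]setTI; exact: measurable_sphere_proj.
have innerE s : (\int[leb]_(y in B') (\1_Gs (s, udir y) : R)%:E = inner s)%E.
  rewrite (_ : (fun y : lebT => (\1_Gs (s, udir y) : R)%:E) =
    (fun y => (\1_([set y | N (sphere_proj x s y)]) y)%:E)).
    by rewrite integral_indic//; exact: measurable_punctured_ball.
  by apply/funext => y; rewrite !indicE.
have I0 (p : measurableTypeR R * brV) : (0 <= (\1_Gs p : R)%:E)%E.
  by rewrite lee_fin.
have := polar_ge0 n_ge2 mI I0.
have -> : (\int[leb]_y (\1_Gs (polar_map y) : R)%:E = 0)%E.
  rewrite (_ : (fun y : lebT => (\1_Gs (polar_map y) : R)%:E) =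
    (fun y => (\1_([set y | N (x + y)%R]) y)%:E)); last first.
    have <- : @polar_map R n @^-1` Gs = [set y | N (x + y)].
      by apply/seteqP; split=> y; rewrite /Gs/= scale_udir.
    by apply/funext => y; rewrite !indicE.
  have NxE : [set y | N (x + y)] = [set - x + z | z in N].
    apply/seteqP; split=> [y Ny|_ [z Nz <-]]; last by rewrite /= addrA subrr add0r.
    by exists (x + y) => //; rewrite addKr.
  rewrite integral_indic//; first by rewrite setIT NxE -N0; exact: lebesgue_translate.
  apply: borel_lebesgue; have := @measurable_affine R n _ brV x (fun=> 1) id
    (measurable_cst _) (@measurable_id _ _ _) measurableT N mN.
  by congr measurable; rewrite setTI; apply/seteqP; split=> y /=; rewrite scale1r.
under eq_integral do rewrite innerE.
move=> /esym int0.
have mF : measurable_fun setT (fun s => inner s * (radial_weight n s)%:E)%E.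
  apply: emeasurable_funM; last first.
    by apply/measurable_EFinP; exact: measurable_radial_weight.
  have := measurable_fun_xsection
    (sigma_finite_measure_of (angular_sigma_finite R n_ge2)) mGs.
  congr measurable_fun; apply/funext => s.
  rewrite /= /sigma_finite_measure_of angularE; congr (leb (_ `&` _)).
  by apply/seteqP; split=> y; rewrite /xsection/= inE.
have /(ae_eq_integral_abs mu1 measurableT mF) : (\int[mu1]_s `|inner s * (radial_weight n s)%:E| = 0)%E.
  rewrite -[RHS]int0; apply: eq_integral => s _; rewrite gee0_abs//.
  by rewrite mule_ge0// lee_fin radial_weight_ge0.
apply: filterS => s /(_ Logic.I) /= h s0.
have iw : inner s = 0%E.
  apply/eqP; have /eqP := h; rewrite mule_eq0 => /orP[//|].
  rewrite eqe radial_weight_pos ?(ltW s0)// mulf_eq0 pnatr_eq0 gtn_eqF//=.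
  by rewrite gt_eqF// exprn_gt0.
by rewrite (hausdorff_sphere_lebesgue n_ge2 x s0 mN) -/(inner s) iw mule0.
Qed.

End sphere_average.

(** * Differentiation along lines *)

Lemma mvt_affine (R : realType) (g dg : R -> R) (c eta h : R) :
  (forall t : R, `|t| <= `|h| -> is_derive t 1 g (dg t)) ->
  (forall t : R, `|t| <= `|h| -> `|dg t - c| <= eta) ->
  `|g h - g 0 - c * h| <= eta * `|h|.
Proof.
move=> dgP dgc.
have key (a b : R) : a <= b -> (forall t : R, a <= t <= b -> `|t| <= `|h|) ->
    `|g b - g a - c * (b - a)| <= eta * (b - a).
  move=> ab abh.
  have [||xi] := @MVT_segment R g dg a b ab.
  - move=> t; rewrite in_itv/= => /andP[/ltW at_ /ltW tb].
    by apply/dgP/abh; rewrite at_.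
  - apply: continuous_in_subspaceT => t /set_mem/=; rewrite in_itv/= => /abh/dgP.
    exact: is_derive_continuous.
  - rewrite in_itv/= => /abh/dgc xic ->.
    by rewrite -mulrBl normrM (ger0_norm (_ : 0 <= b - a)) ?subr_ge0// ler_wpM2r
      ?subr_ge0.
have [h0|h0] := leP 0 h.
  have := @key 0 h h0; rewrite subr0 ger0_norm//; apply=> t /andP[t0 th].
  by rewrite !ger0_norm.
have := @key h 0 (ltW h0); rewrite sub0r (ltr0_norm h0) => key0.
rewrite -normrN (_ : - (g h - g 0 - c * h) = g 0 - g h - c * - h); last by ring.
apply: key0 => t /andP[ht t0].
by rewrite (ler0_norm t0) lerN2.
Qed.

Section line_derivative.
Context (R : realType) (n : nat).
Implicit Types (v : 'rV[R]_n -> R) (Omega : set 'rV[R]_n).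

Lemma is_derive_line v z d (t l : R) :
  derivable v (z + t *: d) d -> 'D_d v (z + t *: d) = l ->
  is_derive t 1 (fun s : R => v (z + s *: d)) l.
Proof.
move=> dv <-.
have E : (fun h : R => h^-1 *: (((fun s => v (z + s *: d)) \o shift t) (h *: 1)
    - v (z + t *: d))) =
  (fun h => h^-1 *: ((v \o shift (z + t *: d)) (h *: d) - v (z + t *: d))).
  apply/funext => h /=; congr (_ *: (v _ - _)).
  by rewrite -[h *: 1]/(h * 1) mulr1 scalerDl addrCA.
apply: DeriveDef; first by rewrite /derivable E.
by rewrite /derive E.
Qed.

Section C1.
Variables (Omega : set 'rV[R]_n) (v : 'rV[R]_n -> R).
Hypotheses (oO : open Omega) (v_C1 : C1 Omega v).

Definition grad_dot (v : 'rV[R]_n -> R) (x d : 'rV[R]_n) : R :=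
  \sum_(i < n) partial v i x * d 0 i.

(** Vertices of the path from 0 to a that changes one coordinate at a time. *)
Let head (a : 'rV[R]_n) (j : nat) : 'rV[R]_n :=
  \row_i (if (i < j)%N then a 0 i else 0).

Let head_step a (j : 'I_n) : head a j.+1 = head a j + a 0 j *: delta_mx 0 j.
Proof.
apply/rowP => i; rewrite !mxE eqxx ltnS leq_eqVlt -val_eqE/=.
by case: eqVneq => [/val_inj ->|]; rewrite ?ltnn ?mulr1 ?mulr0 ?addr0 ?add0r.
Qed.

Let head_le (a : 'rV[R]_n) (j : 'I_n) (t : R) : `|t| <= `|a 0 j| ->
  enorm (head a j + t *: delta_mx 0 j) <= enorm a.
Proof.
move=> ta; rewrite ler_wsqrtr//; apply: ler_sum => i _.
rewrite !mxE eqxx -val_eqE/=; case: ltngtP => ij.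
- by rewrite mulr0 addr0.
- by rewrite mulr0 addr0 expr0n sqr_ge0.
- rewrite add0r mulr1 -real_normK ?num_real// -[leRHS]real_normK ?num_real//.
  by rewrite lerXn2r ?nnegrE// (val_inj ij).
Qed.

(** [C1] only speaks of continuous partial derivatives. Along the coordinate path each leg moves a
    single coordinate, where the mean value theorem applies; differentiability along arbitrary lines
    is then derived from this expansion. *)
Lemma C1_taylor x eta : Omega x -> 0 < eta -> exists2 rho, 0 < rho &
  forall a, enorm a < rho ->
    `|v (x + a) - v x - grad_dot v x a| <= eta * enorm a.
Proof.
move=> Ox eta0.
(* There are n legs, each with an error of at most e times the norm of a. *)
pose e := eta / n.+1%:R; have e0 : 0 < e by rewrite divr_gt0.
have near_x : \forall y \near x, Omega y /\ forall i, `|partial v i y - partial v i x| <= e.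
  apply: filterI; first exact: open_nbhs_nbhs.
  apply: (@filter_forall _ _ (fun i y => `|partial v i y - partial v i x| <= e)
    (nbhs x) (nbhs_filter x)) => i; have [_ /(_ _ (nbhsx_ballx _ _ e0)) /= nb] := v_C1 Ox i.
  apply: (@filterS _ (nbhs x) (nbhs_filter x) _ _ _ nb) => y.
  by rewrite /ball/= distrC; exact: ltW.
have /nbhs_eballP[rho rho0 rhoP] := near_x.
exists rho => // a arho.
have -> : v (x + a) - v x = \sum_(j < n) (v (x + head a j.+1) - v (x + head a j)).
  rewrite -(big_mkord xpredT (fun j => v (x + head a j.+1) - v (x + head a j))).
  rewrite (telescope_sumr (fun j => v (x + head a j)))//.
  congr (v _ - v _); last by apply/rowP => i; rewrite !mxE/= addr0.
  by apply/rowP => i; rewrite !mxE ltn_ord.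
rewrite /grad_dot -sumrB (le_trans (ler_norm_sum _ _ _))//.
apply: (@le_trans _ _ (\sum_(j < n) e * enorm a)).
  apply: ler_sum => j _; rewrite head_step addrA.
  have inball t : `|t| <= `|a 0 j| -> eball x rho (x + head a j + t *: delta_mx 0 j).
    move=> ta; rewrite /eball/= [X in enorm X](_ : _ = head a j + t *: delta_mx 0 j).
      exact: le_lt_trans (head_le ta) arho.
    by rewrite -(addrA x) addrAC subrr add0r.
  have := @mvt_affine R (fun t => v (x + head a j + t *: delta_mx 0 j))
    (fun t => partial v j (x + head a j + t *: delta_mx 0 j)) (partial v j x) e (a 0 j).
  rewrite scale0r addr0 => h; apply: (le_trans (h _ _)).
  - move=> t /inball /rhoP[Oy _]; apply: is_derive_line => //.
    by have [] := v_C1 Oy j.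
  - by move=> t /inball /rhoP[_]; apply.
  - by rewrite ler_wpM2l ?(ltW e0)// coord_le_enorm.
rewrite sumr_const card_ord -mulr_natl /e mulrA ler_wpM2r ?enorm_ge0//.
rewrite mulrCA ger_pMr// ler_pdivrMr// mul1r ler_nat//.
Qed.

Lemma C1_is_derive_line x d (t : R) : Omega (x + t *: d) ->
  is_derive t 1 (fun s : R => v (x + s *: d)) (grad_dot v (x + t *: d) d).
Proof.
move=> Oy; set y := x + t *: d.
have cv : h^-1 *: (((fun s => v (x + s *: d)) \o shift t) (h *: 1) - v y)
    @[h --> 0^'] --> grad_dot v y d.
  apply/cvgrPdist_le => e e0.
  pose eta := e / (enorm d + 1).
  have d1 : 0 < enorm d + 1 by rewrite ltr_wpDl ?enorm_ge0.
  have eta0 : 0 < eta by rewrite divr_gt0.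
  have [rho rho0 taylor] := C1_taylor Oy eta0.
  have rd : 0 < rho / (enorm d + 1) by rewrite divr_gt0.
  near=> h.
  have h0 : h != 0 by near: h; exact: nbhs_dnbhs_neq.
  have hr : `|h| < rho / (enorm d + 1).
    by near: h; exact: dnbhs0_lt.
  have hd : enorm (h *: d) < rho.
    rewrite enormZ (@le_lt_trans _ _ (`|h| * (enorm d + 1)))//.
      by rewrite ler_wpM2l// lerDl.
    by rewrite -ltr_pdivlMr.
  have := taylor _ hd.
  rewrite /= -[h *: 1]/(h * 1) mulr1.
  have -> : x + (h + t) *: d = y + h *: d by rewrite scalerDl addrCA addrC.
  have -> : grad_dot v y (h *: d) = h * grad_dot v y d.
    by rewrite mulr_sumr; apply: eq_bigr => i _; rewrite mxE mulrCA.
  rewrite enormZ => tay.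
  have -> : grad_dot v y d - h^-1 * (v (y + h *: d) - v y) =
      - (h^-1 * (v (y + h *: d) - v y - h * grad_dot v y d)).
    by rewrite [in RHS]mulrBr mulKf// opprB.
  rewrite normrN normrM normfV ler_pdivrMl ?normr_gt0//.
  apply: (le_trans tay); rewrite mulrCA ler_wpM2l// /eta mulrAC.
  by rewrite ler_pdivrMr// ler_wpM2l ?(ltW e0)// lerDl.
apply: DeriveDef; first by apply/cvg_ex; exists (grad_dot v y d).
exact: cvg_lim cv.
Unshelve. all: by end_near. Qed.

End C1.
End line_derivative.

(** * The fundamental solution *)

Section fundamental_solution.
Context (R : realType) (n : nat).
Hypothesis n_gt1 : (1 < n)%N.

(* A primitive of s |-> s^(1-n) on ]0, +oo[. *)
Definition lam (s : R) : R :=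
  if n == 2%N then ln s else - (n - 2)%N%:R^-1 * s ^- (n - 2).

Lemma is_derive_lam (s : R) : 0 < s -> is_derive s 1 lam (s ^- n.-1).
Proof.
move=> s0; rewrite /lam; have [->|n2] := eqVneq n 2%N.
  by rewrite expr1; exact: is_derive1_ln.
have k0 : (0 < n - 2)%N by rewrite subn_gt0 ltn_neqAle eq_sym n2.
have kR : (n - 2)%N%:R != 0 :> R by rewrite pnatr_eq0 -lt0n.
have sk : s ^+ (n - 2) != 0 by rewrite expf_neq0// gt_eqF.
have dX : is_derive s 1 (fun t : R => t ^+ (n - 2)) ((n - 2)%N%:R * s ^+ (n - 2).-1).
  apply: DeriveDef; first exact: exprn_derivable.
  by rewrite exp_derive -[LHS]/(_ * _ * 1) mulr1.
have D := @is_deriveZ _ _ _ _ (- (n - 2)%N%:R^-1) _ _ _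
  (@is_deriveV R (fun t => t ^+ (n - 2)) s _ 1 sk dX).
apply: (is_derive_eq D); rewrite -[LHS]/(_ * (_ * _)).
have -> : s ^+ n.-1 = s * s ^+ (n - 2).
  by rewrite -exprS; congr (_ ^+ _); rewrite -subSn// subSS subn1.
have -> : s ^+ (n - 2) = s * s ^+ (n - 2).-1 by rewrite -exprS prednK.
have s1 : s ^+ (n - 2).-1 != 0 by rewrite expf_neq0// gt_eqF.
move: s1 kR; set p := s ^+ _; set q := _%:R => p0 q0.
by field; rewrite q0 p0 gt_eqF.
Qed.

(** The form in which the kernel arises, for n = 2 and n >= 3 at once: the polar weight s^(n-1)
    times the radial fundamental solution normalized to vanish at eps. *)
Lemma mean_kernelE (eps s : R) : 0 < eps -> 0 < s ->
  mean_kernel n eps s = s ^+ n.-1 * (lam eps - lam s).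
Proof.
move=> e0 s0; rewrite /mean_kernel /lam; have [->|n2] := eqVneq n 2%N.
  by rewrite expr1 lnM ?posrE ?invr_gt0// lnV ?posrE.
have k0 : (0 < n - 2)%N by rewrite subn_gt0 ltn_neqAle eq_sym n2.
have kR : (n - 2)%N%:R != 0 :> R by rewrite pnatr_eq0 -lt0n.
have -> : s ^+ n.-1 = s * s ^+ (n - 2).
  by rewrite -exprS; congr (_ ^+ _); rewrite -subSn// subSS subn1.
have sk : s ^+ (n - 2) != 0 by rewrite expf_neq0// gt_eqF.
have ek : eps ^+ (n - 2) != 0 by rewrite expf_neq0// gt_eqF.
rewrite expr_div_n; field.
by rewrite ek sk kR.
Qed.

Lemma lam_lipschitz (delta a b : R) : 0 < delta -> delta <= a -> delta <= b ->
  `|lam a - lam b| <= delta ^- n.-1 * `|a - b|.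
Proof.
move=> d0; wlog ab : a b / a <= b => [H da db|da db].
  have [ab|/ltW ba] := leP a b; first exact: H.
  by rewrite distrC (distrC a); exact: H.
have [||c] := @MVT_segment R lam (fun s => s ^- n.-1) a b ab.
- move=> s; rewrite in_itv/= => /andP[as_ _].
  by apply: is_derive_lam; rewrite (lt_le_trans d0)// (le_trans da)// ltW.
- apply: continuous_in_subspaceT => s /set_mem/=; rewrite in_itv/= => /andP[as_ _].
  apply: is_derive_continuous; apply: is_derive_lam.
  by rewrite (lt_le_trans d0)// (le_trans da).
- rewrite in_itv/= => /andP[ac _] E.
  have c0 : 0 < c by rewrite (lt_le_trans d0)// (le_trans da).
  rewrite distrC E normrM (distrC a) ler_wpM2r//.
  rewrite ger0_norm ?invr_ge0 ?exprn_ge0 ?(ltW c0)//.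
  by rewrite lef_pV2 ?posrE ?exprn_gt0// lerXn2r ?nnegrE ?(ltW d0) ?(ltW c0)//
    (le_trans da).
Qed.

Lemma lam_le (a b : R) : 0 < a -> a <= b -> lam a <= lam b.
Proof.
move=> a0 ab.
have [||c] := @MVT_segment R lam (fun s => s ^- n.-1) a b ab.
- move=> s; rewrite in_itv/= => /andP[as_ _].
  by apply: is_derive_lam; exact: lt_trans as_.
- apply: continuous_in_subspaceT => s /set_mem/=; rewrite in_itv/= => /andP[as_ _].
  by apply: is_derive_continuous; apply: is_derive_lam; exact: lt_le_trans as_.
- rewrite in_itv/= => /andP[ac _] E; rewrite -subr_ge0 E mulr_ge0 ?subr_ge0//.
  by rewrite invr_ge0 exprn_ge0// (le_trans (ltW a0)).
Qed.

Section cutoff.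
Variables (delta eps : R).
Hypotheses (delta_gt0 : 0 < delta) (delta_lt : delta < eps).

Definition clip (s : R) : R := Num.min (Num.max s delta) eps.

Definition cutoff (s : R) : R := lam eps - lam (clip s).

Definition cutoff_slope (s : R) : R := if delta < s < eps then - s ^- n.-1 else 0.

Let clip_ge s : delta <= clip s.
Proof. by rewrite le_min le_max lexx orbT ltW. Qed.

Lemma clip_lipschitz s t : `|clip s - clip t| <= `|s - t|.
Proof.
have key a b : clip a <= clip b + `|a - b|.
  have n0 : 0 <= `|a - b| by [].
  rewrite /clip; case: (leP (Num.max b delta) eps) => _; last first.
    by rewrite (@le_trans _ _ eps) ?ge_min ?lexx ?orbT// lerDl.
  apply: (@le_trans _ _ (Num.max a delta)); first by rewrite ge_min lexx.
  have h1 : b <= Num.max b delta by rewrite le_max lexx.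
  have h2 : delta <= Num.max b delta by rewrite le_max lexx orbT.
  by have := ler_norm (a - b); rewrite ge_max; lra.
have := key s t; have := key t s; rewrite (distrC t) ler_norml; lra.
Qed.

Lemma cutoff_lipschitz s t : `|cutoff s - cutoff t| <= delta ^- n.-1 * `|s - t|.
Proof.
rewrite /cutoff (_ : _ - _ = lam (clip t) - lam (clip s)); last by ring.
rewrite distrC.
rewrite (le_trans (lam_lipschitz delta_gt0 (clip_ge _) (clip_ge _)))//.
by rewrite ler_wpM2l ?clip_lipschitz// invr_ge0 exprn_ge0// ltW.
Qed.

Lemma cutoff_le s : `|cutoff s| <= lam eps - lam delta.
Proof.
have cs : clip s <= eps by rewrite ge_min lexx orbT.
have c0 : 0 < clip s by exact: lt_le_trans (clip_ge s).
rewrite /cutoff ger0_norm ?subr_ge0 ?lam_le//.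
by rewrite lerD2l lerN2 lam_le.
Qed.

Lemma cutoff_out s : eps <= s -> cutoff s = 0.
Proof.
move=> es; rewrite /cutoff /clip min_r ?subrr//.
by rewrite le_max es.
Qed.

Lemma cutoff_mid s : delta <= s <= eps -> cutoff s = lam eps - lam s.
Proof. by move=> /andP[ds se]; rewrite /cutoff /clip max_l// min_l. Qed.

Lemma cutoff_in s : s <= delta -> cutoff s = lam eps - lam delta.
Proof. by move=> sd; rewrite /cutoff /clip max_r// min_l// ltW. Qed.

Lemma cutoff_slope_le s : `|cutoff_slope s| <= delta ^- n.-1.
Proof.
have d1 : 0 <= delta ^- n.-1 by rewrite invr_ge0 exprn_ge0// ltW.
rewrite /cutoff_slope; case: ifPn => [/andP[dz _]|_]; last by rewrite normr0.
have z0 : 0 < s by exact: lt_trans dz.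
rewrite normrN ger0_norm ?invr_ge0 ?exprn_ge0 ?(ltW z0)//.
by rewrite lef_pV2 ?posrE ?exprn_gt0// lerXn2r ?nnegrE ?(ltW delta_gt0) ?(ltW z0) ?ltW.
Qed.

Lemma cutoff_slope_out s : eps <= s -> cutoff_slope s = 0.
Proof. by move=> es; rewrite /cutoff_slope [_ < eps]ltNge es andbF. Qed.

Lemma is_derive_cutoff s : s != delta -> s != eps ->
  is_derive s 1 cutoff (cutoff_slope s).
Proof.
move=> sd se; rewrite /cutoff_slope.
have [sd'|ds] := ltP s delta.
  rewrite [delta < s]ltNge (ltW sd')/=.
  apply: (@near_eq_is_derive _ _ _ (cst (lam eps - lam delta))) => //.
  near=> t; rewrite cutoff_in//; apply: ltW; near: t; exact: lt_nbhsl.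
have {sd ds}ds : delta < s by rewrite lt_neqAle eq_sym sd.
rewrite ds/=; have [se'|es] := ltP s eps; last first.
  apply: (@near_eq_is_derive _ _ _ (cst 0)) => //.
  near=> t; rewrite cutoff_out//; apply: ltW; near: t; apply: lt_nbhsr.
  by rewrite lt_neqAle eq_sym se.
apply: (@near_eq_is_derive _ _ _ (fun t => lam eps - lam t)).
  near=> t; rewrite cutoff_mid//; apply/andP; split; apply: ltW; near: t.
    exact: lt_nbhsr.
  exact: lt_nbhsl.
have dl := is_derive_lam (lt_trans delta_gt0 ds).
apply: (is_derive_eq (is_deriveB (is_derive_cst (lam eps) s 1) dl)).
by rewrite sub0r.
Unshelve. all: by end_near. Qed.

End cutoff.
End fundamental_solution.

(** * Uniform bounds on compact sets *)

Section compact_bounds.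
Context (R : realType).

Lemma compact_bounded_near (T : topologicalType) (K : set T) (g : T -> R) :
  compact K -> (forall x, K x -> exists M, \forall y \near x, g y <= M) ->
  exists M, forall y, K y -> g y <= M.
Proof.
move=> /compact_near_coveringP cK gM.
(* Near-covering compactness, with the bound itself as the parameter tending to +oo. *)
have [|M [_ MP]] := cK R +oo (fun M y => g y <= M) _.
  move=> x /gM[M nM].
  exists ([set y | g y <= M], [set i | M <= i]) => /=.
    by split=> //; apply: nbhs_pinfty_ge; exact: num_real.
  by move=> [y i] /= [gy Mi]; exact: le_trans gy Mi.
by exists (M + 1); apply: MP; rewrite ltrDl.
Qed.

Context (n : nat).
Implicit Types (u : 'rV[R]_n -> R).

Lemma compact_cball (x : 'rV[R]_n) r : compact [set y | enorm (y - x) <= r].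
Proof.
apply: bounded_closed_compact; last exact: closed_enorm_le.
exists (r + enorm x); split; first exact: num_real.
move=> M rM y /= xy; apply: (le_trans (norm_le_enorm y)); apply: ltW.
apply: le_lt_trans rM; have := enormD (y - x) x; rewrite subrK.
by move/le_trans; apply; rewrite lerD2r.
Qed.

Lemma locally_lipschitz_near (Omega : set 'rV[R]_n) u x :
  locally_lipschitz Omega u -> Omega x -> exists2 L, 0 <= L &
  exists2 r, 0 < r & forall y z, eball x r y -> eball x r z ->
    `|u y - u z| <= L * enorm (y - z).
Proof.
move=> lu Ox; have [U nU [M [_ MP]]] := lu x Ox.
have M1 : M < `|M| + 1 by rewrite (le_lt_trans (ler_norm M))// ltrDl.
have {}MP := MP _ M1.
exists (`|M| + 1); first by rewrite addr_ge0.
have /nbhs_eballP[r r0 rU] := nU; exists r => // y z yr zr.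
apply: (@le_trans _ _ ((`|M| + 1) * `|y - z|)).
  by have := MP (y, z) (conj (rU _ yr) (rU _ zr)).
by rewrite ler_wpM2l ?norm_le_enorm// addr_ge0.
Qed.

Lemma locally_lipschitz_bounded (Omega K : set 'rV[R]_n) u :
  locally_lipschitz Omega u -> compact K -> K `<=` Omega ->
  exists M, forall y, K y -> `|u y| <= M.
Proof.
move=> lu cK KO; apply: (compact_bounded_near cK) => x Kx.
have [L L0 [r r0 Lr]] := locally_lipschitz_near lu (KO x Kx).
exists (`|u x| + L * r).
apply: (@filterS _ (nbhs x) (nbhs_filter x) _ _ _ (nbhs_eball x r0)) => y yr.
have xr : eball x r x by rewrite /eball/= subrr enorm0.
rewrite -[u y](subrK (u x)) (le_trans (ler_normD _ _))// addrC lerD2l.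
by rewrite (le_trans (Lr _ _ yr xr))// ler_wpM2l// ltW.
Qed.

(** The difference quotient is bounded on K x K: near the diagonal by a local Lipschitz constant,
    away from it because u is bounded and the distance is bounded below. *)
Lemma locally_lipschitz_compact (Omega K : set 'rV[R]_n) u :
  locally_lipschitz Omega u -> compact K -> K `<=` Omega ->
  exists L, forall y z, K y -> K z -> `|u y - u z| <= L * enorm (y - z).
Proof.
move=> lu cK KO.
have [M uM] := locally_lipschitz_bounded lu cK KO.
have cKK := compact_setX cK cK.
(* The indicator factors make the quotient vanish outside K x K: the neighbourhoods used for
   compactness leave K, where there is no bound on u. *)
have [|L gL] := @compact_bounded_near _ _
  (fun p => `|(u p.1 - u p.2) / enorm (p.1 - p.2)| *
            (p.1 \in K)%:R * (p.2 \in K)%:R) cKK.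
  move=> [a b] [/= Ka Kb]; have [<-|ab] := eqVneq a b.
    have [L L0 [r r0 Lr]] := locally_lipschitz_near lu (KO a Ka).
    exists L; exists (eball a r, eball a r) => /=; first by split; exact: nbhs_eball.
    move=> [y z] /= [yr zr].
    apply: (@le_trans _ _ `|(u y - u z) / enorm (y - z)|).
      by rewrite -mulrA ler_piMr// mulr_ile1 ?ler0n// lern1 leq_b1.
    have [->|yz] := eqVneq y z; first by rewrite subrr mul0r normr0.
    rewrite normrM normfV (ger0_norm (enorm_ge0 _)) ler_pdivrMr ?Lr//.
    by rewrite enorm_gt0 subr_eq0.
  pose d := enorm (a - b).
  have d0 : 0 < d by rewrite enorm_gt0 subr_eq0.
  have d4 : 0 < d / 4 by rewrite divr_gt0.
  exists (2 * `|M| / (d / 2)).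
  exists (eball a (d / 4), eball b (d / 4)) => /=; first by split; exact: nbhs_eball.
  move=> [y z] /= [yr zr].
  have dyz : d / 2 <= enorm (y - z).
    have h1 := enormB_le y a b; have h2 := enormB_le z y b.
    move: yr zr h1 h2; rewrite /eball/= -/d (enormC a y) => *; lra.
  have yz0 : 0 < enorm (y - z) by rewrite (lt_le_trans _ dyz)// divr_gt0.
  have R0 : 0 <= 2 * `|M| / (d / 2).
    by rewrite divr_ge0 ?mulr_ge0// ltW// divr_gt0.
  have [/set_mem Ky|_] := boolP (y \in K); last first.
    by rewrite mulr0 mul0r.
  have [/set_mem Kz|_] := boolP (z \in K); last first.
    by rewrite mulr0.
  rewrite !mulr1 normrM normfV (ger0_norm (enorm_ge0 _)) ler_pM//.
  - by rewrite invr_ge0 enorm_ge0.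
  - have := uM y Ky; have := uM z Kz; have := ler_norm M.
    by have := ler_normB (u y) (u z); lra.
  - by rewrite lef_pV2 ?posrE// divr_gt0.
exists L => y z Ky Kz; have [->|yz] := eqVneq y z.
  by rewrite !subrr normr0 enorm0 mulr0.
have yz0 : 0 < enorm (y - z) by rewrite enorm_gt0 subr_eq0.
have := gL (y, z) (conj Ky Kz); rewrite /= !mem_set// !mulr1.
by rewrite normrM normfV (ger0_norm (enorm_ge0 _)) ler_pdivrMr.
Qed.

End compact_bounds.

(** * Integration by parts *)

Lemma bounded_integrable d (T : measurableType d) (R : realType)
    (m : {measure set T -> \bar R}) (A : set T) (f : T -> R) (C : R) :
  measurable A -> (m A < +oo)%E -> measurable_fun A f ->
  (forall x, A x -> `|f x| <= C) -> m.-integrable A (EFin \o f).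
Proof.
move=> mA mAoo mf fC; apply: measurable_bounded_integrable => //.
by exists C; split=> [|B CB y Ay]; [exact: num_real|exact: le_trans (fC _ Ay) (ltW CB)].
Qed.

Section lebesgue_tools.
Context (R : realType) (n : nat).
Hypothesis n_gt1 : (1 < n)%N.
Local Notation brV := (borel_rV R n).
Local Notation leb := (@lebesgue_rV R n).
Local Notation lebT := (lebesgue_type R n).

Lemma measurable_translate (a : 'rV[R]_n) :
  measurable_fun setT (fun z : brV => (a + (z : 'rV[R]_n)) : brV).
Proof.
apply: borel_measurable_fun => i.
apply: (eq_measurable_fun (fun z : brV => a 0 i + (z : 'rV[R]_n) 0 i)).
  by move=> z _; rewrite mxE.
by apply: measurable_funD => //; exact: borel_coord.
Qed.

Lemma measurable_borel_lebesgue d (T : measurableType d) (f : brV -> T) :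
  measurable_fun setT f -> measurable_fun setT (f : lebT -> T).
Proof. by move=> mf; exact: (measurableT_comp mf (@measurable_leb_borel R n)). Qed.

Lemma integral_translate (a : 'rV[R]_n) (f : brV -> \bar R) :
  measurable_fun setT f ->
  (\int[leb]_z f (a + z)%R = \int[leb]_z f z)%E.
Proof.
move=> mf; have ma := measurable_borel_lebesgue (measurable_translate a).
rewrite -(integral_image _ ma mf).
rewrite -[RHS](integral_image _ (@measurable_leb_borel R n) mf).
apply: eq_measure_integral => A mA _.
rewrite -[RHS]/(leb A) -(lebesgue_translate (- a) A); congr (leb _).
apply/seteqP; split=> [z Az|_ [z Az <-]]; last first.
  by rewrite /preimage/= addrA subrr add0r.
by exists (a + z) => //; rewrite addKr.
Qed.

(** In polar coordinates the indicator of the centred sphere lives on the single radius r. *)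
Lemma lebesgue_esphere (x : 'rV[R]_n) r : leb (esphere x r) = 0%E.
Proof.
have -> : leb (esphere x r) = leb (esphere 0 r).
  rewrite -(lebesgue_translate x (esphere 0 r)); congr (leb _).
  apply/seteqP; split=> [y Sy|_ [y Sy <-]].
    exists (y - x); last by rewrite addrCA subrr addr0.
    by rewrite /esphere/= subr0.
  by rewrite /esphere/= addrAC subrr add0r; move: Sy; rewrite /esphere/= subr0.
pose X : set (measurableTypeR R * brV) := [set r] `*` setT.
have mX : measurable X by exact: measurableX.
have mI : measurable_fun setT (fun p : measurableTypeR R * brV => (\1_X p : R)%:E).
  by apply/measurable_EFinP; exact: measurable_indic.
have I0 (p : measurableTypeR R * brV) : (0 <= (\1_X p : R)%:E)%E.
  by rewrite lee_fin.
have := polar_ge0 n_gt1 mI I0.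
have -> : (\int[leb]_y (\1_X (polar_map y) : R)%:E = leb (esphere 0 r))%E.
  rewrite (_ : (fun y : lebT => (\1_X (polar_map y) : R)%:E) =
    (fun y => (\1_(esphere 0 r : set lebT) y)%:E)).
    by rewrite integral_indic ?setIT//; apply: borel_lebesgue; exact: borel_esphere.
  have -> : esphere 0 r = @polar_map R n @^-1` X.
    by apply/seteqP; split=> y; rewrite /esphere/= subr0 => // -[].
  by apply/funext => y; rewrite !indicE.
move=> ->; rewrite -[RHS](@integral_set1 R (fun s => (\int[leb]_(y in @punctured_ball R n)
  (\1_X (s, udir y) : R)%:E) * (radial_weight n s)%:E)%E r).
rewrite [RHS]integral_mkcond; apply: eq_integral => s _.
rewrite patchE; case: ifPn => // /negP sr.
rewrite integral0_eq ?mul0e// => y _; rewrite indicE memNset// => -[/= sr' _].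
by apply: sr; apply/mem_set.
Qed.

Lemma integrable_bounded_support (f : brV -> R) (M r : R) (x : 'rV[R]_n) :
  measurable_fun setT f -> (forall z, `|f z| <= M) ->
  (forall z, r <= enorm (z - x) -> f z = 0) ->
  leb.-integrable setT (EFin \o (f : lebT -> R)).
Proof.
move=> mf fM f0; have mf' := measurable_borel_lebesgue mf.
have mb : measurable (eball x r : set lebT).
  by apply: borel_lebesgue; exact: borel_eball.
have -> : EFin \o f = (EFin \o f) \_ (eball x r).
  apply/funext => z; rewrite patchE; case: ifPn => // /negP zr.
  by rewrite /= f0// leNgt; apply/negP => zr'; apply: zr; exact: mem_set.
apply: (iffLR (integrable_mkcond (EFin \o (f : lebT -> R)) mb)).
have mfb : measurable_fun (eball x r : set lebT) (f : lebT -> R).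
  exact: measurable_funTS.
exact: (bounded_integrable mb (lebesgue_eball_lty x r) mfb (fun z _ => fM z)).
Qed.

(** Dominated convergence concerns sequences, hence the increments 1/(k+1). *)
Lemma derive_sequence (g : R -> R) (l : R) : is_derive (0 : R) 1 g l ->
  (fun k : nat => (g k.+1%:R^-1 - g 0) / k.+1%:R^-1) @ \oo --> l.
Proof.
move=> [dg gl].
have cv : h^-1 *: ((g \o shift 0) (h *: 1) - g 0) @[h --> 0^'] --> l.
  by rewrite -gl; exact: dg.
have ch : (fun k : nat => k.+1%:R^-1 : R) @ \oo --> 0^'.
  move=> U nU.
  have nU' : nbhs (0 : R) [set y : R | y != 0 -> U y] by exact: nU.
  have [N _ HN] := @cvg_harmonic R _ nU'.
  by exists N => // k /HN/=; apply; rewrite invr_eq0.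
have := cvg_comp _ _ ch cv.
apply: cvg_trans; apply: near_eq_cvg; near=> k => /=.
by rewrite addr0 -[_ *: 1]/(_ * 1) mulr1 mulrC.
Unshelve. all: by end_near. Qed.

(** The square of the norm is a polynomial in t, positive at t = 0, and the chain rule applies to
    the square root. *)
Lemma is_derive_enorm_line (y d : 'rV[R]_n) : y != 0 ->
  is_derive (0 : R) 1 (fun t : R => enorm (y + t *: d)) (edot y d / enorm y).
Proof.
move=> y0.
pose p (t : R) := edot y y + (t * (2 * edot y d) + t ^+ 2 * edot d d).
have E : (fun t : R => enorm (y + t *: d)) = Num.sqrt \o p.
  apply/funext => t; rewrite /= enormE; congr Num.sqrt.
  by rewrite edotDl !edotDr !edotZl !edotZr (edotC d y) /p; ring.
have p0 : p 0 = enorm y ^+ 2 by rewrite enorm_sqr /p; ring.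
have py : 0 < enorm y by rewrite enorm_gt0.
have dp : is_derive (0 : R) 1 p (2 * edot y d).
  by apply: is_derive_eq; rewrite /GRing.scale/=; ring.
have ds : is_derive (p 0) 1 Num.sqrt (2 * Num.sqrt (p 0))^-1.
  by apply: is_derive1_sqrt; rewrite p0 exprn_gt0.
rewrite E; apply: (is_derive_eq (is_derive1_comp ds dp)).
rewrite p0 sqrtr_sqr ger0_norm ?enorm_ge0//.
by field; rewrite gt_eqF.
Qed.

Lemma cvg_sumr (T I : Type) (F : set_system T) (FF : Filter F) (s : seq I)
    (f : I -> T -> R) (l : I -> R) :
  (forall i, f i @ F --> l i) ->
  (fun k => \sum_(i <- s) f i k) @ F --> \sum_(i <- s) l i.
Proof.
move=> fl; elim: s => [|i s IH].
  rewrite big_nil (_ : (fun k => _) = cst 0); first exact: cvg_cst.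
  by apply/funext => k; rewrite big_nil.
rewrite big_cons (_ : (fun k => _) = (fun k => f i k + \sum_(j <- s) f j k)).
  exact: cvgD.
by apply/funext => k; rewrite big_cons.
Qed.

Lemma measurable_cutoff_slope (delta eps : R) : 0 < delta ->
  measurable_fun setT (cutoff_slope n delta eps : measurableTypeR R -> R).
Proof.
move=> delta_gt0; apply: (eq_measurable_fun (fun s : measurableTypeR R =>
    if delta < s < eps then - ((s ^+ n.-1) `^ (-1)) else 0)).
  move=> s _; rewrite /cutoff_slope; case: ifPn => // /andP[ds _].
  by rewrite powR_inv1// exprn_ge0// ltW// (lt_trans delta_gt0).
apply: measurable_fun_ifT => //.
  by apply: measurable_and; exact: measurable_fun_ltr.
apply: measurableT_comp => //.
by apply: (measurableT_comp (measurable_powR (-1))); exact: measurable_funX.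
Qed.

End lebesgue_tools.

Section integration_by_parts.
Context (R : realType) (n : nat).
Hypothesis n_gt1 : (1 < n)%N.
Local Notation brV := (borel_rV R n).
Local Notation leb := (@lebesgue_rV R n).
Local Notation lebT := (lebesgue_type R n).
Variables (x : 'rV[R]_n) (delta eps M L MF : R).
Hypotheses (delta_gt0 : 0 < delta) (delta_lt : delta < eps).
Variables (u : 'I_n -> 'rV[R]_n -> R) (F : 'rV[R]_n -> R).
Hypothesis mu_ : forall i, measurable_fun setT (u i : brV -> R).
Hypothesis mF : measurable_fun setT (F : brV -> R).
Hypotheses (M_ge0 : 0 <= M) (L_ge0 : 0 <= L).
Hypothesis uM : forall i z, enorm (z - x) <= eps -> `|u i z| <= M.
Hypothesis uL : forall i a b, enorm (a - x) <= eps -> enorm (b - x) <= eps ->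
  `|u i a - u i b| <= L * enorm (a - b).
Hypothesis FM : forall z, `|F z| <= MF.
Hypothesis div_u : {ae leb, forall z, eball x eps z ->
  (forall i, derivable (u i) z (delta_mx 0 i)) /\
  \sum_(i < n) 'D_(delta_mx 0 i) (u i) z = F z}.

Let psi (z : 'rV[R]_n) : R := cutoff n delta eps (enorm (z - x)).
Let w i z : R := u i z * psi z.
Let P : R := lam n eps - lam n delta.
Let K : R := delta ^- n.-1.
Let e (i : 'I_n) : 'rV[R]_n := delta_mx 0 i.

Let K_ge0 : 0 <= K. Proof. by rewrite invr_ge0 exprn_ge0// ltW. Qed.

Let enorm_e i : enorm (e i) = 1.
Proof.
rewrite enormE /edot (bigD1 i)//= big1 => [|j ji].
  by rewrite addr0 !mxE !eqxx mulr1 sqrtr1.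
by rewrite !mxE eqxx/= (negbTE ji) mulr0.
Qed.

Let psi_lip a b : `|psi a - psi b| <= K * enorm (a - b).
Proof.
rewrite (le_trans (cutoff_lipschitz n_gt1 delta_gt0 delta_lt _ _))//.
rewrite ler_wpM2l//.
by have := enorm_lip (a - x) (b - x); rewrite opprB subrKA.
Qed.

Let psi_out z : eps <= enorm (z - x) -> psi z = 0.
Proof. exact: cutoff_out. Qed.

Let psi_le z : `|psi z| <= P.
Proof. exact: (cutoff_le n_gt1 delta_gt0 delta_lt). Qed.

Let P_ge0 : 0 <= P. Proof. by apply: le_trans (psi_le 0). Qed.

(** u is controlled only on the closed ball, but psi vanishes beyond it. If one point is inside and
    the other outside, psi at the inner point is at most K times their distance, and the bound M on
    u there suffices. *)
Let w_lip i a b : `|w i a - w i b| <= (L * P + M * K) * enorm (a - b).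
Proof.
have ab0 := enorm_ge0 (a - b).
have LP : 0 <= L * P * enorm (a - b) by rewrite !mulr_ge0.
have half c d : enorm (c - x) <= eps -> eps <= enorm (d - x) ->
    `|w i c - w i d| <= M * K * enorm (c - d).
  move=> cx dx; rewrite /w (psi_out dx) mulr0 subr0 normrM -mulrA.
  rewrite ler_pM//; first exact: uM.
  by have := psi_lip c d; rewrite (psi_out dx) subr0.
have [ax|/ltW ax] := leP (enorm (a - x)) eps; last first.
  have [bx|/ltW bx] := leP (enorm (b - x)) eps.
    by rewrite distrC (le_trans (half _ _ bx ax))// (enormC b a) mulrDl lerDr.
  rewrite /w !psi_out// !mulr0 subrr normr0 mulr_ge0// addr_ge0// mulr_ge0//.
have [bx|/ltW bx] := leP (enorm (b - x)) eps; last first.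
  by rewrite (le_trans (half _ _ ax bx))// mulrDl lerDr.
have -> : w i a - w i b = (u i a - u i b) * psi a + u i b * (psi a - psi b).
  by rewrite /w; ring.
rewrite (le_trans (ler_normD _ _))// [X in _ <= X]mulrDl lerD//.
  by rewrite normrM mulrAC ler_pM//; exact: uL.
by rewrite normrM -mulrA ler_pM//; exact: uM.
Qed.

Let mpsi : measurable_fun setT (psi : brV -> R).
Proof. by apply: borel_continuous; exact: lip_continuous psi_lip. Qed.

Let mw i : measurable_fun setT (w i : brV -> R).
Proof. by apply: measurable_funM; [exact: mu_|exact: mpsi]. Qed.

Let w_int i : leb.-integrable setT (EFin \o (w i : lebT -> R)).
Proof.
apply: (@integrable_bounded_support _ _ _ (M * P) eps x (mw i)) => z.
  have [zx|/ltW zx] := leP (enorm (z - x)) eps.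
    by rewrite normrM ler_pM//; exact: uM.
  by rewrite /w psi_out// mulr0 normr0 mulr_ge0.
by move=> zx; rewrite /w psi_out// mulr0.
Qed.

Let h (k : nat) : R := k.+1%:R^-1.
Let h_gt0 k : 0 < h k. Proof. by rewrite invr_gt0. Qed.
Let h_le1 k : h k <= 1. Proof. by rewrite invf_le1// ler1n. Qed.

Let q k z : R := \sum_(i < n) (w i (h k *: e i + z) - w i z) / h k.

Let mq k : measurable_fun setT (q k : brV -> R).
Proof.
apply: measurable_sum => i; apply: measurable_funM => //.
apply: measurable_funB; last exact: mw.
exact: (measurableT_comp (mw i) (measurable_translate (h k *: e i))).
Qed.

Let q_int0 k : (\int[leb]_z (q k z)%:E = 0)%E.
Proof.
have iw i : leb.-integrable setT
    (fun z : lebT => (w i (h k *: e i + z))%:E).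
  apply: (@integrable_bounded_support _ _
    (fun z => w i (h k *: e i + z)) (M * P) (eps + h k) x).
  - exact: (measurableT_comp (mw i) (measurable_translate (h k *: e i))).
  - move=> z; have [zx|/ltW zx] := leP (enorm (h k *: e i + z - x)) eps.
      by rewrite normrM ler_pM//; exact: uM.
    by rewrite /w psi_out// mulr0 normr0 mulr_ge0.
  - move=> z zx; rewrite /w psi_out ?mulr0//.
    have := enormD (h k *: e i + z - x) (- (h k *: e i)).
    rewrite enormN enormZ enorm_e mulr1 gtr0_norm// [X in enorm X <= _](_ : _ = z - x).
      by move: zx; lra.
    by apply/rowP => j; rewrite !mxE; ring.
have term0 i : (\int[leb]_z ((w i (h k *: e i + z) - w i z) / h k)%:E = 0)%E.
  under eq_integral do rewrite mulrC EFinM EFinB.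
  have mwE : measurable_fun setT (EFin \o w i : brV -> \bar R).
    by apply/measurable_EFinP; exact: mw.
  have iB := integrableB measurableT (iw i) (w_int i).
  rewrite (integralZl measurableT iB) (integralB_EFin measurableT (iw i) (w_int i)).
  rewrite (integral_translate (h k *: e i) mwE).
  by rewrite subee ?mule0// (integrable_fin_num measurableT (w_int i)).
rewrite /q; under eq_integral do rewrite -sumEFin.
rewrite integral_sum//; first by rewrite big1// => i _; exact: term0.
move=> i; have := integrableZl (measurableT) (h k)^-1 (integrableB measurableT (iw i) (w_int i)).
apply: eq_integrable => // z _ /=.
by rewrite -EFinB -EFinM mulrC.
Qed.

Let C : R := L * P + M * K.
Let C_ge0 : 0 <= C. Proof. by rewrite addr_ge0// mulr_ge0. Qed.

Let q_bound k z : `|q k z| <= n%:R * C.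
Proof.
rewrite /q (le_trans (ler_norm_sum _ _ _))//.
apply: (@le_trans _ _ (\sum_(i < n) C)); last first.
  by rewrite sumr_const card_ord -[C *+ n]mulr_natl.
apply: ler_sum => i _; rewrite normrM normfV ler_pdivrMr ?normr_gt0 ?gt_eqF//.
rewrite (le_trans (w_lip i _ _))// ler_wpM2l//.
by rewrite addrK enormZ enorm_e mulr1.
Qed.

Let q_out k z : eps + 1 <= enorm (z - x) -> q k z = 0.
Proof.
move=> zx; rewrite /q big1// => i _; rewrite /w !psi_out ?mulr0 ?subrr ?mul0r//.
  by move: zx; lra.
have := enormD (h k *: e i + z - x) (- (h k *: e i)).
rewrite enormN enormZ enorm_e mulr1 gtr0_norm// [X in enorm X <= _](_ : _ = z - x).
  by have := h_le1 k; move: zx; lra.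
by apply/rowP => j; rewrite !mxE; ring.
Qed.

Let slope (z : 'rV[R]_n) : R := cutoff_slope n delta eps (enorm (z - x)).

Let slope_le z : `|slope z| <= K.
Proof. exact: cutoff_slope_le. Qed.

Let slope_out z : eps <= enorm (z - x) -> slope z = 0.
Proof. exact: cutoff_slope_out. Qed.

Let mslope : measurable_fun setT (slope : brV -> R).
Proof.
apply: (measurableT_comp (measurable_cutoff_slope n eps delta_gt0)).
by apply: borel_continuous; exact: continuous_enormB.
Qed.

(** Minus the scalar product of u with the gradient of psi, so that div (psi u) = F psi - flux. On
    the annulus it is u.(z - x) / |z - x|^n. *)
Definition flux (z : 'rV[R]_n) : R :=
  \sum_(i < n) u i z * (udir (z - x) 0 i * - slope z).

Let flux_out z : eps <= enorm (z - x) -> flux z = 0.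
Proof. by move=> ze; rewrite /flux big1// => i _; rewrite slope_out// oppr0 !mulr0. Qed.

Let udir_le (y : 'rV[R]_n) i : `|udir y 0 i| <= 1.
Proof.
have [->|y0] := eqVneq y 0; first by rewrite /udir scaler0 mxE normr0.
by rewrite (le_trans (coord_le_enorm _ _))// enorm_udir.
Qed.

Let flux_le z : `|flux z| <= n%:R * (M * K).
Proof.
have [zx|/ltW zx] := leP (enorm (z - x)) eps; last first.
  by rewrite flux_out// normr0 !mulr_ge0.
rewrite /flux (le_trans (ler_norm_sum _ _ _))//.
apply: (@le_trans _ _ (\sum_(i < n) (M * K))); last first.
  by rewrite sumr_const card_ord -[_ *+ n]mulr_natl.
apply: ler_sum => i _; rewrite normrM ler_pM ?uM//.
by rewrite normrM normrN -[K]mul1r ler_pM.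
Qed.

Lemma measurable_flux : measurable_fun setT (flux : brV -> R).
Proof.
apply: measurable_sum => i; apply: measurable_funM; first exact: mu_.
apply: measurable_funM; last by apply: measurableT_comp => //; exact: mslope.
apply: (eq_measurable_fun (fun z : brV => udir ((- x) + (z : 'rV[R]_n)) 0 i)).
  by move=> z _; rewrite addrC.
apply: (measurableT_comp (borel_coord i)).
by apply: (measurableT_comp (@measurable_udir R n)); exact: measurable_translate.
Qed.

(** The excluded points are the kinks of the norm and of the profile [cutoff]: the centre and two
    spheres, together a null set. *)
Let q_cvg z : z != x -> enorm (z - x) != delta -> enorm (z - x) != eps ->
  (eball x eps z -> (forall i, derivable (u i) z (delta_mx 0 i)) /\
  \sum_(i < n) 'D_(delta_mx 0 i) (u i) z = F z) ->
  q ^~ z @ \oo --> F z * psi z - flux z.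
Proof.
move=> zx zd ze duz.
have [lze|gze] := ltP (enorm (z - x)) eps; last first.
  rewrite psi_out// flux_out// mulr0 subr0.
  have ez : 0 < enorm (z - x) - eps by rewrite subr_gt0 lt_neqAle eq_sym ze.
  apply: cvg_near_cst; near=> k; rewrite /q big1// => i _.
  rewrite /w !psi_out ?mulr0 ?subrr ?mul0r//.
  have hk : h k < enorm (z - x) - eps.
    by near: k; exact: (near_infty_natSinv_lt (PosNum ez)).
  have := enormD (h k *: e i + z - x) (- (h k *: e i)).
  rewrite enormN enormZ enorm_e mulr1 gtr0_norm// [X in enorm X <= _](_ : _ = z - x).
    by move: hk; lra.
  by apply/rowP => j; rewrite !mxE; ring.
have {duz}[du duF] := duz lze.
rewrite -duF mulr_suml /flux -sumrB.
have -> : q ^~ z = (fun k => \sum_(i < n) (w i (h k *: e i + z) - w i z) / h k) by [].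
apply: cvg_sumr => i.
have zx0 : z - x != 0 by rewrite subr_eq0.
have d1 : is_derive (0 : R) 1 (fun t : R => u i (z + t *: e i)) ('D_(e i) (u i) z).
  by apply: is_derive_line; rewrite scale0r addr0//; exact: du.
have d2 := is_derive_enorm_line (e i) zx0.
have d3 : is_derive (enorm (z - x + (0 : R) *: e i)) 1 (cutoff n delta eps) (slope z).
  by rewrite scale0r addr0; exact: is_derive_cutoff.
have d4 := @is_derive1_comp R (cutoff n delta eps)
  (fun t : R => enorm (z - x + t *: e i)) 0 _ _ d3 d2.
have := derive_sequence (is_deriveM d1 d4).
rewrite scale0r !addr0/= scale0r !addr0.
have -> : edot (z - x) (e i) = (z - x) 0 i.
  rewrite /edot (bigD1 i)//= big1 => [|j ji]; first by rewrite !mxE !eqxx/= mulr1 addr0.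
  by rewrite !mxE eqxx/= (negbTE ji) mulr0.
have -> : 'D_(delta_mx 0 i) (u i) z * psi z - u i z * (udir (z - x) 0 i * - slope z)
    = u i z *: (slope z * ((z - x) 0 i / enorm (z - x)))
      + cutoff n delta eps (enorm (z - x)) *: 'D_(e i) (u i) z.
  rewrite [udir _ _ _]mxE /psi -[RHS]/(_ * _ + _ * _); ring.
apply: cvg_trans; apply: near_eq_cvg; near=> k.
rewrite /w /psi [h k *: _ + z]addrC (addrAC z).
by rewrite -[LHS]/((u i (z + _ *: _) * cutoff n delta eps (enorm (z - x + _ *: _)) -
  u i (z + _ *: _) * cutoff n delta eps (enorm (z - x + _ *: _))) / _) scale0r !addr0.
Unshelve. all: by end_near. Qed.

Let Fpsi_int : leb.-integrable setT (fun z : lebT => (F z * psi z)%:E).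
Proof.
apply: (@integrable_bounded_support _ _ (fun z => F z * psi z) (MF * P) eps x).
- by apply: measurable_funM; [exact: mF|exact: mpsi].
- by move=> z; rewrite normrM ler_pM.
- by move=> z zx; rewrite psi_out// mulr0.
Qed.

Let flux_int : leb.-integrable setT (fun z : lebT => (flux z)%:E).
Proof.
exact: (integrable_bounded_support measurable_flux flux_le flux_out).
Qed.

Lemma integral_flux :
  (\int[leb]_z (F z * cutoff n delta eps (enorm (z - x)))%:E =
   \int[leb]_z (flux z)%:E)%E.
Proof.
pose G (z : lebT) := ((F z * psi z)%:E - (flux z)%:E)%E.
(* Dominating function: every quotient is bounded by n C and, the increments being at most 1,
   vanishes at distance eps + 1 and beyond. *)
pose B (z : brV) : R := (n%:R * C) * \1_(eball x (eps + 1) : set brV) z.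
have mB : measurable_fun setT B.
  apply: measurable_funM => //; apply: measurable_indic; exact: borel_eball.
have BB : leb.-integrable setT (EFin \o (B : lebT -> R)).
  apply: (@integrable_bounded_support _ _ B (n%:R * C) (eps + 1) x) => // z.
    rewrite /B normrM ger0_norm ?mulr_ge0// -[X in _ <= X]mulr1 ler_wpM2l ?mulr_ge0//.
    by rewrite indicE; case: (_ \in _); rewrite ?normr1 ?normr0.
  by move=> zx; rewrite /B indicE memNset ?mulr0// /eball/= ltNge zx.
have [|||||_ _] := @dominated_convergence _ lebT R leb setT measurableT
  (fun k z => (q k z)%:E) G (EFin \o (B : lebT -> R)).
- by move=> k; apply/measurable_EFinP; apply: measurable_borel_lebesgue; exact: mq.
- by apply: emeasurable_funB; apply: measurable_int; [exact: Fpsi_int|exact: flux_int].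
- have nz (A : set lebT) : measurable A -> leb A = 0%E -> {ae leb, forall z, ~ A z}.
    by move=> mA A0; exists A; split=> // z /= /contrapT.
  have n0 : (0 < n)%N by exact: ltnW.
  have a1 := nz _ (borel_lebesgue (@borel_set1 R n x)) (lebesgue_set1 n0 x).
  have a2 := nz _ (borel_lebesgue (@borel_esphere R n x delta)) (lebesgue_esphere n_gt1 x delta).
  have a3 := nz _ (borel_lebesgue (@borel_esphere R n x eps)) (lebesgue_esphere n_gt1 x eps).
  apply: filterS (filterI (filterI a1 a2) (filterI a3 div_u)) => z [[/= z1 z2] [z3 zu]] _.
  rewrite /G -EFinB; apply: cvg_EFin; first by apply: nearW.
  by apply: q_cvg => //; apply/eqP.
- exact: BB.
- apply: aeW => z k _ /=; rewrite lee_fin /B indicE.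
  have [zr|zr] := ltP (enorm (z - x)) (eps + 1); first by rewrite mem_set// mulr1.
  by rewrite q_out// normr0 memNset ?mulr0// /eball/= ltNge zr.
under eq_fun do rewrite q_int0.
move=> /(cvg_unique _ (@cvg_cst _ _ _ _ _)).
rewrite /G (integralB_EFin measurableT Fpsi_int flux_int).
have := integrable_fin_num measurableT flux_int.
have := integrable_fin_num measurableT Fpsi_int.
rewrite -/psi; case: (\int[leb]_z (F z * psi z)%:E)%E => // a _.
case: (\int[leb]_z (flux z)%:E)%E => // b _.
move=> /(_ (@ereal_hausdorff R))/esym/eqP.
by rewrite -EFinB eqe subr_eq0 => /eqP ->.
Qed.

End integration_by_parts.

(** * Potentials and averages *)

Section completed_lebesgue.
Context (R : realType).
Local Notation mu1 := (@lebesgue_measure R).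
Local Notation cmu := (@completed_lebesgue_measure R).
Local Notation RT := (measurableTypeR R).

Definition completed_type : measurableType _ :=
  caratheodory_type ((wlength (@idfun R))^*)%mu.

Lemma measurable_completed : measurable_fun setT (idfun : completed_type -> RT).
Proof.
by move=> _ A mA; rewrite setTI preimage_id; exact: sub_caratheodory.
Qed.

Lemma completed_integral (D : set R) (g : RT -> \bar R) :
  measurable (D : set RT) -> measurable_fun setT g ->
  (\int[cmu]_(r in D) g r = \int[mu1]_(r in D) g r)%E.
Proof.
move=> mD mg; rewrite [LHS]integral_mkcond [RHS]integral_mkcond.
have mgD : measurable_fun setT (g \_ (D : set RT)).
  by apply/(measurable_restrictT _ mD); exact: measurable_funTS.
rewrite -[LHS](integral_image cmu measurable_completed mgD).
by apply: eq_measure_integral => A mA _.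
Qed.

(** In the completion, h is measurable as soon as it agrees almost everywhere with a Borel function.
    This is what is known of the spherical averages of f, which are identified only at almost every
    radius. *)
Lemma completed_Rintegral_ae (D : set R) (h g : R -> R) :
  measurable (D : set RT) -> measurable_fun setT (g : RT -> R) ->
  {ae mu1, forall r, D r -> h r = g r} ->
  \int[cmu]_(r in D) h r = \int[mu1]_(r in D) g r.
Proof.
move=> mD mg hg.
have mgE : measurable_fun setT (EFin \o g : RT -> \bar R).
  exact/measurable_EFinP.
rewrite /Rintegral -(completed_integral mD mgE); congr fine.
have mD' : measurable (D : set completed_type) by exact: sub_caratheodory.
have mg' : measurable_fun (D : set completed_type) (EFin \o g).
  apply: measurable_funTS.
  exact: (measurableT_comp mgE measurable_completed).
have hg' : ae_eq cmu D (EFin \o g) (EFin \o h).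
  have [A [mA A0 hA]] := hg; exists A; split=> [||r /= Hr]; [|exact: A0|].
    exact: sub_caratheodory.
  by apply: hA => /= Hr'; apply: Hr => Dr; rewrite /= Hr'.
have mh : measurable_fun (D : set completed_type) (EFin \o h).
  by apply: (ae_measurable_fun _ hg' mg'); exact: completed_lebesgue_measure_is_complete.
exact: (esym (ae_eq_integral _ _ mD' mg' mh hg')).
Qed.

End completed_lebesgue.

Section sphere_mean.
Context (R : realType) (n : nat).
Hypothesis n_gt1 : (1 < n)%N.
Local Notation brV := (borel_rV R n).
Local Notation RT := (measurableTypeR R).
Local Notation leb := (@lebesgue_rV R n).
Local Notation lebT := (lebesgue_type R n).
Local Notation vol := (unit_vol R n).
Local Notation B' := (@punctured_ball R n).
Local Notation mu1 := (@lebesgue_measure R).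
Local Notation w := (@radial_weight R n).
Local Notation angular_sf := (sigma_finite_measure_of (angular_sigma_finite R n_gt1)).

Let n_gt0 : (0 < n)%N. Proof. exact: ltnW. Qed.
Let vol_gt0 : 0 < vol. Proof. exact: unit_vol_gt0. Qed.

(** For Borel g and s > 0 this is [sphere_avg], by [sphere_avg_borel]. As an integral over a fixed
    set it is defined for every real s, and Fubini gives its measurability in s. *)
Definition sphere_mean (g : 'rV[R]_n -> R) x s : R :=
  (\int[leb]_(y in B') g (sphere_proj x s y)) / vol.

Let mB' : measurable (B' : set lebT). Proof. exact: measurable_punctured_ball. Qed.

Let ball_vol : leb B' = vol%:E. Proof. exact: lebesgue_punctured_ball. Qed.

Let ball_lty : (leb B' < +oo)%E. Proof. by rewrite ball_vol ltry. Qed.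

Let cst_int (b : R) : leb.-integrable B' (EFin \o cst b).
Proof.
exact: (bounded_integrable mB' ball_lty (measurable_cst b) (fun y _ => lexx `|b|)).
Qed.

Lemma sphere_mean_cst (c : R) x s : sphere_mean (cst c : 'rV[R]_n -> R) x s = c.
Proof.
rewrite /sphere_mean Rintegral_cst; last exact: measurable_punctured_ball.
rewrite -[fine _]/(fine (leb (@punctured_ball R n))) lebesgue_punctured_ball//=.
by rewrite mulfK// gt_eqF.
Qed.

Variables (x : 'rV[R]_n) (g : 'rV[R]_n -> R) (M : R).
Hypotheses (mg : measurable_fun setT (g : brV -> R)) (gM : forall z, `|g z| <= M).

Lemma sphere_proj_integrable s :
  leb.-integrable B' (fun y => (g (sphere_proj x s y))%:E).
Proof.
have mgs : measurable_fun (B' : set lebT) (fun y : lebT => g (sphere_proj x s y)).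
  apply: measurable_funTS.
  exact: (measurableT_comp mg (@measurable_sphere_proj R n x s)).
exact: (bounded_integrable mB' ball_lty mgs (fun y _ => gM (sphere_proj x s y))).
Qed.

Lemma sphere_meanE s :
  (\int[leb]_(y in B') (g (sphere_proj x s y))%:E = (vol * sphere_mean g x s)%:E)%E.
Proof.
rewrite /sphere_mean mulrC divfK ?gt_eqF// /Rintegral fineK//.
exact: (integrable_fin_num mB' (sphere_proj_integrable s)).
Qed.

Lemma sphere_mean_near (c C s : R) :
  (forall z, enorm (z - x) = `|s| -> `|g z - c| <= C) -> `|sphere_mean g x s - c| <= C.
Proof.
move=> gC; have ig := sphere_proj_integrable s.
have C_int (b : R) : \int[leb]_(y in B') cst b y = b * vol.
  by rewrite Rintegral_cst// -[X in _ * fine X]/(leb B') ball_vol.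
rewrite -(ler_pM2r vol_gt0) -{1}(gtr0_norm vol_gt0) -normrM mulrBl.
rewrite /sphere_mean divfK ?gt_eqF// -!C_int -(RintegralB mB' ig (cst_int c)).
have ib := integrableB mB' ig (cst_int c).
apply: (le_trans (le_normr_Rintegral mB' ib)).
apply: (le_Rintegral mB' (integrable_norm ib) (cst_int C)) => y [_ y0].
apply: gC; rewrite /sphere_proj addrAC subrr add0r enormZ enorm_udir ?mulr1//.
exact/eqP.
Qed.

Lemma sphere_mean_le s : `|sphere_mean g x s| <= M.
Proof. by rewrite -[X in `|X|]subr0; apply: sphere_mean_near => z _; rewrite subr0. Qed.

Lemma measurable_sphere_mean : measurable_fun setT (sphere_mean g x : RT -> R).
Proof.
pose G (p : RT * brV) : R := g (x + (p.1 : R) *: udir (p.2 : 'rV[R]_n)).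
have mG : measurable_fun setT G.
  apply: (measurableT_comp mg); apply: measurable_affine => //.
  exact: (measurableT_comp (@measurable_udir R n) measurable_snd).
(* Adding M makes the integrand nonnegative, as Tonelli's theorem asks; M is subtracted again from
   the mean. *)
have mGM : measurable_fun setT (fun p => (G p + M)%:E).
  by apply/measurable_EFinP; exact: measurable_funD.
have GM0 p : (0 <= (G p + M)%:E)%E.
  by rewrite lee_fin; have := gM (x + (p.1 : R) *: udir (p.2 : 'rV[R]_n));
    rewrite ler_norml /G; lra.
have mF := @measurable_fun_fubini_tonelli_F _ _ _ _ _ angular_sf _ mGM GM0.
apply: (eq_measurable_fun (fun s : RT =>
  fine (fubini_F angular_sf (fun p => (G p + M)%:E) s) / vol - M)).
  move=> s _; rewrite /fubini_F integral_angular//; last first.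
    exact: (measurableT_comp mGM (pair1_measurable s)).
  have -> : (\int[leb]_(y in B') (G (s, udir y) + M)%:E =
      (vol * sphere_mean g x s + vol * M)%:E)%E.
    rewrite EFinD -sphere_meanE.
    have -> : (vol * M)%:E = (\int[leb]_(y in B') (cst M%:E) y)%E.
      by rewrite integral_cst// -[X in (_ = _ * X)%E]/(leb B') ball_vol -EFinM mulrC.
    rewrite -(integralD mB' (sphere_proj_integrable s) (cst_int M)).
    apply: eq_integral => y _; rewrite -EFinD /G /sphere_proj/=.
    by rewrite udir_udir.
  by rewrite /= -mulrDr mulrAC divff ?gt_eqF// mul1r addrK.
apply: measurable_funB => //; apply: measurable_funM => //.
exact: (measurableT_comp _ mF).
Qed.

Lemma integral_sphere_mean (k : R -> R) (K b : R) :
  measurable_fun setT (k : RT -> R) -> (forall s, `|k s| <= K) ->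
  (forall s, b <= s -> k s = 0) ->
  (\int[leb]_z (g z * k (enorm (z - x)))%:E =
   \int[mu1]_s (vol * sphere_mean g x s * k s * w s)%:E)%E.
Proof.
move=> mk kK k0.
pose G (p : RT * brV) : R := g (x + (p.1 : R) *: (p.2 : 'rV[R]_n)) * k p.1.
have mG : measurable_fun setT G.
  apply: measurable_funM; last exact: (measurableT_comp mk measurable_fst).
  apply: (measurableT_comp mg); exact: measurable_affine.
have GM p : `|G p| <= M * K by rewrite normrM ler_pM.
have G0 s t : b <= s -> G (s, t) = 0 by move=> bs; rewrite /G/= k0// mulr0.
rewrite -(integral_translate x (f := fun z => (g z * k (enorm (z - x)))%:E)).
  have := polar_bounded1 n_gt1 mG GM G0.
  have -> : (\int[leb]_y (G (polar_map y))%:E =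
      \int[leb]_z (g (x + z) * k (enorm (x + z - x)))%:E)%E.
    apply: eq_integral => y _; rewrite /G /polar_map/= scale_udir.
    by rewrite addrAC subrr add0r.
  move=> ->; apply: eq_integral => s _.
  rewrite (EFinM (_ * k s)) (EFinM (vol * _)) -sphere_meanE.
  congr (_ * _)%E; rewrite muleC -(integralZl mB' (sphere_proj_integrable s)).
  by apply: eq_integral => y _; rewrite /G/= -EFinM mulrC.
apply/measurable_EFinP; apply: measurable_funM => //.
apply: (measurableT_comp mk).
by apply: borel_continuous; exact: continuous_enormB.
Qed.

End sphere_mean.

(** * The potential and the two radial integrals *)

Section potential.
Context (R : realType) (n : nat).
Hypothesis n_gt1 : (1 < n)%N.
Local Notation brV := (borel_rV R n).
Local Notation RT := (measurableTypeR R).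
Local Notation leb := (@lebesgue_rV R n).
Local Notation vol := (unit_vol R n).
Local Notation mu1 := (@lebesgue_measure R).
Local Notation w := (@radial_weight R n).

Let n_gt0 : (0 < n)%N. Proof. exact: ltnW. Qed.
Let vol_gt0 : 0 < vol. Proof. exact: unit_vol_gt0. Qed.

Lemma integrable_itv_support (h : R -> R) (C a b : R) :
  measurable_fun setT (h : RT -> R) -> (forall s, a <= s <= b -> `|h s| <= C) ->
  (forall s, ~~ (a <= s <= b) -> h s = 0) -> mu1.-integrable setT (EFin \o h).
Proof.
move=> mh hC h0.
have -> : EFin \o h = (EFin \o h) \_ `[a, b].
  apply/funext => s; rewrite patchE; case: ifPn => // /negP sab.
  rewrite /= h0//; apply/negP => sab'; apply: sab.
  by apply/mem_set; rewrite /= in_itv.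
have mI : measurable (`[a, b]%classic : set RT) by exact: measurable_itv.
apply: (iffLR (integrable_mkcond (EFin \o h : RT -> \bar R) mI)).
apply: (@bounded_integrable _ _ _ mu1 `[a, b]%classic h C) => //.
- rewrite -[X in (X < _)%E]/(@lebesgue_measure R [set` `[a, b]]) lebesgue_measure_itv/=.
  by case: ifPn => // _; rewrite ltry.
- exact: measurable_funTS.
Qed.

(* The kernel of the statement, extended by 0 to the whole line. *)
Definition kern (eps s : R) : R :=
  if 0 < s < eps then s ^+ n.-1 * (lam n eps - lam n s) else 0.

Lemma kernE eps s : 0 < s < eps -> kern eps s = mean_kernel n eps s.
Proof.
move=> /[dup] se /andP[s0 se']; rewrite /kern se mean_kernelE//.
exact: lt_trans se'.
Qed.

(** The mean value theorem gives lam eps - lam s <= s^(1-n) (eps - s), so the weight s^(n-1) absorbs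
    the singularity at 0. *)
Lemma kern_le eps s : 0 < eps -> `|kern eps s| <= eps.
Proof.
move=> e0; rewrite /kern; case: ifPn => [/andP[s0 se]|_]; last by rewrite normr0 ltW.
have sn : 0 < s ^+ n.-1 by rewrite exprn_gt0.
rewrite normrM gtr0_norm// mulrC -ler_pdivlMr//.
rewrite (le_trans (lam_lipschitz n_gt1 s0 (ltW se) (lexx s)))//.
rewrite mulrC ler_pM2r ?invr_gt0// ger0_norm ?subr_ge0 ?(ltW se)//.
by rewrite gerBl ltW.
Qed.

Lemma measurable_lam : measurable_fun (`]0%R, +oo[%classic : set RT) (lam n : RT -> R).
Proof.
rewrite /lam; case: eqP => _; first by apply: measurable_funTS; exact: measurable_ln.
apply: (eq_measurable_fun (fun s : RT => - (n - 2)%:R^-1 * (s ^+ (n - 2)) `^ (-1))).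
  move=> s /set_mem/=; rewrite in_itv/= andbT => s0.
  by rewrite powR_inv1// exprn_ge0// ltW.
apply: measurable_funTS; apply: measurable_funM => //.
by apply: (measurableT_comp (measurable_powR (-1))); exact: measurable_funX.
Qed.

Lemma measurable_kern eps : measurable_fun setT (kern eps : RT -> R).
Proof.
have -> : kern eps = (fun s => s ^+ n.-1 * (lam n eps - lam n s)) \_ `]0, eps[.
  by apply/funext => s; rewrite patchE mem_setE in_itv.
apply/(measurable_restrictT _ (measurable_itv _)).
apply: measurable_funM; first exact: measurable_funX.
apply: measurable_funB => //; apply: measurable_funS measurable_lam => //.
by move=> s; rewrite /= !in_itv/= andbT => /andP[].
Qed.

(** The common value of the mean value difference and of both integrals of the statement. The
    integral runs over the whole line, as [kern] vanishes off ]0, eps[. *)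
Definition potential (g : 'rV[R]_n -> R) x eps : R :=
  \int[mu1]_s (sphere_mean g x s * kern eps s).

Variables (x : 'rV[R]_n) (g : 'rV[R]_n -> R) (M eps : R).
Hypotheses (mg : measurable_fun setT (g : brV -> R)) (gM : forall z, `|g z| <= M).
Hypothesis eps_gt0 : 0 < eps.
Local Notation sm := (sphere_mean g x).

Let M_ge0 : 0 <= M. Proof. exact: le_trans (gM 0). Qed.
Let msm : measurable_fun setT (sm : RT -> R).
Proof. exact: (measurable_sphere_mean n_gt1 x mg gM). Qed.
Let smM s : `|sm s| <= M.
Proof. exact: (sphere_mean_le n_gt1 x mg gM). Qed.

Lemma potential_integrable :
  mu1.-integrable setT (fun s => (sm s * kern eps s)%:E).
Proof.
apply: (@integrable_itv_support (fun s => sm s * kern eps s) (M * eps) 0 eps).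
- by apply: measurable_funM => //; exact: measurable_kern.
- by move=> s _; rewrite normrM ler_pM// kern_le.
- move=> s; rewrite /kern; case: ifPn => [/andP[s0 se]|_]; last by rewrite mulr0.
  by rewrite (ltW s0) (ltW se).
Qed.

Lemma sphere_int_potential (f : 'rV[R]_n -> R) :
  {ae mu1, forall s, 0 < s < eps -> sphere_avg f x s = sm s} ->
  sphere_int f x eps = potential g x eps.
Proof.
move=> [A [mA A0 fA]].
rewrite /sphere_int (@completed_Rintegral_ae _ _ _ (fun s => sm s * kern eps s)).
- rewrite Rintegral_mkcond /potential; apply: eq_Rintegral => s _.
  rewrite patchE; case: ifPn => // /negP sne.
  rewrite /kern; case: ifPn => [/andP[s0 se]|_]; last by rewrite mulr0.
  by exfalso; apply: sne; rewrite mem_setE in_itv/= !ltW.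
- exact: measurable_itv.
- by apply: measurable_funM => //; exact: measurable_kern.
(* The hypothesis says nothing at the endpoints 0 and eps, which form a null set. *)
- have m2 : measurable ([set 0; eps] : set RT) by apply: measurableU.
  have nA : mu1.-negligible A by exists A; split.
  have n2 : mu1.-negligible [set 0; eps].
    exists [set 0; eps]; split=> //.
    by apply: countable_lebesgue_measure0; apply: finite_set_countable.
  apply: negligibleS (negligibleU nA n2).
  move=> s /= H; have [->|s0] := eqVneq s 0; [by right; left|].
  have [->|se] := eqVneq s eps; [by right; right|left].
  apply: fA => fs; apply: H; rewrite in_itv/= => /andP[s0' se'].
  have se2 : 0 < s < eps by rewrite !lt_neqAle eq_sym s0 se se' s0'.
  by rewrite -kernE// fs.
Qed.

(** Integrated in s it gives the ball average times r / n ([section1]); integrated in r it gives the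
    spherical mean times the kernel ([section2]). It is bounded by M because s < r. *)
Let T (p : RT * RT) : R :=
  if (0 < p.2) && ((p.2 < p.1) && (p.1 <= eps)) then
    sm p.2 * (p.2 ^+ n.-1 * (p.1 ^+ n.-1) `^ (-1)) else 0.

Let mT : measurable_fun setT T.
Proof.
apply: measurable_fun_ifT => //.
  apply: measurable_and; first exact: measurable_fun_ltr.
  apply: measurable_and; first exact: measurable_fun_ltr.
  exact: measurable_fun_ler.
apply: measurable_funM; first exact: (measurableT_comp msm measurable_snd).
apply: measurable_funM; first by apply: measurable_funX.
by apply: (measurableT_comp (measurable_powR (-1))); exact: measurable_funX.
Qed.

Let TM p : `|T p| <= M.
Proof.
rewrite /T; case: ifPn => [/and3P[s0 sr re]|_]; last by rewrite normr0.
have r0 : 0 < p.1 by exact: lt_trans sr.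
rewrite normrM -[M]mulr1 ler_pM// powR_inv1 ?exprn_ge0 ?(ltW r0)//.
rewrite ger0_norm ?divr_ge0 ?exprn_ge0 ?(ltW r0) ?(ltW s0)//.
rewrite ler_pdivrMr ?exprn_gt0// mul1r.
by rewrite lerXn2r ?nnegrE ?ltW.
Qed.

Let T_int : (mu1 \x mu1)%E.-integrable setT (EFin \o T).
Proof.
pose A : set (RT * RT) := `[0, eps]%classic `*` `[0, eps]%classic.
have mA : measurable A by exact: measurableX.
have -> : EFin \o T = (EFin \o T) \_ A.
  apply/funext => -[r s]; rewrite patchE; case: ifPn => // /negP nA.
  rewrite /T/=; case: ifPn => // /and3P[s0 sr re]; exfalso; apply: nA.
  apply/mem_set; rewrite /A/= !in_itv/= re (ltW s0) (le_trans (ltW sr))//.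
  by rewrite (ltW (lt_trans s0 sr)).
apply: (iffLR (integrable_mkcond _ mA)).
have Aoo : ((mu1 \x mu1) A < +oo)%E.
  rewrite product_measure1E//= -[X in (X * X < _)%E]/(@lebesgue_measure R [set` `[0, eps]]).
  by rewrite lebesgue_measure_itv/= lte_fin eps_gt0 -EFinB -EFinM ltry.
apply: (@bounded_integrable _ _ _ _ A T M) => //.
exact: measurable_funTS.
Qed.

Let section1 (r : R) : 0 <= r <= eps ->
  (\int[mu1]_s (T (r, s))%:E = (ball_avg g x r * (r / n%:R))%:E)%E.
Proof.
move=> /andP[]; rewrite le_eqVlt => /predU1P[<-|r0] re.
  rewrite mul0r mulr0 integral0_eq// => s _; rewrite /T/=.
  by case: ifPn => // /and3P[s0 /(lt_trans s0)]; rewrite ltxx.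
pose k (s : R) : R := if s < r then 1 else 0.
have mk : measurable_fun setT (k : RT -> R).
  by apply: measurable_fun_ifT => //; exact: measurable_fun_ltr.
have k1 s : `|k s| <= 1 by rewrite /k; case: ifP => _; rewrite ?normr1 ?normr0.
have k0 s : r <= s -> k s = 0 by move=> rs; rewrite /k ltNge rs.
have := integral_sphere_mean n_gt1 x mg gM mk k1 k0.
have -> : (\int[leb]_z (g z * k (enorm (z - x)))%:E =
    \int[leb]_(z in eball x r) (g z)%:E)%E.
  rewrite [RHS]integral_mkcond; apply: eq_integral => z _.
  rewrite patchE /k; have [zr|zr] := ltP (enorm (z - x)) r.
    by rewrite mem_set ?mulr1.
  by rewrite memNset ?mulr0// /eball/= ltNge zr.
pose h (s : R) := vol * sm s * k s * w s.
rewrite -[X in _ = X -> _]/(\int[mu1]_s (h s)%:E)%E => E.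
have r0n : 0 < r ^+ n.-1 by rewrite exprn_gt0.
have ih : mu1.-integrable setT (EFin \o h).
  apply: (@integrable_itv_support h (vol * M * (n%:R * r ^+ n.-1)) 0 r).
  - apply: measurable_funM; last exact: measurable_radial_weight.
    by apply: measurable_funM => //; exact: measurable_funM.
  - move=> s /andP[s0 sr]; rewrite /h -mulrA normrM ler_pM//.
      by rewrite normrM gtr0_norm// ler_pM2l.
    rewrite normrM -[X in _ <= X]mul1r ler_pM// radial_weight_pos//.
    rewrite ger0_norm ?mulr_ge0 ?exprn_ge0// ler_pM2l ?ltr0n//.
    by rewrite lerXn2r ?nnegrE// ltW.
  - move=> s; rewrite negb_and -!ltNge => /orP[s0|sr]; rewrite /h.
      by rewrite radial_weight_neg ?mulr0// ltW.
    by rewrite k0 ?mulr0 ?mul0r// ltW.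
have n0 : 0 < n%:R :> R by rewrite ltr0n.
(* [h] is the polar form of the integral over the ball, with factor vol and weight n s^(n-1);
   division by n vol r^(n-1) leaves T. *)
have -> : (\int[mu1]_s (T (r, s))%:E =
    \int[mu1]_s ((vol * n%:R * r ^+ n.-1)^-1%:E * (h s)%:E))%E.
  apply: eq_integral => s _; rewrite -EFinM /T /h /k/= re andbT; congr EFin.
  have [s0|s0] := ltP 0 s; last by rewrite radial_weight_neg// !mulr0.
  rewrite andTb; case: ifP => _; last by rewrite mulr0 mul0r mulr0.
  rewrite radial_weight_pos ?(ltW s0)// powR_inv1 ?exprn_ge0 ?(ltW r0)//.
  by field; rewrite !gt_eqF.
rewrite integralZl// -E /ball_avg /Rintegral (lebesgue_eball _ r0)/=.
have : (\int[leb]_(z in eball x r) (g z)%:E)%E \is a fin_num.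
  by rewrite E; apply: (integrable_fin_num measurableT ih).
case: (\int[leb]_(z in eball x r) (g z)%:E)%E => // a _.
rewrite -EFinM; congr EFin; rewrite -[in X in _ = _ / (_ * X) * _](prednK n_gt0) exprS /=.
by field; rewrite !gt_eqF.
Qed.

Let section2 (s : R) : (\int[mu1]_r (T (r, s))%:E = (sm s * kern eps s)%:E)%E.
Proof.
rewrite /kern; case: ifPn => [/andP[s0 se]|ns]; last first.
  rewrite mulr0 integral0_eq// => r _; rewrite /T/=; case: ifPn => // /and3P[s0 sr re].
  by exfalso; move: ns; rewrite s0 (lt_le_trans sr re).
pose c := sm s * s ^+ n.-1.
pose h (r : R) : R := c * (r ^+ n.-1) `^ (-1).
have mh : measurable_fun setT (fun r : RT => (h r)%:E).
  apply/measurable_EFinP; apply: measurable_funM => //.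
  by apply: (measurableT_comp (measurable_powR (-1))); exact: measurable_funX.
have -> : (\int[mu1]_r (T (r, s))%:E = \int[mu1]_(r in `]s, eps]) (h r)%:E)%E.
  rewrite [RHS]integral_mkcond; apply: eq_integral => r _.
  rewrite patchE mem_setE in_itv /T/= s0/=.
  by case: ifP => // _; rewrite /h /c mulrA.
rewrite integral_itv_obnd_cbnd; last exact: measurable_funTS.
have pos r : s <= r <= eps -> 0 < r by move=> /andP[sr _]; exact: lt_le_trans sr.
under eq_integral => r /set_mem /=.
  rewrite in_itv/= => /pos r0; rewrite /h powR_inv1 ?exprn_ge0 ?(ltW r0)//.
  over.
have dF r : s <= r <= eps -> is_derive r 1 (fun r => c * lam n r) (c * r ^- n.-1).
  by move=> /pos r0; exact: (is_deriveZ c (is_derive_lam n_gt1 r0)).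
have cf r : s <= r <= eps -> {for r, continuous (fun r : R => c * r ^- n.-1)}.
  move=> /pos r0; apply: cvgM; first exact: cvg_cst.
  by apply: cvgV; [rewrite expf_neq0// gt_eqF|exact: exprn_continuous].
by rewrite (integral_derive se dF cf); congr EFin; rewrite /c; ring.
Qed.

Lemma ball_int_potential : ball_int g x eps = potential g x eps.
Proof.
have F0 := Fubini T_int.
have mF := measurable_fubini_F T_int.
rewrite /ball_int (@completed_Rintegral_ae _ _ _ (fun r => fine (fubini_F mu1 (EFin \o T) r))).
- rewrite Rintegral_mkcond /potential /Rintegral.
  under [in RHS]eq_integral do rewrite -section2.
  rewrite -F0; congr fine; apply: eq_integral => r _.
  rewrite -[RHS]/(fubini_F mu1 (EFin \o T) r) /= patchE.
  rewrite /fubini_F mem_setE in_itv/=; case: ifPn => [r0e|nr].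
    by rewrite /= section1.
  have T0 s : T (r, s) = 0.
    rewrite /T/=; case: ifP => [/and3P[s0 sr re]|_]; last by [].
    by exfalso; move: nr; rewrite re (ltW (lt_trans s0 sr)).
  by under eq_integral do rewrite /= T0; rewrite integral0.
- exact: measurable_itv.
- exact: (measurableT_comp _ mF).
- apply: aeW => r /=; rewrite in_itv/= => r0e.
  by rewrite /fubini_F /= section1.
Qed.

End potential.

Section potential_bounds.
Context (R : realType) (n : nat).
Hypothesis n_gt1 : (1 < n)%N.
Local Notation brV := (borel_rV R n).
Local Notation leb := (@lebesgue_rV R n).
Local Notation vol := (unit_vol R n).
Local Notation mu1 := (@lebesgue_measure R).

Let n_gt0 : (0 < n)%N. Proof. exact: ltnW. Qed.
Let vol_gt0 : 0 < vol. Proof. exact: unit_vol_gt0. Qed.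
Let n0 : 0 < n%:R :> R. Proof. by rewrite ltr0n. Qed.

Lemma kern_ge0 (eps s : R) : 0 <= kern n eps s.
Proof.
rewrite /kern; case: ifPn => // /andP[s0 se].
by rewrite mulr_ge0 ?exprn_ge0 ?(ltW s0)// subr_ge0 (lam_le n_gt1)// ltW.
Qed.

Lemma integral_id_div (eps : R) : 0 < eps ->
  (\int[mu1]_(r in `[0%R, eps]) (r / n%:R)%:E = (eps ^+ 2 / (2 * n%:R))%:E)%E.
Proof.
move=> e0.
have dF (r : R) : is_derive r 1 (fun r : R => (2 * n%:R)^-1 * r ^+ 2) (r / n%:R).
  have dX : is_derive r 1 (fun t : R => t ^+ 2) (2%:R * r ^+ 1).
    apply: DeriveDef; first exact: exprn_derivable.
    by rewrite exp_derive -[LHS]/(_ * _ * 1) mulr1.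
  apply: (is_derive_eq (is_deriveZ (2 * n%:R)^-1 dX)).
  by rewrite expr1 -[LHS]/(_ * (_ * _)); field; rewrite gt_eqF.
have cf (r : R) : {for r, continuous (fun r : R => r / n%:R)}.
  by apply: cvgM; [exact: cvg_id|exact: cvg_cst].
rewrite (integral_derive e0 (fun r _ => dF r) (fun r _ => cf r)).
by congr EFin; rewrite expr0n/= mulr0 subr0 mulrC.
Qed.

(** This is the potential of the constant 1, evaluated through its ball averages, which equal 1. *)
Lemma integral_kern (eps : R) : 0 < eps ->
  \int[mu1]_s kern n eps s = eps ^+ 2 / (2 * n%:R).
Proof.
move=> e0.
have mc : measurable_fun setT (cst 1 : brV -> R) by exact: measurable_cst.
have c1 (z : 'rV[R]_n) : `|cst 1 z : R| <= 1 by rewrite normr1.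
have := ball_int_potential n_gt1 0 mc c1 e0.
rewrite /potential; under eq_Rintegral do rewrite (sphere_mean_cst n_gt1) mul1r.
move=> <-; rewrite /ball_int (@completed_Rintegral_ae _ _ _ (fun r => r / n%:R)).
- by rewrite /Rintegral integral_id_div.
- exact: measurable_itv.
- exact: measurable_funM.
- apply: aeW => r /=; rewrite in_itv/= => /andP[]; rewrite le_eqVlt => /predU1P[<-|r0] _.
    by rewrite mul0r mulr0.
  rewrite /ball_avg Rintegral_cst; last by apply: borel_lebesgue; exact: borel_eball.
  rewrite -[X in _ * fine X]/(leb (eball 0 r)) mul1r divff ?mul1r// lebesgue_eball//=.
  by rewrite mulf_neq0 ?gt_eqF// exprn_gt0.
Qed.

Variables (x : 'rV[R]_n) (g : 'rV[R]_n -> R) (M eps : R).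
Hypotheses (mg : measurable_fun setT (g : brV -> R)) (gM : forall z, `|g z| <= M).
Hypothesis eps_gt0 : 0 < eps.

Let kern_int : mu1.-integrable setT (fun s => (kern n eps s)%:E).
Proof.
apply: (@integrable_itv_support _ (kern n eps) eps 0 eps).
- exact: measurable_kern.
- by move=> s _; exact: kern_le.
- move=> s; rewrite /kern; case: ifPn => [/andP[s0 se]|//].
  by rewrite (ltW s0) (ltW se).
Qed.

Lemma potential_le : `|potential g x eps| <= M * (eps ^+ 2 / (2 * n%:R)).
Proof.
have ip := potential_integrable n_gt1 x mg gM eps_gt0.
rewrite /potential -(integral_kern eps_gt0).
rewrite -(RintegralZl _ measurableT kern_int).
apply: (le_trans (le_normr_Rintegral measurableT ip)).
apply: le_Rintegral => //.
- exact: (integrable_norm ip).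
- exact: (integrableZl measurableT M kern_int).
- move=> s _; rewrite normrM (ger0_norm (kern_ge0 _ _)) ler_wpM2r ?kern_ge0//.
  exact: (sphere_mean_le n_gt1 x mg gM).
Qed.

Lemma potential_subr c :
  potential (fun z => g z - c) x eps = potential g x eps - c * (eps ^+ 2 / (2 * n%:R)).
Proof.
have ip := potential_integrable n_gt1 x mg gM eps_gt0.
have ic := integrableZl measurableT c kern_int.
rewrite /potential -(integral_kern eps_gt0) -(RintegralZl _ measurableT kern_int).
rewrite -(RintegralB measurableT ip ic); apply: eq_Rintegral => s _.
rewrite -mulrBl; congr (_ * _).
rewrite -[in RHS](sphere_mean_cst n_gt1 c x s) /sphere_mean -mulrBl; congr (_ / _).
have mc : measurable_fun setT (cst c : brV -> R) by exact: measurable_cst.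
have ig := sphere_proj_integrable n_gt1 x mg gM s.
have ic' := @sphere_proj_integrable _ _ n_gt1 x (cst c) `|c| mc (fun=> lexx _) s.
by rewrite -(RintegralB (@measurable_punctured_ball R n) ig ic').
Qed.

End potential_bounds.

(** * The mean value formula *)

Section mean_value.
Context (R : realType) (n : nat).
Hypothesis n_gt1 : (1 < n)%N.
Local Notation brV := (borel_rV R n).
Local Notation RT := (measurableTypeR R).
Local Notation leb := (@lebesgue_rV R n).
Local Notation vol := (unit_vol R n).
Local Notation B' := (@punctured_ball R n).
Local Notation mu1 := (@lebesgue_measure R).
Local Notation w := (@radial_weight R n).
Variables (Omega : set 'rV[R]_n) (x : 'rV[R]_n) (eps : R).
Hypotheses (oO : open Omega) (eps_gt0 : 0 < eps).
Hypothesis ball_sub : [set z | enorm (z - x) <= eps] `<=` Omega.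

Let n_gt0 : (0 < n)%N. Proof. exact: ltnW. Qed.
Let vol_gt0 : 0 < vol. Proof. exact: unit_vol_gt0. Qed.
Let n0 : 0 < n%:R :> R. Proof. by rewrite ltr0n. Qed.

(** v and its derivatives are controlled only in Omega. Extension by 0 off the closed ball makes
    them bounded Borel functions on the whole space, unchanged on the ball. *)
Definition ball_patch (f : 'rV[R]_n -> R) z : R :=
  if enorm (z - x) <= eps then f z else 0.

Lemma borel_ball_patch f : (forall y, Omega y -> {for y, continuous f}) ->
  measurable_fun setT (ball_patch f : brV -> R).
Proof.
move=> cf; have mO := borel_continuous_in oO cf.
pose B : set brV := [set z : 'rV[R]_n | enorm (z - x) <= eps].
have mB : measurable B by apply: borel_closed; exact: closed_enorm_le.
have -> : ball_patch f = (f : brV -> R) \_ B.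
  apply/funext => z; rewrite patchE /ball_patch; case: ifPn => [zx|zx].
    by rewrite mem_set.
  by rewrite memNset//; exact/negP.
apply: (iffLR (measurable_restrictT _ mB)).
by apply: measurable_funS mO => //; exact: borel_open.
Qed.

Lemma bounded_ball_patch f : (forall y, Omega y -> {for y, continuous f}) ->
  exists2 M, 0 <= M & forall z, `|ball_patch f z| <= M.
Proof.
move=> cf.
have [|M MP] := compact_bounded_near (g := fun z => `|f z|) (@compact_cball R n x eps).
  move=> y /ball_sub Oy; exists (`|f y| + 1).
  have := cf y Oy; move=> /(_ _ (nbhsx_ballx (f y) 1 ltr01)) ny.
  apply: (@filterS _ (nbhs y) (nbhs_filter y) _ _ _ ny) => z; rewrite /ball/= => yz.
  rewrite -[f z](subrK (f y)) (le_trans (ler_normD _ _))// addrC lerD2l.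
  by rewrite distrC ltW.
exists `|M| => // z; rewrite /ball_patch; case: ifPn => zx; last by rewrite normr0.
by rewrite (le_trans (MP z zx)) ?ler_norm.
Qed.

Lemma sphere_avg_patch f s : (forall y, Omega y -> {for y, continuous f}) ->
  0 < s -> s <= eps -> sphere_avg f x s = sphere_mean (ball_patch f) x s.
Proof.
move=> cf s0 se; rewrite -[RHS](sphere_avg_borel n_gt1 x s0 (borel_ball_patch cf)).
rewrite /sphere_avg; congr (_ / _); apply: eq_Rintegral => z /set_mem zs.
by rewrite /ball_patch zs se.
Qed.

Variable v : 'rV[R]_n -> R.
Hypothesis v_C11 : C11 Omega v.

(** [C1] is phrased through partial derivatives; continuity of v itself comes from the first-order
    expansion. *)
Lemma C1_continuous y : Omega y -> {for y, continuous v}.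
Proof.
move=> Oy; have [rho rho0 T] := C1_taylor oO v_C11.1 Oy ltr01.
pose K := 1 + \sum_(i < n) `|partial v i y|.
have K0 : 0 < K by rewrite ltr_pwDl// sumr_ge0.
have vK z : enorm (z - y) < rho -> `|v z - v y| <= K * enorm (z - y).
  move=> /T; rewrite [y + _]addrC subrK mul1r => zy.
  have gd : `|grad_dot v y (z - y)| <= (\sum_(i < n) `|partial v i y|) * enorm (z - y).
    rewrite /grad_dot mulr_suml (le_trans (ler_norm_sum _ _ _))//.
    by apply: ler_sum => i _; rewrite normrM ler_wpM2l// coord_le_enorm.
  have tri (a b : R) : `|a| <= `|a - b| + `|b| by rewrite -lerBlDr lerB_dist.
  by have := tri (v z - v y) (grad_dot v y (z - y)); rewrite mulrDl mul1r; lra.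
move=> U /nbhs_ballP[e /= e0 eU].
have m0 : 0 < Num.min rho (e / K) by rewrite lt_min rho0 divr_gt0.
apply: (@filterS _ (nbhs y) (nbhs_filter y) _ _ _ (nbhs_eball y m0)) => z.
rewrite /eball/= lt_min => /andP[zr zK]; apply: eU.
by rewrite /ball/= distrC (le_lt_trans (vK z zr))// mulrC -ltr_pdivlMr.
Qed.

Variables (g : 'rV[R]_n -> R) (M : R).
Hypotheses (mg : measurable_fun setT (g : brV -> R)) (gM : forall z, `|g z| <= M).
Hypothesis laplace_v : {ae leb, forall z, eball x eps z -> is_laplacian v z (g z)}.

Let u (i : 'I_n) := ball_patch (partial v i).
Let V := ball_patch v.
Let v_C1 := v_C11.1.

Let mu_ i : measurable_fun setT (u i : brV -> R).
Proof. by apply: borel_ball_patch => y Oy; have [] := v_C1 Oy i. Qed.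

Let mV : measurable_fun setT (V : brV -> R).
Proof. by apply: borel_ball_patch => y Oy; exact: C1_continuous. Qed.

Let uniform_bound (P : 'I_n -> R -> Prop) :
  (forall i a b, a <= b -> P i a -> P i b) -> (forall i, exists a, P i a) ->
  exists2 a, 0 <= a & forall i, P i a.
Proof.
move=> mono /choice[a Pa]; exists (\sum_i `|a i|); first exact: sumr_ge0.
move=> i; apply: mono (Pa i); rewrite (bigD1 i)//=.
by rewrite (le_trans (ler_norm _))// lerDl sumr_ge0.
Qed.

Let u_bounded : exists2 C, 0 <= C & forall i z, `|u i z| <= C.
Proof.
have [i a b ab ua z|i|C C0 uC] := uniform_bound (P := fun i a => forall z, `|u i z| <= a).
- exact: le_trans (ua z) ab.
- have [y Oy|C _ uC] := @bounded_ball_patch (partial v i); last by exists C.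
  by have [] := v_C1 Oy i.
- by exists C.
Qed.

Let u_lipschitz : exists2 L, 0 <= L & forall i a b,
  enorm (a - x) <= eps -> enorm (b - x) <= eps ->
  `|u i a - u i b| <= L * enorm (a - b).
Proof.
have [i K L KL uK a b ax bx|i|L L0 uL] := uniform_bound (P := fun i L => forall a b,
    enorm (a - x) <= eps -> enorm (b - x) <= eps ->
    `|u i a - u i b| <= L * enorm (a - b)).
- by rewrite (le_trans (uK a b ax bx))// ler_wpM2r// enorm_ge0.
- have [L uL] := locally_lipschitz_compact (v_C11.2 i) (@compact_cball R n x eps) ball_sub.
  by exists L => a b ax bx; rewrite /u /ball_patch ax bx; exact: uL.
- by exists L.
Qed.

(** Near each point of the open ball the patch coincides with the partial derivative, hence has the
    same derivatives. *)
Let div_u : {ae leb, forall z, eball x eps z ->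
  (forall i, derivable (u i) z (delta_mx 0 i)) /\
  \sum_(i < n) 'D_(delta_mx 0 i) (u i) z = g z}.
Proof.
have [A [mA A0 PA]] := laplace_v; exists A; split=> // z H.
apply: PA => lz; apply: H => zx; have [dv dg] := lz zx.
have nz i : {near z, partial v i =1 u i}.
  have := open_nbhs_nbhs (conj (@open_eball R n x eps) zx).
  apply: (@filterS _ (nbhs z) (nbhs_filter z)) => y yx.
  by rewrite /u /ball_patch ltW.
split=> [i|]; first exact: near_eq_derivable (nz i) (dv i).
rewrite -dg; apply: eq_bigr => i _; apply: near_eq_derive.
by apply: (@filterS _ (nbhs z) (nbhs_filter z) _ _ _ (nz i)) => y yE; exact: esym yE.
Qed.

Section annulus.
Variable delta : R.
Hypotheses (delta_gt0 : 0 < delta) (delta_lt : delta < eps).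

Let radial_line (d : 'rV[R]_n) : enorm d = 1 ->
  (\int[mu1]_(s in `]delta, eps[)
     (n%:R * \sum_(i < n) u i (x + s *: d) * d 0 i)%:E =
   (n%:R * (V (x + eps *: d) - V (x + delta *: d)))%:E)%E.
Proof.
move=> d1.
pose h (s : R) : R := n%:R * \sum_(i < n) u i (x + s *: d) * d 0 i.
have mh : measurable_fun setT (fun s : RT => (h s)%:E).
  apply/measurable_EFinP; apply: measurable_funM => //; apply: measurable_sum => i.
  apply: measurable_funM => //; apply: (measurableT_comp (mu_ i)).
  by apply: measurable_affine => //; exact: measurable_cst.
rewrite -[LHS]/(\int[mu1]_(s in `]delta, eps[) (h s)%:E)%E.
rewrite integral_itv_bndo_bndc; last exact: measurable_funTS.
rewrite integral_itv_obnd_cbnd; last exact: measurable_funTS.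
have inb s : delta <= s <= eps -> enorm (x + s *: d - x) <= eps.
  move=> /andP[ds se]; rewrite addrAC subrr add0r enormZ d1 mulr1 ger0_norm//.
  by rewrite (le_trans (ltW delta_gt0)).
under eq_integral => s /set_mem /=.
  rewrite in_itv/= => /inb sx.
  rewrite (_ : h s = n%:R * grad_dot v (x + s *: d) d); last first.
    by congr (_ * _); apply: eq_bigr => i _; rewrite /u /ball_patch sx.
  over.
rewrite /V /ball_patch !inb ?lexx ?(ltW delta_lt)//.
have inO s : delta <= s <= eps -> Omega (x + s *: d) by move=> /inb; exact: ball_sub.
have dF s : delta <= s <= eps -> is_derive s 1 (fun s : R => n%:R * v (x + s *: d))
    (n%:R * grad_dot v (x + s *: d) d).
  move=> /inO Os; exact: (is_deriveZ n%:R (C1_is_derive_line oO v_C1 Os)).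
have cf s : delta <= s <= eps ->
    {for s, continuous (fun s : R => n%:R * grad_dot v (x + s *: d) d)}.
  move=> /inO Os; apply: cvgM; first exact: cvg_cst.
  apply: cvg_sumr => i; apply: cvgM; last exact: cvg_cst.
  have [_ cp] := v_C1 Os i.
  apply: (@continuous_comp _ _ _ (fun s : R => x + s *: d) (partial v i)) => //.
  by apply: cvgD; [exact: cvg_cst|apply: cvgZ; [exact: cvg_id|exact: cvg_cst]].
by rewrite (integral_derive delta_lt dF cf) mulrBr.
Qed.

Lemma flux_annulus :
  (\int[leb]_z (flux x delta eps u z)%:E =
   (n%:R * vol * (sphere_mean V x eps - sphere_mean V x delta))%:E)%E.
Proof.
have [C C0 uC] := u_bounded.
pose G (p : RT * brV) : R :=
  \sum_(i < n) u i (x + (p.1 : R) *: udir (p.2 : 'rV[R]_n)) *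
    (udir (p.2 : 'rV[R]_n) 0 i * - cutoff_slope n delta eps p.1).
have m2 : measurable_fun setT (fun p : RT * brV => udir (p.2 : 'rV[R]_n) : brV).
  exact: (measurableT_comp (@measurable_udir R n) measurable_snd).
have mG : measurable_fun setT G.
  apply: measurable_sum => i; apply: measurable_funM.
    by apply: (measurableT_comp (mu_ i)); exact: measurable_affine.
  apply: measurable_funM; first exact: (measurableT_comp (borel_coord i) m2).
  apply: measurableT_comp => //.
  exact: (measurableT_comp (measurable_cutoff_slope n eps delta_gt0) measurable_fst).
have udir_le (y : 'rV[R]_n) i : `|udir y 0 i| <= 1.
  have [->|y0] := eqVneq y 0; first by rewrite /udir scaler0 mxE normr0.
  by rewrite (le_trans (coord_le_enorm _ _))// enorm_udir.
have GM p : `|G p| <= \sum_(i < n) C * delta ^- n.-1.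
  rewrite (le_trans (ler_norm_sum _ _ _))//; apply: ler_sum => i _.
  rewrite normrM ler_pM// normrM normrN -[X in _ <= X]mul1r ler_pM//.
  exact: cutoff_slope_le.
have G0 s t : eps <= s -> G (s, t) = 0.
  by move=> es; rewrite /G big1// => i _; rewrite cutoff_slope_out// oppr0 !mulr0.
have mfl := measurable_flux x eps delta_gt0 mu_.
rewrite -(integral_translate x (f := fun z => (flux x delta eps u z)%:E)); last first.
  exact/measurable_EFinP.
have -> : (\int[leb]_z (flux x delta eps u (x + z))%:E =
    \int[leb]_z (G (polar_map z))%:E)%E.
  apply: eq_integral => z _; congr EFin; apply: eq_bigr => i _.
  by rewrite /polar_map/= udir_udir scale_udir [x + z - x]addrAC subrr add0r.
rewrite (polar_bounded2 n_gt1 mG GM G0).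
have [CV CV0 VC] := bounded_ball_patch C1_continuous.
have iV s := sphere_proj_integrable n_gt1 x mV VC s.
have mB' := @measurable_punctured_ball R n.
have -> : (\int[leb]_(y in B') \int[mu1]_s (G (s, udir y) * w s)%:E =
    \int[leb]_(y in B') (n%:R%:E *
      ((V (sphere_proj x eps y))%:E - (V (sphere_proj x delta y))%:E)))%E.
  apply: eq_integral => y /set_mem[_ /eqP y0].
  rewrite -EFinB -EFinM /sphere_proj -radial_line ?enorm_udir//.
  rewrite [RHS]integral_mkcond; apply: eq_integral => s _.
  rewrite patchE mem_setE in_itv/= /G/= udir_udir /cutoff_slope.
  case: ifPn => [/andP[ds se]|_]; last first.
    by rewrite big1 ?mul0r// => i _; rewrite oppr0 !mulr0.
  have s0 : 0 < s by exact: lt_trans ds.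
  (* On the annulus the factor s^(1-n) of the flux cancels the weight n s^(n-1), leaving n times the
     radial derivative. *)
  congr EFin; rewrite radial_weight_pos ?(ltW s0)// mulrC -mulrA; congr (_ * _).
  rewrite mulr_sumr; apply: eq_bigr => i _; rewrite opprK.
  by field; rewrite expf_neq0// gt_eqF.
rewrite integralZl//; last exact: (integrableB mB' (iV eps) (iV delta)).
rewrite (integralB_EFin mB' (iV eps) (iV delta)) !(sphere_meanE n_gt1 x mV VC).
by rewrite -EFinB -EFinM -mulrBr mulrA.
Qed.

(** For s > 0, s^(n-1) times the cut-off is [kern eps s - kern delta s]: below delta the logarithms
    or powers of s cancel in the difference, and between delta and eps only the first kernel is
    present. *)
Lemma source_annulus :
  (\int[leb]_z (g z * cutoff n delta eps (enorm (z - x)))%:E =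
   (n%:R * vol * (potential g x eps - potential g x delta))%:E)%E.
Proof.
have mc : measurable_fun setT (cutoff n delta eps : RT -> R).
  apply: measurable_funB => //.
  have mclip : measurable_fun setT (clip delta eps : RT -> RT).
    by apply: measurable_minr => //; exact: measurable_maxr.
  have clip0 : clip delta eps @` setT `<=` `]0%R, +oo[%classic.
    move=> _ [s _ <-]; rewrite /= in_itv/= andbT.
    by rewrite /clip lt_min eps_gt0 lt_max delta_gt0 orbT.
  have m0 : measurable (`]0%R, +oo[%classic : set RT) by exact: measurable_itv.
  exact: (measurable_comp m0 clip0 (@measurable_lam R n) mclip).
rewrite (integral_sphere_mean n_gt1 x mg gM mc (cutoff_le n_gt1 delta_gt0 delta_lt)
  (@cutoff_out R n delta eps)).
have ie := potential_integrable n_gt1 x mg gM eps_gt0.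
have id := potential_integrable n_gt1 x mg gM delta_gt0.
have ied := integrableB measurableT ie id.
rewrite /potential -(RintegralB measurableT ie id).
rewrite -(RintegralZl _ measurableT ied) /Rintegral fineK; last first.
  exact: (integrable_fin_num measurableT (integrableZl measurableT _ ied)).
apply: eq_integral => s _; congr EFin.
have [s0|s0] := leP s 0.
  by rewrite radial_weight_neg// /kern !ltNge s0/=; ring.
rewrite radial_weight_pos ?(ltW s0)// /kern s0/=.
have [es|se] := leP eps s.
  by rewrite cutoff_out// [s < delta]ltNge (ltW (lt_le_trans delta_lt es))/=; ring.
have [ds|sd] := leP delta s.
  by rewrite cutoff_mid ?ds ?ltW//; ring.
by rewrite cutoff_in ?ltW//; ring.
Qed.

Lemma mean_value_annulus :
  sphere_mean V x eps - sphere_mean V x delta =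
  potential g x eps - potential g x delta.
Proof.
have [C C0 uC] := u_bounded; have [L L0 uL] := u_lipschitz.
have := integral_flux n_gt1 delta_gt0 delta_lt mu_ mg C0 L0
  (fun i z _ => uC i z) uL gM div_u.
rewrite source_annulus flux_annulus => -[] /mulfI H; apply/esym/H.
by rewrite mulf_neq0 ?gt_eqF.
Qed.

End annulus.

Lemma sphere_avg_potential : sphere_avg v x eps - v x = potential g x eps.
Proof.
rewrite (sphere_avg_patch C1_continuous eps_gt0 (lexx _)).
have [CV CV0 VC] := bounded_ball_patch C1_continuous.
have M0 : 0 <= M := le_trans (normr_ge0 _) (gM 0).
have Ox : Omega x by apply: ball_sub; rewrite /= subrr enorm0 ltW.
apply/eqP; rewrite -subr_eq0 -normr_le0; apply/ler_addgt0Pl => eta eta0.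
rewrite addr0.
have e2 : 0 < eta / 2 by rewrite divr_gt0.
have := C1_continuous Ox (nbhsx_ballx (v x) (eta / 2) e2).
move=> /nbhs_eballP[rho rho0 vrho].
(* The bound rho / 2 keeps the small sphere where v is within eta / 2 of v x; the bounds 1 and eta /
   (2 (M + 1)) make the potential at delta at most M delta <= eta / 2. *)
pose delta := Num.min (Num.min (rho / 2) (eps / 2)) (Num.min 1 (eta / (2 * (M + 1)))).
have M1 : 0 < M + 1 by rewrite ltr_wpDl.
have M2 : 0 < 2 * (M + 1) by rewrite mulr_gt0.
have d0 : 0 < delta by rewrite !lt_min ltr01 !divr_gt0.
have dr : delta <= rho / 2 by rewrite !ge_min lexx.
have de : delta <= eps / 2 by rewrite !ge_min lexx !orbT.
have d1 : delta <= 1 by rewrite !ge_min lexx !orbT.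
have dM : delta <= eta / (2 * (M + 1)) by rewrite !ge_min lexx !orbT.
have {}dr : delta < rho by move: dr rho0; lra.
have {}de : delta < eps by move: de eps_gt0; lra.
have E := mean_value_annulus d0 de.
have -> : sphere_mean V x eps - v x - potential g x eps =
  (sphere_mean V x delta - v x) - potential g x delta by move: E; lra.
rewrite (le_trans (ler_normB _ _))// [eta]splitr lerD//.
  apply: (sphere_mean_near n_gt1 mV VC) => z; rewrite gtr0_norm// => zd.
  have := vrho z; rewrite /eball/= zd => /(_ dr); rewrite /ball/= distrC => /ltW.
  by rewrite /V /ball_patch zd (ltW de).
rewrite (le_trans (potential_le n_gt1 x mg gM d0))//.
apply: (@le_trans _ _ (M * delta)).
  rewrite ler_wpM2l// ler_pdivrMr ?mulr_gt0// expr2 ler_pM2l//.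
  have : 1 <= n%:R :> R by rewrite ler1n.
  by move: d1; lra.
apply: (@le_trans _ _ ((M + 1) * (eta / (2 * (M + 1))))).
  by rewrite ler_pM// ?(ltW d0)// lerDl.
by rewrite le_eqVlt; apply/orP; left; apply/eqP; field; rewrite gt_eqF.
Qed.

End mean_value.

(** * Lebesgue measurable densities *)

Section transfer.
Context (R : realType) (n : nat).
Hypothesis n_gt1 : (1 < n)%N.
Local Notation brV := (borel_rV R n).
Local Notation leb := (@lebesgue_rV R n).
Local Notation lebT := (lebesgue_type R n).
Local Notation HT := (hausdorff_type R n n.-1).
Local Notation H := (@hausdorff_measure R n n.-1).
Variables (Omega : set 'rV[R]_n) (x : 'rV[R]_n) (eps : R).
Hypotheses (oO : open Omega) (eps_gt0 : 0 < eps).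

(* A segment from x to a point outside Omega would cross the boundary. *)
Lemma boundary_dist_ball : Omega x -> (eps%:E < boundary_dist Omega x)%E ->
  [set z | enorm (z - x) <= eps] `<=` Omega.
Proof.
move=> Ox eb z /= zx.
pose l (t : R) : 'rV[R]_n := x + t *: (z - x).
have cl : continuous l.
  move=> t; apply: cvgD; first exact: cvg_cst.
  by apply: cvgZ; [exact: cvg_id|exact: cvg_cst].
pose B : set R := `[0, 1]%classic `&` l @^-1` Omega.
have BE : B = `[0, 1]%classic `&` l @^-1` closure Omega.
  apply/seteqP; split=> t [t01 lt]; split=> //; first exact: subset_closure.
  apply: contrapT => nlt; move: eb; apply/negP; rewrite -leNgt.
  apply: (@le_trans _ _ (enorm (x - l t))%:E).
    apply: ereal_inf_lbound; exists (l t) => //; split=> //.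
    by rewrite (interior_id _).1.
  move: t01; rewrite /= in_itv/= => /andP[t0 t1].
  rewrite lee_fin enormC addrAC subrr add0r enormZ ger0_norm//.
  by rewrite (le_trans _ zx)// ler_piMl ?enorm_ge0.
have B1 : B = `[0, 1]%classic.
  apply: segment_connected.
  - by exists 0; split; rewrite /= ?in_itv/= ?lexx ?ler01// /l scale0r addr0.
  - by exists (l @^-1` Omega) => //; apply: open_comp => // t _; exact: cl.
  - exists (l @^-1` closure Omega) => //; apply: closed_comp.
      by move=> t _; exact: cl.
    exact: closed_closure.
have : B 1 by rewrite B1 /= in_itv/= ler01 lexx.
by move=> []; rewrite /l /= scale1r addrC subrK.
Qed.

Hypothesis ball_sub : [set z | enorm (z - x) <= eps] `<=` Omega.

(** A Borel version of f is truncated at |M|. The set [big], where truncation changes it inside the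
    ball, is Borel and contained in a union of two null sets, so it joins the exceptional set. *)
Lemma bounded_representative (f : 'rV[R]_n -> R) (M : R) :
  measurable_fun (Omega : set lebT) (f : lebT -> R) ->
  {ae leb, forall z, enorm (z - x) <= eps -> `|f z| <= M} ->
  exists g (N : set brV), [/\ measurable_fun setT (g : brV -> R),
    forall z, `|g z| <= `|M|, measurable N, leb N = 0%E &
    forall z, enorm (z - x) <= eps -> ~ N z -> f z = g z].
Proof.
move=> mf [A [mA A0 fA]].
have mO : measurable (Omega : set lebT) by apply: borel_lebesgue; exact: borel_open.
pose fO : lebT -> R := f \_ Omega.
have mfO : measurable_fun setT fO.
  by apply: (iffLR (measurable_restrictT _ mO)).
have [N [mN N0 mg]] := borel_representative mfO.
set g0 := (fun y => _) in mg.
pose C : set brV := [set z : 'rV[R]_n | enorm (z - x) <= eps].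
have mC : measurable C by apply: borel_closed; exact: closed_enorm_le.
pose big : set brV := C `&` [set z | `|M| < `|g0 z| ].
have mbig : measurable big.
  apply: measurableI => //; rewrite -[X in measurable X]setTI.
  have := measurable_fun_ltr (measurable_cst `|M|) (measurableT_comp (@normr_measurable R setT) mg).
  by move=> /(_ measurableT [set true]); apply.
have gN z : C z -> ~ N z -> g0 z = f z.
  by move=> Cz Nz; rewrite /g0 memNset// /fO patchE mem_set//; exact: ball_sub.
pose g z : R := Num.max (- `|M|) (Num.min `|M| (g0 z)).
exists g, (N `|` big); split.
- by apply: measurable_maxr => //; exact: measurable_minr.
- move=> z; rewrite ler_norml /g le_max lexx/= ge_max ge_min lexx/= andbT.
  by rewrite (le_trans _ (normr_ge0 _))// oppr_le0.
- exact: measurableU.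
- apply/eqP; rewrite -measure_le0.
  apply: (@le_trans _ _ (leb (N `|` A))); last first.
    have UA : (leb (N `|` A) <= leb N + leb A)%E.
      by apply: measureU2 => //; exact: borel_lebesgue.
    by rewrite N0 A0 adde0 in UA.
  apply: le_lebesgue => z [Nz|[Cz bz]]; first by left.
  have [Nz|Nz] := pselect (N z); [by left|right].
  apply: fA => /= /(_ Cz); rewrite -gN// => Mz.
  by move: bz => /=; rewrite ltNge (le_trans Mz)// ler_norm.
- move=> z Cz NNz; have Nz : ~ N z by move=> Nz; apply: NNz; left.
  rewrite -gN// /g; have : `|g0 z| <= `|M|.
    by rewrite leNgt; apply/negP => bz; apply: NNz; right.
  by rewrite ler_norml => /andP[h1 h2]; rewrite min_r// max_r.
Qed.

Section representative.
Variables (f g : 'rV[R]_n -> R) (M : R) (N : set brV).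
Hypotheses (mf : measurable_fun (Omega : set lebT) (f : lebT -> R))
  (mg : measurable_fun setT (g : brV -> R)) (gM : forall z, `|g z| <= M)
  (mN : measurable N) (N0 : leb N = 0%E)
  (fg : forall z, enorm (z - x) <= eps -> ~ N z -> f z = g z).

Lemma ball_int_representative : ball_int f x eps = potential g x eps.
Proof.
rewrite -(ball_int_potential n_gt1 x mg gM eps_gt0) /ball_int.
apply: eq_Rintegral => r /set_mem; rewrite /= in_itv/= => /andP[r0 re].
congr (_ * _); rewrite /ball_avg; congr (_ / _); rewrite /Rintegral; congr fine.
have bO : eball x r `<=` [set z | enorm (z - x) <= eps].
  by move=> z zr; rewrite /= (le_trans (ltW zr)).
apply: ae_eq_integral.
- by apply: borel_lebesgue; exact: borel_eball.
- apply/measurable_EFinP; apply: measurable_funS mf.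
    by apply: borel_lebesgue; exact: borel_open.
  by move=> z /bO /ball_sub.
- apply/measurable_EFinP; apply: measurable_funTS; exact: measurable_borel_lebesgue.
- exists N; split=> [||z /= nz]; [exact: borel_lebesgue|exact: N0|].
  by apply: contrapT => Nz; apply: nz => /bO zx; rewrite fg.
Qed.

(** At almost every radius N meets the sphere in a null set. There f = g almost everywhere, and
    completeness of the Caratheodory measure makes f measurable on the sphere. *)
Lemma sphere_int_representative : sphere_int f x eps = potential g x eps.
Proof.
apply: (sphere_int_potential n_gt1 mg gM).
have [A [mA A0 NA]] := ae_sphere_null n_gt1 x mN N0.
exists A; split=> // s /= ns; apply: NA => Ns; apply: ns => /andP[s0 se].
have {}Ns := Ns s0.
rewrite -[RHS](sphere_avg_borel n_gt1 x s0 mg) /sphere_avg; congr (_ / _).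
rewrite /Rintegral; congr fine.
have mS : measurable (esphere x s : set HT).
  by apply: borel_hausdorff; exact: borel_esphere.
have mgH : measurable_fun (esphere x s : set HT) (EFin \o g : HT -> \bar R).
  apply/measurable_EFinP; apply: measurable_funTS.
  exact: (measurableT_comp mg (@measurable_hausdorff_borel R n n.-1)).
have gf : ae_eq H (esphere x s) (EFin \o g) (EFin \o f).
  exists (N `&` esphere x s); split=> [||z /= nz].
  - by apply: borel_hausdorff; apply: measurableI => //; exact: borel_esphere.
  - exact: Ns.
  - have [zs nfg] : esphere x s z /\ g z <> f z.
      by apply: contrapT => h; apply: nz => zs; apply: contrapT => e;
        apply: h; split=> // e'; apply: e; rewrite e'.
    split=> //; apply: contrapT => Nz; apply: nfg; rewrite fg//.
    by rewrite zs ltW.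
have mfH : measurable_fun (esphere x s : set HT) (EFin \o f : HT -> \bar R).
  by apply: (ae_measurable_fun _ gf mgH); exact: measure_is_complete_caratheodory.
exact: (esym (ae_eq_integral _ _ mS mgH mfH gf)).
Qed.

End representative.
End transfer.

(** * Expansion and remainder estimates *)

Section expansion.
Context (R : realType) (n : nat).
Hypothesis n_gt1 : (1 < n)%N.
Local Notation brV := (borel_rV R n).
Local Notation leb := (@lebesgue_rV R n).
Local Notation lebT := (lebesgue_type R n).
Variables (Omega : set 'rV[R]_n) (v f : 'rV[R]_n -> R).
Hypotheses (oO : open Omega) (f_Linfty : Linfty_loc Omega f) (v_C11 : C11 Omega v).
Hypothesis laplace_v : {ae leb, forall x, Omega x -> is_laplacian v x (f x)}.

Let n_gt0 : (0 < n)%N. Proof. exact: ltnW. Qed.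
Let n0 : 0 < n%:R :> R. Proof. by rewrite ltr0n. Qed.

Section at_point.
Variables (x : 'rV[R]_n) (eps : R).
Hypothesis eps_gt0 : 0 < eps.
Hypothesis ball_sub : [set z | enorm (z - x) <= eps] `<=` Omega.

(** One representative g serves all the claims. As c is free, it can be the value f x even at a
    point where g differs from f, which gives the expansion at every x. *)
Lemma local_potential : exists p,
  [/\ sphere_avg v x eps - v x = p, ball_int f x eps = p, sphere_int f x eps = p &
    forall c, ball_int (fun y => f y - c) x eps = p - c * (eps ^+ 2 / (2 * n%:R)) /\
      sphere_int (fun y => f y - c) x eps = p - c * (eps ^+ 2 / (2 * n%:R))].
Proof.
have [mf fL] := f_Linfty.
have [M fM] := fL _ (@compact_cball R n x eps) ball_sub.
have [g [N [mg gM mN N0 fg]]] := bounded_representative oO ball_sub mf fM.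
have lap : {ae leb, forall z, eball x eps z -> is_laplacian v z (g z)}.
  have [A [mA A0 fA]] := laplace_v.
  have nN : leb.-negligible N by exists N; split=> //; exact: borel_lebesgue.
  have nA : leb.-negligible A by exists A; split.
  apply: negligibleS (negligibleU nN nA) => z /= nz.
  have [Nz|Nz] := pselect (N z); [by left|right].
  apply: fA => /= fz; apply: nz => zx; rewrite -fg//; last exact: ltW.
  by apply: fz; apply: ball_sub; exact: ltW.
exists (potential g x eps); split.
- exact: (sphere_avg_potential n_gt1 oO eps_gt0 ball_sub v_C11 mg gM lap).
- exact: (ball_int_representative n_gt1 oO eps_gt0 ball_sub mf mg gM mN N0 fg).
- exact: (sphere_int_representative n_gt1 mg gM mN N0 fg).
move=> c; rewrite -(potential_subr n_gt1 x mg gM eps_gt0).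
have mfc : measurable_fun (Omega : set lebT) (fun y : lebT => f y - c).
  exact: measurable_funB.
have mgc : measurable_fun setT (fun y : brV => g y - c) by exact: measurable_funB.
have gcM z : `|g z - c| <= `|M| + `|c|.
  by rewrite (le_trans (ler_normB _ _))// lerD2r.
have fgc z : enorm (z - x) <= eps -> ~ N z -> f z - c = g z - c.
  by move=> zx Nz; rewrite fg.
split.
- exact: (ball_int_representative n_gt1 oO eps_gt0 ball_sub mfc mgc gcM mN N0 fgc).
- exact: (sphere_int_representative n_gt1 mgc gcM mN N0 fgc).
Qed.

Lemma mean_value_formula :
  sphere_avg v x eps - v x = ball_int f x eps /\ ball_int f x eps = sphere_int f x eps.
Proof. by have [p [-> -> -> _]] := local_potential. Qed.

Lemma mean_value_expansion :
  sphere_avg v x eps - v x = f x / (2 * n%:R) * eps ^+ 2 + remainder f x eps /\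
  remainder f x eps = sphere_int (fun y => f y - f x) x eps.
Proof.
have [p [-> _ _ /(_ (f x))[bE sE]]] := local_potential.
by rewrite /remainder sE bE; split=> //; ring.
Qed.

(** The representative is taken for f - f x rather than for f, so that it inherits the bound C on
    the oscillation. *)
Lemma remainder_le C : (forall z, enorm (z - x) <= eps -> `|f z - f x| <= C) ->
  `|remainder f x eps| <= C * (eps ^+ 2 / (2 * n%:R)).
Proof.
move=> fC; have C0 : 0 <= C.
  by apply: le_trans (fC x _); rewrite ?normr_ge0// subrr enorm0 ltW.
have mf : measurable_fun (Omega : set lebT) (fun y : lebT => f y - f x).
  by apply: measurable_funB => //; exact: f_Linfty.1.
have fC' : {ae leb, forall z, enorm (z - x) <= eps -> `|f z - f x| <= C} by exact: aeW.
have [g [N [mg gM mN N0 fg]]] := bounded_representative oO ball_sub mf fC'.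
rewrite /remainder (ball_int_representative n_gt1 oO eps_gt0 ball_sub mf mg gM mN N0 fg).
by have := potential_le n_gt1 x mg gM eps_gt0; rewrite (ger0_norm C0).
Qed.

End at_point.

Lemma eps_sqr_le (eps : R) : eps ^+ 2 / (2 * n%:R) <= eps ^+ 2.
Proof.
rewrite ler_pdivrMr ?mulr_gt0// ler_peMr ?sqr_ge0//.
by have : 1 <= n%:R :> R by [rewrite ler1n]; lra.
Qed.

(** The estimate is uniform for x near a: the case x = a is the pointwise claim, and compactness
    extends it to the locally uniform one. *)
Lemma remainder_near (a : 'rV[R]_n) (eta : R) : Omega a -> {for a, continuous f} ->
  0 < eta -> exists2 rho, 0 < rho & forall x eps, enorm (x - a) < rho ->
    0 < eps < rho -> `|remainder f x eps| <= eta * eps ^+ 2.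
Proof.
move=> Oa fa eta0; have e2 : 0 < eta / 2 by rewrite divr_gt0.
have := fa _ (nbhsx_ballx (f a) (eta / 2) e2) => /nbhs_eballP[r r0 fr].
have /nbhs_eballP[s s0 sO] : nbhs a Omega by exact: open_nbhs_nbhs.
(* Half of the smaller radius leaves room for the sum of |x - a| and eps. *)
exists (Num.min r s / 2); first by rewrite divr_gt0// lt_min r0.
move=> x eps xa /andP[eps0 epsr].
have near_a z : enorm (z - x) <= eps -> enorm (z - a) < r /\ enorm (z - a) < s.
  move=> zx; apply/andP; rewrite -lt_min.
  by have := enormB_le x z a; move: zx xa epsr; lra.
have near_x : enorm (x - x) <= eps by rewrite subrr enorm0 ltW.
have ball_sub : [set z | enorm (z - x) <= eps] `<=` Omega.
  by move=> z /= /near_a[_]; exact: sO.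
apply: (le_trans (remainder_le (C := eta) eps0 ball_sub _)) => [z zx|].
  have /fr fz := (near_a z zx).1; have /fr fx := (near_a x near_x).1.
  move: fz fx; rewrite /ball/= => fz fx.
  rewrite [eta]splitr -(subrKA (f a)) (le_trans (ler_normD _ _))// lerD// ltW//.
  by rewrite distrC.
by rewrite ler_wpM2l ?(ltW eta0)// eps_sqr_le.
Qed.

Lemma remainder_littleo x : Omega x -> {for x, continuous f} ->
  (remainder f x : R -> R^o) =o_ ((0 : R)^'+) (fun eps : R => eps ^+ 2 : R^o).
Proof.
move=> Ox fx; apply/eqoP => eta eta0.
have [rho rho0 H] := remainder_near Ox fx eta0.
near=> eps; rewrite [leRHS](_ : _ = eta * eps ^+ 2); last first.
  by congr (_ * _); rewrite ger0_norm ?sqr_ge0.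
apply: H; first by rewrite subrr enorm0.
apply/andP; split; near: eps; [exact: nbhs_right_gt|exact: nbhs_right_lt].
Unshelve. all: by end_near. Qed.

Lemma remainder_loc_unif_littleo :
  (forall x, Omega x -> {for x, continuous f}) ->
  loc_unif_little_o Omega (fun eps x => remainder f x eps) 2.
Proof.
move=> cf K cK KO eta eta0.
(* Near-covering compactness with eps tending to 0 from the right as parameter gives one threshold
   for all of K. *)
have [|d /= d0 Hd] := (compact_near_coveringP K).1 cK R 0^'+
  (fun eps x => `|remainder f x eps| <= eta * eps ^+ 2) _.
  move=> a Ka; have [rho rho0 H] := remainder_near (KO a Ka) (cf a (KO a Ka)) eta0.
  exists (eball a rho, [set eps | 0 < eps < rho]) => /=.
    split; first exact: nbhs_eball.
    near=> eps => /=; apply/andP; split; near: eps;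
      [exact: nbhs_right_gt|exact: nbhs_right_lt].
  by move=> [x eps] /= [xa epsr]; exact: H.
exists d => // eps /andP[e0 ed]; apply/ess_supP; apply: aeW => x.
rewrite patchE; case: ifPn => [/set_mem Kx|_].
  by rewrite lee_fin; apply: Hd => //; rewrite /= sub0r normrN gtr0_norm.
by rewrite lee_fin mulr_ge0 ?sqr_ge0 ?ltW.
Unshelve. all: by end_near. Qed.

End expansion.

Theorem corollary2p4 (R : realType) (n : nat) (n_ge2 : (2 <= n)%N)
    (Omega : set 'rV[R]_n) (v f : 'rV[R]_n -> R)
    (open_Omega : open Omega) (f_Linfty : Linfty_loc Omega f)
    (v_C11 : C11 Omega v)
    (laplace_v : {ae lebesgue_rV, forall x, Omega x -> is_laplacian v x (f x)}) :
  [/\ (forall x eps, Omega x -> 0 < eps -> (eps%:E < boundary_dist Omega x)%E ->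
         sphere_avg v x eps - v x = ball_int f x eps /\
         ball_int f x eps = sphere_int f x eps),
      {ae lebesgue_rV, forall x, Omega x -> forall eps, 0 < eps ->
         (eps%:E < boundary_dist Omega x)%E ->
         sphere_avg v x eps - v x
           = f x / (2 * n%:R) * eps ^+ 2 + remainder f x eps /\
         remainder f x eps = sphere_int (fun y => f y - f x) x eps},
      (forall x, Omega x -> {for x, continuous f} ->
         (remainder f x : R -> R^o) =o_ ((0 : R)^'+) (fun eps : R => eps ^+ 2 : R^o)) /\
      ((forall x, Omega x -> {for x, continuous f}) ->
         (forall x eps, Omega x -> 0 < eps ->
            (eps%:E < boundary_dist Omega x)%E ->
            sphere_avg v x eps - v x
              = f x / (2 * n%:R) * eps ^+ 2 + remainder f x eps /\
            remainder f x eps = sphere_int (fun y => f y - f x) x eps) /\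
         loc_unif_little_o Omega (fun eps x => remainder f x eps) 2),
      (forall omega : R -> R,
         (forall t, 0 <= t -> 0 <= omega t) ->
         (forall s t, 0 <= s -> s <= t -> omega s <= omega t) ->
         omega t @[t --> 0^'+] --> 0 ->
         (forall x y, Omega x -> Omega y ->
            `|f x - f y| <= omega (enorm (x - y))) ->
         forall x eps, Omega x -> 0 < eps ->
           (eps%:E < boundary_dist Omega x)%E ->
           `|remainder f x eps| <= (2 * n%:R)^-1 * omega eps * eps ^+ 2) &
      (forall alpha : R, 0 < alpha <= 1 ->
         (exists L : R, forall x y, Omega x -> Omega y ->
            `|f x - f y| <= L * enorm (x - y) `^ alpha) ->
         exists C : R, forall x eps, Omega x -> 0 < eps ->
           (eps%:E < boundary_dist Omega x)%E ->
           `|remainder f x eps| <= C * eps `^ (2 + alpha))].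

Proof.
have n0 : n%:R != 0 :> R by rewrite pnatr_eq0 -lt0n ltnW.
have bs x eps := @boundary_dist_ball R n Omega x eps open_Omega.
have form x eps (Ox : Omega x) (e0 : 0 < eps) (eb : (eps%:E < boundary_dist Omega x)%E) :=
  mean_value_formula n_ge2 open_Omega f_Linfty v_C11 laplace_v e0 (bs x eps Ox eb).
have expa x eps (Ox : Omega x) (e0 : 0 < eps) (eb : (eps%:E < boundary_dist Omega x)%E) :=
  mean_value_expansion n_ge2 open_Omega f_Linfty v_C11 laplace_v e0 (bs x eps Ox eb).
have rem x eps C (Ox : Omega x) (e0 : 0 < eps) (eb : (eps%:E < boundary_dist Omega x)%E) :=
  @remainder_le R n n_ge2 Omega f open_Omega f_Linfty x eps e0 (bs x eps Ox eb) C.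
split.
- exact: form.
- by apply: aeW => x Ox eps; exact: expa.
- split=> [x Ox fx|cf].
    exact: (remainder_littleo n_ge2 open_Omega f_Linfty).
  split; first exact: expa.
  exact: (remainder_loc_unif_littleo n_ge2 open_Omega f_Linfty).
- move=> omega om0 omle _ fom x eps Ox e0 eb.
  rewrite (le_trans (rem x eps (omega eps) Ox e0 eb _))// => [z zx|].
    rewrite (le_trans (fom _ _ (bs x eps Ox eb z zx) Ox))//.
    by apply: omle => //; exact: enorm_ge0.
  by rewrite le_eqVlt; apply/orP; left; apply/eqP; field.
(* The absolute value of L makes the bound monotone in the distance, so its value at eps bounds the
   oscillation on the whole ball. *)
- move=> alpha /andP[a0 a1] [L fL]; exists (`|L| / (2 * n%:R)) => x eps Ox e0 eb.
  rewrite (le_trans (rem x eps (`|L| * eps `^ alpha) Ox e0 eb _))// => [z zx|].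
    rewrite (le_trans (fL _ _ (bs x eps Ox eb z zx) Ox))//.
    apply: (@le_trans _ _ (`|L| * enorm (z - x) `^ alpha)).
      by rewrite ler_wpM2r ?powR_ge0// ler_norm.
    rewrite ler_wpM2l// ge0_ler_powR ?nnegrE ?enorm_ge0// ltW//.
  rewrite powRD ?(gt_eqF e0) ?implybT// powR_mulrn ?(ltW e0)//.
  by rewrite le_eqVlt; apply/orP; left; apply/eqP; field.
Qed.
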